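(* Let $Y$ be a regular Noetherian scheme. Let $X$ be a closed subscheme of $Y$ defined by the ideal sheaf $\mathcal{J}$. Assume that $\mathcal{J}$ is locally radical. Then for any $n\ge1$ there exist $m\ge1$ and a natural closed embedding $X_{[n]}\hookrightarrow X_{(m)}$ (of closed subschemes of $Y$).
   Context: An ideal sheaf $\mathcal{J}$ on a scheme $Y$ is locally radical if $\mathcal{J}_y$ is a radical ideal of $\mathcal{O}_{Y,y}$ for every $y\in Y$. Symbolic powers. For a Noetherian ring $R$, a proper ideal $\mathfrak{a}$ and $n\ge1$, the $n$-th symbolic power is $\mathfrak{a}^{(n)}=\bigcap_{\mathfrak{p}\in\mathrm{Ass}_R(R/\mathfrak{a})}\ker\big(R\to(R/\mathfrak{a}^n)_{\mathfrak{p}}\big)$; also $R^{(n)}=R$. For an ideal sheaf $\mathcal{J}$ on a Noetherian scheme $Y$ and $y\in Y$ let $\mathcal{J}_{n,y}$ be the ideal sheaf with $\mathcal{J}_{n,y}(U)=\mathcal{O}_Y(U)$ if $y\notin U$ and $\mathcal{J}_{n,y}(U)=$ the preimage of $(\mathcal{J}_y)^{(n)}\subset\mathcal{O}_{Y,y}$ in $\mathcal{O}_Y(U)$ if $y\in U$. The $n$-th symbolic power of $\mathcal{J}$ is $\mathcal{J}^{(n)}=\bigcap_{y\in Y}\mathcal{J}_{n,y}$. For $X\subset Y$ with ideal sheaf $\mathcal{J}$, $X_{[n]}$ (the $n$-th power thickening) is the closed subscheme of $Y$ defined by $\mathcal{J}^n$, and, when $\mathcal{J}$ is locally radical, $X_{(m)}$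 (the $m$-th symbolic thickening) is the closed subscheme of $Y$ defined by $\mathcal{J}^{(m)}$. *)

(* Defs.v *)
From HB Require Import structures.
From mathcomp Require Import all_boot all_order all_algebra.
From mathcomp Require Import all_classical topology.
From mathcomp Require Import ring.
Set Implicit Arguments.
Unset Strict Implicit.
Unset Printing Implicit Defensive.

Import GRing.Theory.
Local Open Scope classical_set_scope.
Local Open Scope ring_scope.

(* Rings are commutative and may be zero (sections over the empty set are).  *)

(* Localizations, quotients by ideals and stalks are all obtained as the set *)
(* of equivalence classes of a [preRing].                                    *)
Record preRing := PreRing {
  pr_car :> Type;
  pr_eq : pr_car -> pr_car -> Prop;
  pr_zero : pr_car;
  pr_one : pr_car;
  pr_opp : pr_car -> pr_car;
  pr_add : pr_car -> pr_car -> pr_car;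
  pr_mul : pr_car -> pr_car -> pr_car;
  pr_refl : forall a, pr_eq a a;
  pr_sym : forall a b, pr_eq a b -> pr_eq b a;
  pr_trans : forall b a c, pr_eq a b -> pr_eq b c -> pr_eq a c;
  pr_oppE : forall a a', pr_eq a a' -> pr_eq (pr_opp a) (pr_opp a');
  pr_addE : forall a a' b b', pr_eq a a' -> pr_eq b b' ->
    pr_eq (pr_add a b) (pr_add a' b');
  pr_mulE : forall a a' b b', pr_eq a a' -> pr_eq b b' ->
    pr_eq (pr_mul a b) (pr_mul a' b');
  pr_addA : forall a b c,
    pr_eq (pr_add a (pr_add b c)) (pr_add (pr_add a b) c);
  pr_addC : forall a b, pr_eq (pr_add a b) (pr_add b a);
  pr_add0 : forall a, pr_eq (pr_add pr_zero a) a;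
  pr_addN : forall a, pr_eq (pr_add (pr_opp a) a) pr_zero;
  pr_mulA : forall a b c,
    pr_eq (pr_mul a (pr_mul b c)) (pr_mul (pr_mul a b) c);
  pr_mulC : forall a b, pr_eq (pr_mul a b) (pr_mul b a);
  pr_mul1 : forall a, pr_eq (pr_mul pr_one a) a;
  pr_mulD : forall a b c,
    pr_eq (pr_mul (pr_add a b) c) (pr_add (pr_mul a c) (pr_mul b c));
}.

Section QRing.
Variable G : preRing.

Definition qring : Type := {c : set G | exists g, c = pr_eq g}.
HB.instance Definition _ := gen_eqMixin qring.
HB.instance Definition _ := gen_choiceMixin qring.

Definition qcl (g : G) : qring := exist _ (pr_eq g) (ex_intro _ g erefl).
Definition qrep (c : qring) : G := sval (cid (svalP c)).

Lemma qclP g h : qcl g = qcl h <-> pr_eq g h.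
Proof.
split=> [[gh]|gh]; first by rewrite gh; exact: pr_refl.
apply: eq_exist; apply/seteqP; split=> x /=; last exact: pr_trans.
by apply: pr_trans; exact: pr_sym.
Qed.

Lemma qrepK : cancel qrep qcl.
Proof.
move=> c; rewrite /qrep; case: cid => g /= cg.
by case: c cg => c cP /= cg; apply: eq_exist.
Qed.

Lemma qclK g : pr_eq (qrep (qcl g)) g.
Proof. by apply/qclP; rewrite qrepK. Qed.

Definition q_add c d := qcl (pr_add (qrep c) (qrep d)).
Definition q_mul c d := qcl (pr_mul (qrep c) (qrep d)).
Definition q_opp c := qcl (pr_opp (qrep c)).

Lemma q_addE g h : q_add (qcl g) (qcl h) = qcl (pr_add g h).
Proof. by apply/qclP; apply: pr_addE; exact: qclK. Qed.
Lemma q_mulE g h : q_mul (qcl g) (qcl h) = qcl (pr_mul g h).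
Proof. by apply/qclP; apply: pr_mulE; exact: qclK. Qed.
Lemma q_oppE g : q_opp (qcl g) = qcl (pr_opp g).
Proof. by apply/qclP; apply: pr_oppE; exact: qclK. Qed.

Lemma q_addA : associative q_add.
Proof.
move=> a b c; rewrite -[a]qrepK -[b]qrepK -[c]qrepK !q_addE.
by apply/qclP; exact: pr_addA.
Qed.
Lemma q_addC : commutative q_add.
Proof. by move=> a b; apply/qclP; exact: pr_addC. Qed.
Lemma q_add0 : left_id (qcl (pr_zero G)) q_add.
Proof.
by move=> a; rewrite -[a]qrepK q_addE; apply/qclP; exact: pr_add0.
Qed.
Lemma q_addN : left_inverse (qcl (pr_zero G)) q_opp q_add.
Proof.
by move=> a; rewrite -[a]qrepK q_oppE q_addE; apply/qclP; exact: pr_addN.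
Qed.
Lemma q_mulA : associative q_mul.
Proof.
move=> a b c; rewrite -[a]qrepK -[b]qrepK -[c]qrepK !q_mulE.
by apply/qclP; exact: pr_mulA.
Qed.
Lemma q_mulC : commutative q_mul.
Proof. by move=> a b; apply/qclP; exact: pr_mulC. Qed.
Lemma q_mul1 : left_id (qcl (pr_one G)) q_mul.
Proof.
by move=> a; rewrite -[a]qrepK q_mulE; apply/qclP; exact: pr_mul1.
Qed.
Lemma q_mulD : left_distributive q_mul q_add.
Proof.
move=> a b c; rewrite -[a]qrepK -[b]qrepK -[c]qrepK !(q_addE, q_mulE).
by apply/qclP; exact: pr_mulD.
Qed.

HB.instance Definition _ :=
  GRing.isZmodule.Build qring q_addA q_addC q_add0 q_addN.
HB.instance Definition _ :=
  GRing.Zmodule_isComPzRing.Build qring q_mulA q_mulC q_mul1 q_mulD.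

Lemma qcl0 : qcl (pr_zero G) = 0. Proof. by []. Qed.
Lemma qcl1 : qcl (pr_one G) = 1. Proof. by []. Qed.
Lemma qclD g h : qcl (pr_add g h) = qcl g + qcl h.
Proof. exact: esym (q_addE g h). Qed.
Lemma qclM g h : qcl (pr_mul g h) = qcl g * qcl h.
Proof. exact: esym (q_mulE g h). Qed.
Lemma qclN g : qcl (pr_opp g) = - qcl g.
Proof. exact: esym (q_oppE g). Qed.
End QRing.

Definition is_unit (A : comPzRingType) (x : A) : Prop := exists y, x * y = 1.

Record ideal (A : comPzRingType) := Ideal {
  iset :> A -> Prop;
  ideal0 : iset 0;
  idealD : forall x y, iset x -> iset y -> iset (x + y);
  idealM : forall a x, iset x -> iset (a * x);
}.

Section Ideals.
Variable A : comPzRingType.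
Implicit Types (I J : ideal A) (S : set A).

Lemma idealN I x : I x -> I (- x).
Proof. by move=> Ix; rewrite -mulN1r; exact: idealM. Qed.
Lemma idealB I x y : I x -> I y -> I (x - y).
Proof. by move=> Ix Iy; apply: idealD => //; exact: idealN. Qed.

Program Definition ideal_gen S : ideal A :=
  @Ideal A [set x | forall I, S `<=` I -> I x] _ _ _.
Next Obligation. by move=> S I _; exact: ideal0. Qed.
Next Obligation.
by move=> S x y /= Sx Sy I SI; apply: idealD; [exact: Sx|exact: Sy].
Qed.
Next Obligation. by move=> S a x /= Sx I SI; apply: idealM; exact: Sx. Qed.

Definition ideal_pow I (n : nat) : ideal A :=
  ideal_gen [set \prod_(i < n) f i
            | f in [set f : 'I_n -> A | forall i, I (f i)]].

Definition proper_ideal I : Prop := (I : set A) <> setT.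

Definition radical_ideal I : Prop := forall x n, I (x ^+ n) -> I x.

Definition prime_ideal I : Prop :=
  proper_ideal I /\ forall x y, I (x * y) -> I x \/ I y.

Definition maximal_ideal I : Prop :=
  proper_ideal I /\
  forall J, I `<=` J -> proper_ideal J -> (J : set A) = I.

Definition local_ring : Prop :=
  exists2 I, maximal_ideal I & forall J, maximal_ideal J -> (J : set A) = I.

Definition noetherian_ring : Prop :=
  forall I, exists d (g : 'I_d -> A), (I : set A) = ideal_gen (range g).

Definition has_prime_chain (l : nat) : Prop :=
  exists p : nat -> ideal A,
    (forall i, (i <= l)%N -> prime_ideal (p i)) /\
    (forall i, (i < l)%N -> p i `<` p i.+1).

Definition krull_dim (d : nat) : Prop :=
  has_prime_chain d /\ forall l, has_prime_chain l -> (l <= d)%N.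

(* a Noetherian local ring whose maximal ideal is generated by d elements,   *)
(* d being its Krull dimension                                               *)
Definition regular_local_ring : Prop :=
  [/\ noetherian_ring, local_ring &
      exists d (g : 'I_d -> A),
        krull_dim d /\ maximal_ideal (ideal_gen (range g))].

End Ideals.

Section IdealPreim.
Variables (A B : comPzRingType) (f : {rmorphism A -> B}) (I : ideal B).
Program Definition ideal_preim : ideal A := @Ideal A (f @^-1` I) _ _ _.
Next Obligation. by rewrite /= rmorph0; exact: ideal0. Qed.
Next Obligation. by move=> x y /= Ix Iy; rewrite rmorphD; exact: idealD. Qed.
Next Obligation. by move=> a x /= Ix; rewrite rmorphM; exact: idealM. Qed.
End IdealPreim.

Lemma ideal_pow_morph (A B : comPzRingType) (f : {rmorphism A -> B})
    (I : ideal A) (J : ideal B) (n : nat) :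
  (forall x, I x -> J (f x)) ->
  forall x, ideal_pow I n x -> ideal_pow J n (f x).
Proof.
move=> IJ x; move/(_ (ideal_preim f (ideal_pow J n))); apply.
move=> _ [g Ig <-] K; apply => /=.
by exists (f \o g); [move=> i; exact: IJ|rewrite rmorph_prod].
Qed.

Section QuotientRing.
Variables (A : comPzRingType) (I : ideal A).

Program Definition quot_pre : preRing :=
  @PreRing A (fun x y => I (x - y)) 0 1 (fun x => - x)
    (fun x y => x + y) (fun x y => x * y) _ _ _ _ _ _ _ _ _ _ _ _ _ _.
Next Obligation. by move=> a /=; rewrite subrr; exact: ideal0. Qed.
Next Obligation. by move=> a b /= /idealN; rewrite opprB. Qed.
Next Obligation.
by move=> b a c /= ab bc; have := idealD ab bc; rewrite addrA subrK.
Qed.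
Next Obligation. by move=> a b /= /idealN; rewrite opprD. Qed.
Next Obligation.
by move=> a a' b b' /= aa bb; rewrite opprD addrACA; exact: idealD.
Qed.
Next Obligation.
move=> a a' b b' /= aa bb.
have -> : a * b - a' * b' = b * (a - a') + a' * (b - b').
  by rewrite !mulrBr [b * a]mulrC [b * a']mulrC addrA subrK.
by apply: idealD; exact: idealM.
Qed.
Next Obligation. by move=> a b c /=; rewrite addrA subrr; exact: ideal0. Qed.
Next Obligation.
by move=> a b /=; rewrite [b + a]addrC subrr; exact: ideal0.
Qed.
Next Obligation. by move=> a /=; rewrite add0r subrr; exact: ideal0. Qed.
Next Obligation. by move=> a /=; rewrite addNr subrr; exact: ideal0. Qed.
Next Obligation. by move=> a b c /=; rewrite mulrA subrr; exact: ideal0. Qed.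
Next Obligation.
by move=> a b /=; rewrite [b * a]mulrC subrr; exact: ideal0.
Qed.
Next Obligation. by move=> a /=; rewrite mul1r subrr; exact: ideal0. Qed.
Next Obligation.
by move=> a b c /=; rewrite mulrDl subrr; exact: ideal0.
Qed.

Definition quot : comPzRingType := qring quot_pre.
Definition quot_pi (x : A) : quot := @qcl quot_pre x.
Lemma quot_pi_zmod : {morph quot_pi : x y / x - y}.
Proof. by move=> x y; rewrite -(qclN (y : quot_pre)) -qclD. Qed.
Lemma quot_pi_monoid : monoid_morphism quot_pi.
Proof. by split=> [|x y] //; rewrite -qclM. Qed.
HB.instance Definition _ :=
  GRing.isZmodMorphism.Build A quot quot_pi quot_pi_zmod.
HB.instance Definition _ :=
  GRing.isMonoidMorphism.Build A quot quot_pi quot_pi_monoid.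
End QuotientRing.

Record mulset (A : comPzRingType) := MulSet {
  mset :> A -> Prop;
  mset1 : mset 1;
  msetM : forall x y, mset x -> mset y -> mset (x * y);
}.

Section Localization.
Variables (A : comPzRingType) (S : mulset A).

(* fractions x.1 / x.2 with denominator in S *)
Definition frac : Type := (A * {s : A | S s})%type.
Definition frac_mk (a s : A) (Ss : S s) : frac := (a, exist _ s Ss).
Definition den (x : frac) : A := sval x.2.
Lemma denP x : S (den x). Proof. exact: svalP. Qed.

Definition frac_eq (x y : frac) : Prop :=
  exists2 t, S t & t * (x.1 * den y) = t * (y.1 * den x).

Let addf (x y : frac) : frac :=
  frac_mk (x.1 * den y + y.1 * den x) (msetM (denP x) (denP y)).
Let mulf (x y : frac) : frac := frac_mk (x.1 * y.1) (msetM (denP x) (denP y)).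
Let oppf (x : frac) : frac := (- x.1, x.2).

Let feq x y : x.1 * den y = y.1 * den x -> frac_eq x y.
Proof. by move=> e; exists 1; [exact: mset1|rewrite e]. Qed.

Ltac frac_ring := rewrite /= /addf /mulf /oppf /frac_mk /= /den /=; ring.

Program Definition loc_pre : preRing :=
  @PreRing frac frac_eq (frac_mk 0 (mset1 S)) (frac_mk 1 (mset1 S))
    oppf addf mulf _ _ _ _ _ _ _ _ _ _ _ _ _ _.
Next Obligation. by move=> a; apply: feq. Qed.
Next Obligation. by move=> a b [t St e]; exists t. Qed.
Next Obligation.
move=> b a c [t St e1] [u Su e2]; exists (den b * (t * u)).
  by apply: msetM; [exact: denP|exact: msetM].
transitivity (u * den c * (t * (a.1 * den b))); first by ring.
rewrite e1; transitivity (t * den a * (u * (b.1 * den c))); first by ring.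
by rewrite e2; ring.
Qed.
Next Obligation.
by move=> a b [t St e]; exists t => //=; rewrite !mulNr !mulrN e.
Qed.
Next Obligation.
move=> a a' b b' [t St e1] [u Su e2]; exists (t * u); first exact: msetM.
rewrite /den /=.
transitivity (u * den b * den b' * (t * (a.1 * den a')) +
              t * den a * den a' * (u * (b.1 * den b'))).
  by rewrite /den; ring.
by rewrite e1 e2 /den; ring.
Qed.
Next Obligation.
move=> a a' b b' [t St e1] [u Su e2]; exists (t * u); first exact: msetM.
rewrite /den /=.
transitivity ((t * (a.1 * den a')) * (u * (b.1 * den b'))).
  by rewrite /den; ring.
by rewrite e1 e2 /den; ring.
Qed.
Next Obligation. by move=> a b c; apply: feq; frac_ring. Qed.
Next Obligation. by move=> a b; apply: feq; frac_ring. Qed.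
Next Obligation. by move=> a; apply: feq; frac_ring. Qed.
Next Obligation. by move=> a; apply: feq; frac_ring. Qed.
Next Obligation. by move=> a b c; apply: feq; frac_ring. Qed.
Next Obligation. by move=> a b; apply: feq; frac_ring. Qed.
Next Obligation. by move=> a; apply: feq; frac_ring. Qed.
Next Obligation. by move=> a b c; apply: feq; frac_ring. Qed.

Definition loc : comPzRingType := qring loc_pre.
Definition loc_frac (a s : A) (Ss : S s) : loc := @qcl loc_pre (frac_mk a Ss).
Definition loc_pi (a : A) : loc := loc_frac a (mset1 S).

Lemma loc_fracB a s Ss b t St :
  @loc_frac a s Ss - @loc_frac b t St =
  loc_frac (a * t - b * s) (msetM Ss St).
Proof.
rewrite /loc_frac -(qclN (frac_mk b St : loc_pre)) -qclD; apply/qclP.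
by apply: feq; frac_ring.
Qed.
Lemma loc_fracM a s Ss b t St :
  @loc_frac a s Ss * @loc_frac b t St = loc_frac (a * b) (msetM Ss St).
Proof.
rewrite /loc_frac -(qclM (frac_mk a Ss : loc_pre) (frac_mk b St)).
by apply/qclP; apply: feq; frac_ring.
Qed.
Lemma loc_frac1 : loc_frac 1 (mset1 S) = 1. Proof. by []. Qed.
End Localization.

Section MulsetImage.
Variables (A B : comPzRingType) (f : {rmorphism A -> B}) (S : mulset A).
Program Definition mulset_image : mulset B := @MulSet B (f @` S) _ _.
Next Obligation. by exists 1; [exact: mset1|rewrite rmorph1]. Qed.
Next Obligation.
by move=> _ _ [x Sx <-] [y Sy <-]; exists (x * y);
  [exact: msetM|rewrite rmorphM].
Qed.
End MulsetImage.

Record spec (A : comPzRingType) := SpecPoint {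
  spec_ideal :> ideal A;
  specP : prime_ideal spec_ideal;
}.

Section SpecPoints.
Variable A : comPzRingType.

Lemma spec1 (p : spec A) : ~ p 1.
Proof.
move=> p1; case: (specP p) => + _; apply.
by apply/seteqP; split=> // x _; rewrite -[x]mulr1; exact: idealM.
Qed.
Lemma specM (p : spec A) x y : ~ p x -> ~ p y -> ~ p (x * y).
Proof. by move=> px py /(proj2 (specP p))[]. Qed.

Definition prime_compl (p : spec A) : mulset A :=
  @MulSet A (~` p) (@spec1 p) (@specM p).

Definition loc_at (p : spec A) : comPzRingType := loc (prime_compl p).

(* p \in Ass_A (A / I): p is the annihilator of some element of A / I *)
Definition assoc_prime (I : ideal A) (p : spec A) : Prop :=
  exists x : quot I, (p : set A) = [set r | quot_pi I r * x = 0].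

(* the kernel of A -> (A / I)_p *)
Definition ker_quot_loc (I : ideal A) (p : spec A) : set A :=
  [set x | loc_pi (mulset_image (quot_pi I) (prime_compl p)) (quot_pi I x)
           = 0].

Lemma ker_quot_locP I p x :
  ker_quot_loc I p x <-> exists2 s, ~ p s & I (s * x).
Proof.
have qE (a b : A) : quot_pi I a = quot_pi I b <-> I (a - b).
  exact: (@qclP (quot_pre I)).
rewrite /ker_quot_loc /= -qcl0 /loc_pi /loc_frac; split.
  move/(@qclP (loc_pre _)) => [_ [s ps <-]] /=.
  rewrite /den /= mul0r !mulr1 mulr0 -rmorphM -(rmorph0 (quot_pi I)).
  by move/qE; rewrite subr0 => Isx; exists s.
move=> [s ps Isx]; apply/(@qclP (loc_pre _)).
exists (quot_pi I s); first by exists s.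
rewrite /den /= mul0r !mulr1 mulr0 -rmorphM -(rmorph0 (quot_pi I)).
by apply/qE; rewrite subr0.
Qed.

(* By convention the symbolic powers of the unit ideal are the unit ideal.   *)
Program Definition symbolic_pow (I : ideal A) (n : nat) : ideal A :=
  @Ideal A [set x | proper_ideal I -> forall p, assoc_prime I p ->
                    ker_quot_loc (ideal_pow I n) p x] _ _ _.
Next Obligation.
move=> I n _ p _; apply/ker_quot_locP; exists 1; first exact: spec1.
by rewrite mulr0; exact: ideal0.
Qed.
Next Obligation.
move=> I n x y /= Ix Iy pI p pass; apply/ker_quot_locP.
have /ker_quot_locP[s ps Is] := Ix pI p pass.
have /ker_quot_locP[t pt It] := Iy pI p pass.
exists (s * t); first exact: specM.
by rewrite mulrDr -mulrA mulrCA -[s * t * y]mulrA; apply: idealD; exact: idealM.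
Qed.
Next Obligation.
move=> I n a x /= Ix pI p pass; apply/ker_quot_locP.
have /ker_quot_locP[s ps Is] := Ix pI p pass.
by exists s => //; rewrite mulrCA; exact: idealM.
Qed.

End SpecPoints.

Record opens (T : topologicalType) := Opens {
  oset :> T -> Prop;
  oset_open : open oset;
}.

Definition open_setI (T : topologicalType) (U V : opens T) : opens T :=
  Opens (openI (oset_open U) (oset_open V)).

Lemma oI_l (T : topologicalType) (U V : opens T) : open_setI U V `<=` U.
Proof. by move=> x []. Qed.
Lemma oI_r (T : topologicalType) (U V : opens T) : open_setI U V `<=` V.
Proof. by move=> x []. Qed.

Record sheaf (T : topologicalType) := Sheaf {
  sec :> opens T -> comPzRingType;
  res : forall U V : opens T, V `<=` U -> {rmorphism sec U -> sec V};
  res_id : forall (U : opens T) (h : U `<=` U) (s : sec U), res h s = s;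
  res_comp : forall (U V W : opens T) (h : V `<=` U) (k : W `<=` V)
    (l : W `<=` U) (s : sec U), res k (res h s) = res l s;
  sheaf_sep : forall (U : opens T) (s t : sec U),
    (forall x, U x -> exists V : opens T, exists h : V `<=` U,
       V x /\ res h s = res h t) ->
    s = t;
  sheaf_glue : forall (U : opens T) (I : Type) (V : I -> opens T)
    (h : forall i, V i `<=` U) (s : forall i, sec (V i)),
    (forall x, U x -> exists i, V i x) ->
    (forall i j (W : opens T) (hi : W `<=` V i) (hj : W `<=` V j),
       res hi (s i) = res hj (s j)) ->
    exists t : sec U, forall i, res (h i) t = s i;
}.

Arguments res {T s U V} h : rename.

Lemma res_irr (T : topologicalType) (F : sheaf T) (U V : opens T)
  (h k : V `<=` U) (s : F U) : res h s = res k s.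
Proof. by rewrite (Prop_irrelevance h k). Qed.

Lemma resE (T : topologicalType) (F : sheaf T) (U V W : opens T)
  (h : V `<=` U) (k : W `<=` V) (s : F U) :
  res k (res h s) = res (subset_trans k h) s.
Proof. exact: res_comp. Qed.

Record ringed_space := RingedSpace {
  rs_top :> topologicalType;
  rs_sheaf : sheaf rs_top;
}.
Notation "'\O_' X" := (rs_sheaf X) (at level 8, X at level 2, format "'\O_' X").

Section Stalk.
Variables (X : ringed_space) (x : X).

Record germ_rep := GermRep {
  gr_open : opens X;
  gr_mem : gr_open x;
  gr_sec : \O_X gr_open;
}.

Definition germ_eq (a b : germ_rep) : Prop :=
  exists W : opens X, exists h : W `<=` gr_open a, exists k : W `<=` gr_open b,
    W x /\ res h (gr_sec a) = res k (gr_sec b).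

Let gadd (a b : germ_rep) : germ_rep :=
  @GermRep (open_setI (gr_open a) (gr_open b)) (conj (gr_mem a) (gr_mem b))
    (res (@oI_l _ _ _) (gr_sec a) + res (@oI_r _ _ _) (gr_sec b)).
Let gmul (a b : germ_rep) : germ_rep :=
  @GermRep (open_setI (gr_open a) (gr_open b)) (conj (gr_mem a) (gr_mem b))
    (res (@oI_l _ _ _) (gr_sec a) * res (@oI_r _ _ _) (gr_sec b)).
Let gopp (a : germ_rep) : germ_rep := GermRep (gr_mem a) (- gr_sec a).
Let top_open : opens X := Opens openT.
Let gconst (c : \O_X top_open) : germ_rep := @GermRep top_open I c.

Lemma germ_eqI (a b : germ_rep) (W : opens X) (h : W `<=` gr_open a)
    (k : W `<=` gr_open b) :
  W x -> res h (gr_sec a) = res k (gr_sec b) -> germ_eq a b.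
Proof. by move=> Wx e; exists W, h, k. Qed.

Lemma germ_eq2 (a a' b b' : germ_rep) : germ_eq a a' -> germ_eq b b' ->
  exists (W : opens X) (h : W `<=` gr_open a) (h' : W `<=` gr_open a')
    (k : W `<=` gr_open b) (k' : W `<=` gr_open b'),
    [/\ W x, res h (gr_sec a) = res h' (gr_sec a') &
        res k (gr_sec b) = res k' (gr_sec b')].
Proof.
move=> [W [h [k [Wx e]]]] [V [h' [k' [Vx e']]]].
pose hW := @oI_l _ W V; pose hV := @oI_r _ W V.
exists (open_setI W V), (subset_trans hW h), (subset_trans hW k),
  (subset_trans hV h'), (subset_trans hV k'); split.
- by [].
- by rewrite -(res_comp h hW) e; exact: res_comp.
- by rewrite -(res_comp h' hV) e'; exact: res_comp.
Qed.

Definition nb3 (a b c : germ_rep) : opens X :=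
  open_setI (gr_open a) (open_setI (gr_open b) (gr_open c)).
Lemma sub3 a b c : [/\ nb3 a b c x, nb3 a b c `<=` gr_open a,
  nb3 a b c `<=` gr_open b & nb3 a b c `<=` gr_open c].
Proof.
split; try by move=> z [? []].
by split; [|split]; exact: gr_mem.
Qed.

Lemma germ_eq3 a b c u v : nb3 a b c `<=` gr_open u ->
  nb3 a b c `<=` gr_open v ->
  (forall (W : opens X) (ha : W `<=` gr_open a) (hb : W `<=` gr_open b)
     (hc : W `<=` gr_open c) (p : W `<=` gr_open u) (q : W `<=` gr_open v),
     res p (gr_sec u) = res q (gr_sec v)) -> germ_eq u v.
Proof.
move=> p q e; have [Wx ha hb hc] := sub3 a b c.
by apply: (germ_eqI (h := p) (k := q)) => //; apply: e.
Qed.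

Ltac germ_ring a b c :=
  apply: (@germ_eq3 a b c);
  [by move=> ? [? []]; do ?split|by move=> ? [? []]; do ?split|
   let W := fresh in let ha := fresh in let hb := fresh in
   let hc := fresh in intros W ha hb hc ? ?; simpl;
   rewrite ?(rmorphD, rmorphM, rmorphN, rmorph0, rmorph1);
   rewrite ?resE ?(res_irr _ ha) ?(res_irr _ hb) ?(res_irr _ hc); ring].

Program Definition stalk_pre : preRing :=
  @PreRing germ_rep germ_eq (gconst 0) (gconst 1) gopp gadd gmul
    _ _ _ _ _ _ _ _ _ _ _ _ _ _.
Next Obligation. by move=> a; exists (gr_open a), (@subset_refl _ _), (@subset_refl _ _); split=> //; exact: gr_mem. Qed.
Next Obligation. by move=> a b [W [h [k [Wx e]]]]; exists W, k, h. Qed.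
Next Obligation.
move=> b a c [W [h [k [Wx e]]]] [V [h' [k' [Vx e']]]].
pose hW := @oI_l _ W V; pose hV := @oI_r _ W V.
exists (open_setI W V), (subset_trans hW h), (subset_trans hV k'); split=> //.
rewrite -(res_comp h hW) e -(res_comp k' hV) -e'.
by rewrite !(res_comp _ _ (subset_trans hW k)).
Qed.
Next Obligation.
move=> a b [W [h [k [Wx e]]]]; exists W, h, k; split=> //=.
by rewrite !rmorphN e.
Qed.
Next Obligation.
move=> a a' b b' aa bb; have [W [h [h' [k [k' [Wx e f]]]]]] := germ_eq2 aa bb.
have p : W `<=` gr_open (gadd a b) by move=> z Wz; split; auto.
have q : W `<=` gr_open (gadd a' b') by move=> z Wz; split; auto.
apply: (germ_eqI (h := p) (k := q)) => //=; rewrite !rmorphD.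
by rewrite !(res_comp _ _ h) !(res_comp _ _ h') !(res_comp _ _ k)
  !(res_comp _ _ k') e f.
Qed.
Next Obligation.
move=> a a' b b' aa bb; have [W [h [h' [k [k' [Wx e f]]]]]] := germ_eq2 aa bb.
have p : W `<=` gr_open (gmul a b) by move=> z Wz; split; auto.
have q : W `<=` gr_open (gmul a' b') by move=> z Wz; split; auto.
apply: (germ_eqI (h := p) (k := q)) => //=; rewrite !rmorphM.
by rewrite !(res_comp _ _ h) !(res_comp _ _ h') !(res_comp _ _ k)
  !(res_comp _ _ k') e f.
Qed.
Next Obligation.
by move=> a b c; germ_ring a b c.
Qed.
Next Obligation. by move=> a b; germ_ring a b b. Qed.
Next Obligation. by move=> a; germ_ring a a a. Qed.
Next Obligation. by move=> a; germ_ring a a a. Qed.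
Next Obligation. by move=> a b c; germ_ring a b c. Qed.
Next Obligation. by move=> a b; germ_ring a b b. Qed.
Next Obligation. by move=> a; germ_ring a a a. Qed.
Next Obligation. by move=> a b c; germ_ring a b c. Qed.

Definition stalk : comPzRingType := qring stalk_pre.
Definition germ (U : opens X) (Ux : U x) (s : \O_X U) : stalk :=
  @qcl stalk_pre (GermRep Ux s).
End Stalk.

Section GermTheory.
Variables (X : ringed_space) (x : X).

Lemma germ_res (U V : opens X) (h : V `<=` U) (Ux : U x) (Vx : V x)
  (s : \O_X U) : germ Vx (res h s) = germ Ux s.
Proof.
apply/qclP; apply: (@germ_eqI _ _ (GermRep Vx (res h s)) (GermRep Ux s) V
  (@subset_refl _ _) h) => //=.
by rewrite res_id.
Qed.

Lemma germP (U V : opens X) (Ux : U x) (Vx : V x) (s : \O_X U) (t : \O_X V) :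
  germ Ux s = germ Vx t <->
  exists W : opens X, exists h : W `<=` U, exists k : W `<=` V,
    W x /\ res h s = res k t.
Proof. exact: (@qclP (stalk_pre x)). Qed.

Lemma stalkP (a : stalk x) :
  exists (U : opens X) (Ux : U x) (s : \O_X U), a = germ Ux s.
Proof.
by rewrite -[a]qrepK; case: (qrep a : germ_rep x) => U Ux s; exists U, Ux, s.
Qed.

Variables (U : opens X) (Ux : U x).

Lemma germ_zmod : {morph @germ X x U Ux : s t / s - t}.
Proof.
move=> s t; rewrite /germ -qclN -qclD; apply/qclP.
apply: (germ_eq3 (a := GermRep Ux s) (b := GermRep Ux t)
  (c := GermRep Ux t)) => [z [? []]//|z [? []]//|W ha hb hc p q] /=.
by rewrite !rmorphD !rmorphN /= !resE; rewrite !(res_irr _ ha).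
Qed.
Lemma germ_monoid : monoid_morphism (@germ X x U Ux).
Proof.
split.
  apply/qclP; apply: (germ_eqI (W := U) (a := GermRep Ux 1)
    (b := pr_one (stalk_pre x)) (h := @subset_refl _ _) (k := fun _ _ => I)).
    exact: Ux.
  by rewrite !rmorph1.
move=> s t; rewrite /germ -qclM; apply/qclP.
apply: (germ_eq3 (a := GermRep Ux s) (b := GermRep Ux t)
  (c := GermRep Ux t)) => [z [? []]//|z [? []]//|W ha hb hc p q] /=.
by rewrite !rmorphM /= !resE !(res_irr _ ha).
Qed.
HB.instance Definition _ :=
  GRing.isZmodMorphism.Build (\O_X U) (stalk x) (@germ X x U Ux) germ_zmod.
HB.instance Definition _ :=
  GRing.isMonoidMorphism.Build (\O_X U) (stalk x) (@germ X x U Ux)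
    germ_monoid.
End GermTheory.

(* The sheaf of those families (s x)_(x in U) of elements of rings K x that  *)
(* locally belong to a prescribed class [pres] of "presentable" families.    *)
Record presentation (T : topologicalType) (K : T -> comPzRingType) :=
  Presentation {
  pres : forall U : opens T, (forall x, U x -> K x) -> Prop;
  pres_res : forall (U V : opens T) (h : V `<=` U) s, pres s ->
    @pres V (fun x Vx => s x (h x Vx));
  pres1 : forall U, @pres U (fun _ _ => 1);
  presB : forall U s t, pres s -> pres t ->
    @pres U (fun x Ux => s x Ux - t x Ux);
  presM : forall U s t, pres s -> pres t ->
    @pres U (fun x Ux => s x Ux * t x Ux);
}.

Section LocallyPresentable.
Variables (T : topologicalType) (K : T -> comPzRingType).
Variable P : presentation K.

Definition loc_presentable (U : opens T) (s : forall x, U x -> K x) : Prop :=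
  forall x, U x -> exists V : opens T, exists h : V `<=` U,
    V x /\ pres P (fun y Vy => s y (h y Vy)).

Definition lpsec (U : opens T) : Type :=
  {s : forall x, U x -> K x | loc_presentable s}.

Definition lpval U (s : lpsec U) x (Ux : U x) : K x := sval s x Ux.

Lemma lpsec_eq U (s t : lpsec U) :
  (forall x (Ux : U x), lpval s Ux = lpval t Ux) -> s = t.
Proof.
case: s t => [s sP] [t tP] st; apply: eq_exist.
by apply: functional_extensionality_dep => x;
  apply: functional_extensionality_dep => Ux; exact: st.
Qed.

Section Ops.
Variable U : opens T.
HB.instance Definition _ := gen_eqMixin (lpsec U).
HB.instance Definition _ := gen_choiceMixin (lpsec U).
Implicit Types s t : lpsec U.

Lemma lp1P : loc_presentable (fun x (_ : U x) => 1 : K x).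
Proof. by move=> x Ux; exists U, (@subset_refl _ _); split=> //; exact: pres1. Qed.

Lemma lpBP s t :
  loc_presentable (fun x (Ux : U x) => lpval s Ux - lpval t Ux).
Proof.
move=> x Ux; have [V [h [Vx Ps]]] := svalP s x Ux.
have [W [k [Wx Pt]]] := svalP t x Ux.
exists (open_setI V W), (subset_trans (@oI_l _ V W) h); split=> //.
have := presB (pres_res (@oI_l _ V W) Ps) (pres_res (@oI_r _ V W) Pt).
congr (pres P _); apply: functional_extensionality_dep => y;
  apply: functional_extensionality_dep => VWy.
by congr (_ - _); rewrite /lpval; congr (sval _ _ _).
Qed.

Lemma lpMP s t :
  loc_presentable (fun x (Ux : U x) => lpval s Ux * lpval t Ux).
Proof.
move=> x Ux; have [V [h [Vx Ps]]] := svalP s x Ux.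
have [W [k [Wx Pt]]] := svalP t x Ux.
exists (open_setI V W), (subset_trans (@oI_l _ V W) h); split=> //.
have := presM (pres_res (@oI_l _ V W) Ps) (pres_res (@oI_r _ V W) Pt).
congr (pres P _); apply: functional_extensionality_dep => y;
  apply: functional_extensionality_dep => VWy.
by congr (_ * _); rewrite /lpval; congr (sval _ _ _).
Qed.

Definition lp_one : lpsec U := exist _ _ lp1P.
Definition lp_sub s t : lpsec U := exist _ _ (lpBP s t).
Definition lp_mul s t : lpsec U := exist _ _ (lpMP s t).
Definition lp_zero : lpsec U := lp_sub lp_one lp_one.
Definition lp_opp s : lpsec U := lp_sub lp_zero s.
Definition lp_add s t : lpsec U := lp_sub s (lp_opp t).

Let oppE s x (Ux : U x) : lpval (lp_opp s) Ux = - lpval s Ux.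
Proof. by rewrite /lpval /= /lpval /= subrr sub0r. Qed.
Let addE s t x (Ux : U x) :
  lpval (lp_add s t) Ux = lpval s Ux + lpval t Ux.
Proof.
by change (lpval s Ux - lpval (lp_opp t) Ux = lpval s Ux + lpval t Ux);
  rewrite oppE opprK.
Qed.
Let zeroE x (Ux : U x) : lpval lp_zero Ux = 0.
Proof. by rewrite /lpval /= /lpval /= subrr. Qed.
Let mulE s t x (Ux : U x) :
  lpval (lp_mul s t) Ux = lpval s Ux * lpval t Ux.
Proof. by []. Qed.
Let oneE x (Ux : U x) : lpval lp_one Ux = 1. Proof. by []. Qed.
Let lpE := (addE, oppE, zeroE, mulE, oneE).

Lemma lp_addA : associative lp_add.
Proof. by move=> a b c; apply: lpsec_eq => x Ux; rewrite !lpE addrA. Qed.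
Lemma lp_addC : commutative lp_add.
Proof. by move=> a b; apply: lpsec_eq => x Ux; rewrite !lpE addrC. Qed.
Lemma lp_add0 : left_id lp_zero lp_add.
Proof. by move=> a; apply: lpsec_eq => x Ux; rewrite !lpE add0r. Qed.
Lemma lp_addN : left_inverse lp_zero lp_opp lp_add.
Proof. by move=> a; apply: lpsec_eq => x Ux; rewrite !lpE addNr. Qed.
Lemma lp_mulA : associative lp_mul.
Proof. by move=> a b c; apply: lpsec_eq => x Ux; rewrite !lpE mulrA. Qed.
Lemma lp_mulC : commutative lp_mul.
Proof. by move=> a b; apply: lpsec_eq => x Ux; rewrite !lpE mulrC. Qed.
Lemma lp_mul1 : left_id lp_one lp_mul.
Proof. by move=> a; apply: lpsec_eq => x Ux; rewrite !lpE mul1r. Qed.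
Lemma lp_mulD : left_distributive lp_mul lp_add.
Proof. by move=> a b c; apply: lpsec_eq => x Ux; rewrite !lpE mulrDl. Qed.

HB.instance Definition _ :=
  GRing.isZmodule.Build (lpsec U) lp_addA lp_addC lp_add0 lp_addN.
HB.instance Definition _ :=
  GRing.Zmodule_isComPzRing.Build (lpsec U) lp_mulA lp_mulC lp_mul1 lp_mulD.

Lemma lpvalB s t x (Ux : U x) : lpval (s - t) Ux = lpval s Ux - lpval t Ux.
Proof. by rewrite addE oppE. Qed.
Lemma lpvalM s t x (Ux : U x) : lpval (s * t) Ux = lpval s Ux * lpval t Ux.
Proof. by []. Qed.
Lemma lpval1 x (Ux : U x) : lpval (1 : lpsec U) Ux = 1.
Proof. by []. Qed.
End Ops.

Section Res.
Variables (U V : opens T) (h : V `<=` U).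

Lemma lp_resP (s : lpsec U) :
  loc_presentable (fun x (Vx : V x) => lpval s (h Vx)).
Proof.
move=> x Vx; have [W [k [Wx Ps]]] := svalP s x (h Vx).
exists (open_setI V W), (@oI_l _ V W); split=> //.
have := pres_res (@oI_r _ V W) Ps.
congr (pres P _); apply: functional_extensionality_dep => y;
  apply: functional_extensionality_dep => VWy.
by rewrite /lpval; congr (sval _ _ _).
Qed.
Definition lp_res (s : lpsec U) : lpsec V := exist _ _ (lp_resP s).
Lemma lp_res_zmod : {morph lp_res : s t / s - t}.
Proof.
move=> s t; apply: lpsec_eq => x Vx; rewrite [RHS]lpvalB.
exact: (lpvalB s t (h Vx)).
Qed.
Lemma lp_res_monoid : monoid_morphism lp_res.
Proof. by split=> [|s t]; apply: lpsec_eq. Qed.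
HB.instance Definition _ :=
  GRing.isZmodMorphism.Build (lpsec U) (lpsec V) lp_res lp_res_zmod.
HB.instance Definition _ :=
  GRing.isMonoidMorphism.Build (lpsec U) (lpsec V) lp_res lp_res_monoid.
End Res.

Program Definition lp_sheaf : sheaf T :=
  @Sheaf T (fun U => lpsec U) (fun U V h => lp_res h) _ _ _ _.
Next Obligation.
by move=> U h s; apply: lpsec_eq => x Ux; rewrite /lpval /= /lpval; congr (sval _ _ _).
Qed.
Next Obligation.
by move=> U V W h k l s; apply: lpsec_eq => x Wx; rewrite /lpval /= /lpval /= /lpval;
  congr (sval _ _ _).
Qed.
Next Obligation.
move=> U s t st; apply: lpsec_eq => x Ux.
have [V [h [Vx e]]] := st x Ux.
have := congr1 (fun r : lpsec V => lpval r Vx) e.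
by rewrite /lpval /= /lpval (Prop_irrelevance (h x Vx) Ux).
Qed.
Next Obligation.
move=> U I V h s cov comp.
have comp1 x (Ux : U x) i j (Vi : V i x) (Vj : V j x) :
    lpval (s i) Vi = lpval (s j) Vj.
  have := comp i j _ (@oI_l _ _ _) (@oI_r _ _ _).
  move/(congr1 (fun r : lpsec _ => lpval r (conj Vi Vj : open_setI (V i) (V j) x))).
  rewrite /lpval /= /lpval; move=> e.
  rewrite (Prop_irrelevance Vi (oI_l (conj Vi Vj))) e.
  by congr (sval _ _ _).
pose c x (Ux : U x) := cid (cov x Ux).
pose f x (Ux : U x) : K x := lpval (s (sval (c x Ux))) (svalP (c x Ux)).
have fE x (Ux : U x) i (Vi : V i x) : f x Ux = lpval (s i) Vi.
  exact: comp1.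
have fP : loc_presentable f.
  move=> x Ux; have [i Vi] := cov x Ux.
  have [W [k [Wx Ps]]] := svalP (s i) x Vi.
  exists W, (subset_trans k (h i)); split=> //; move: Ps.
  congr (pres P _); apply: functional_extensionality_dep => y;
    apply: functional_extensionality_dep => Wy.
  by rewrite (fE _ _ i (k y Wy)).
exists (exist _ f fP) => i; apply: lpsec_eq => x Vi.
by rewrite /lpval /= /lpval /=; exact: fE.
Qed.

End LocallyPresentable.

Section SpecTopology.
Variable A : comPzRingType.

Definition zariski_closed (E : set A) : set (spec A) := [set p | E `<=` p].

Definition zariski_open : set_system (spec A) :=
  [set U | exists E, U = ~` zariski_closed E].

Lemma zariskiT : zariski_open setT.
Proof.
exists setT; apply/seteqP; split=> p // _ /(_ 1 I); exact: spec1.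
Qed.

Lemma zariskiI : setI_closed zariski_open.
Proof.
move=> _ _ [E ->] [F ->]; exists [set e * f | e in E & f in F].
apply/seteqP; split=> p /=.
  move=> [pE pF] pEF; apply: pE => e Ee; apply: contrapT => npe.
  apply: pF => f Ff; apply: contrapT => npf.
  by apply: (specM npe npf); apply: pEF; exists e => //; exists f.
move=> pEF; split=> pE; apply: pEF => _ [e Ee [f Ff <-]].
  by rewrite mulrC; apply: idealM; exact: pE.
by apply: idealM; exact: pE.
Qed.

Lemma zariskiU (I : Type) (f : I -> set (spec A)) :
  (forall i, zariski_open (f i)) -> zariski_open (\bigcup_i f i).
Proof.
move=> fo; exists (\bigcup_i sval (cid (fo i))).
apply/seteqP; split=> p /=.
  move=> [i _]; rewrite [f i](svalP (cid (fo i))) /= => np pE; apply: np.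
  by move=> e Ee; apply: pE; exists i.
move=> np; apply: contrapT => nf; apply: np => e [i _ Ee].
apply: contrapT => npe; apply: nf; exists i => //.
by rewrite [f i](svalP (cid (fo i))) /= => /(_ e Ee).
Qed.

HB.instance Definition _ := gen_eqMixin (spec A).
HB.instance Definition _ := gen_choiceMixin (spec A).
HB.instance Definition _ :=
  isOpenTopological.Build (spec A) zariskiT zariskiI zariskiU.

Definition spec_presentable (U : opens (spec A))
    (s : forall p : spec A, U p -> loc_at p) : Prop :=
  exists a f : A, forall p (Up : U p),
    exists fp : prime_compl p f, s p Up = loc_frac a fp.

Program Definition spec_presentation :=
  @Presentation (spec A) (fun p => loc_at p) spec_presentable _ _ _ _.
Next Obligation.
by move=> U V h s [a [f e]]; exists a, f => p Vp; have := e p (h p Vp).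
Qed.
Next Obligation.
move=> U; exists 1, 1 => p Up; exists (mset1 _); exact: esym (loc_frac1 _).
Qed.
Next Obligation.
move=> U s t [a [f sE]] [b [g tE]]; exists (a * g - b * f), (f * g) => p Up.
have [fp ->] := sE p Up; have [gp ->] := tE p Up.
by exists (msetM fp gp); rewrite loc_fracB.
Qed.
Next Obligation.
move=> U s t [a [f sE]] [b [g tE]]; exists (a * b), (f * g) => p Up.
have [fp ->] := sE p Up; have [gp ->] := tE p Up.
by exists (msetM fp gp); rewrite loc_fracM.
Qed.

Definition Spec : ringed_space := RingedSpace (lp_sheaf spec_presentation).
End SpecTopology.

(* The comorphism is given as a family O_Y(V) -> O_X(U) indexed by all pairs *)
(* U, V with f(U) contained in V; this amounts to O_Y(V) -> O_X(f^-1(V)).    *)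
Record rs_mor (X Y : ringed_space) := RsMor {
  mor_fun :> X -> Y;
  mor_cont : continuous mor_fun;
  comor : forall (V : opens Y) (U : opens X), U `<=` mor_fun @^-1` V ->
    {rmorphism \O_Y V -> \O_X U};
  comor_res : forall (V V' : opens Y) (U U' : opens X)
    (hV : V' `<=` V) (hU : U' `<=` U)
    (h : U `<=` mor_fun @^-1` V) (h' : U' `<=` mor_fun @^-1` V')
    (s : \O_Y V), res hU (comor h s) = comor h' (res hV s);
}.
Arguments comor {X Y} f {V U} h : rename.

Definition open_preim (X Y : ringed_space) (f : rs_mor X Y) (V : opens Y) :
    opens X :=
  Opens (open_comp (fun x _ => @mor_cont X Y f x) (oset_open V)).

Definition comor_preim (X Y : ringed_space) (f : rs_mor X Y) (V : opens Y) :
    {rmorphism \O_Y V -> \O_X (open_preim f V)} :=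
  comor f (V := V) (U := open_preim f V) (@subset_refl _ _).

Section Composition.
Variables (X Y Z : ringed_space) (g : rs_mor Y Z) (f : rs_mor X Y).

Program Definition rs_comp : rs_mor X Z :=
  @RsMor X Z (g \o f) _
    (fun V U h => comor f (V := open_preim g V) (U := U) h \o
                  comor_preim g V)
    _.
Next Obligation.
by move=> x; apply: continuous_comp; exact: mor_cont.
Qed.
Next Obligation.
move=> V V' U U' hV hU h h' s /=.
have hg : open_preim g V' `<=` open_preim g V by move=> y; exact: hV.
by rewrite (comor_res hg hU h h') (comor_res hV hg (@subset_refl _ _) (@subset_refl _ _)).
Qed.
End Composition.

Definition rs_mor_eq (X Y : ringed_space) (f g : rs_mor X Y) : Prop :=
  (forall x, f x = g x) /\
  (forall (V : opens Y) (U : opens X) (hf : U `<=` f @^-1` V)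
     (hg : U `<=` g @^-1` V) (s : \O_Y V), comor f hf s = comor g hg s).

Definition locally_ringed (X : ringed_space) : Prop :=
  forall x : X, local_ring (stalk x).

(* the stalk maps germ s |-> germ (f^# s) are local homomorphisms            *)
Definition local_mor (X Y : ringed_space) (f : rs_mor X Y) : Prop :=
  forall (x : X) (V : opens Y) (U : opens X) (h : U `<=` f @^-1` V)
    (Ux : U x) (s : \O_Y V),
    is_unit (germ Ux (comor f h s)) -> is_unit (germ (h x Ux) s).

(* f is an isomorphism of X onto the open ringed subspace f(X) of Y          *)
Definition open_immersion (X Y : ringed_space) (f : rs_mor X Y) : Prop :=
  [/\ injective f,
      (forall U : opens X, open (f @` U)) &
      (forall (V : opens Y) (U : opens X) (h : U `<=` f @^-1` V),
         f @` U = V -> bijective (comor f h))].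

(* a homeomorphism onto a closed subset such that O_Y -> f_* O_X is          *)
(* surjective as a morphism of sheaves                                       *)
Definition closed_immersion (X Y : ringed_space) (f : rs_mor X Y) : Prop :=
  [/\ local_mor f,
      injective f /\ closed (range f),
      (forall U : opens X, exists V : opens Y, (U : set X) = f @^-1` V) &
      (forall (V : opens Y) (s : \O_X (open_preim f V)) (y : Y), V y ->
         exists (W : opens Y) (h : W `<=` V) (t : \O_Y W)
           (k : open_preim f W `<=` open_preim f V),
           W y /\ comor_preim f W t = res k s)].

Definition is_scheme (Y : ringed_space) : Prop :=
  locally_ringed Y /\
  forall y : Y, exists (A : comPzRingType) (f : rs_mor (Spec A) Y),
    open_immersion f /\ range f y.

Definition noetherian_scheme (Y : ringed_space) : Prop :=
  [/\ is_scheme Y, compact [set: Y] &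
      forall y : Y, exists (A : comPzRingType) (f : rs_mor (Spec A) Y),
        [/\ noetherian_ring A, open_immersion f & range f y]].

Definition regular_scheme (Y : ringed_space) : Prop :=
  is_scheme Y /\ forall y : Y, regular_local_ring (stalk y).

Record ideal_sheaf (Y : ringed_space) := IdealSheaf {
  isec :> forall U : opens Y, ideal (\O_Y U);
  isec_res : forall (U V : opens Y) (h : V `<=` U) s,
    isec U s -> isec V (res h s);
  isec_loc : forall (U : opens Y) (s : \O_Y U),
    (forall x, U x -> exists V : opens Y, exists h : V `<=` U,
       V x /\ isec V (res h s)) ->
    isec U s;
}.

Section IdealSheaves.
Variables (Y : ringed_space) (J : ideal_sheaf Y).

Program Definition stalk_ideal (y : Y) : ideal (stalk y) :=
  @Ideal (stalk y) [set g | exists (U : opens Y) (Uy : U y) (s : \O_Y U),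
                              J U s /\ g = germ Uy s] _ _ _.
Next Obligation.
move=> y; exists (Opens openT), I, 0.
by split; [exact: ideal0|rewrite rmorph0].
Qed.
Next Obligation.
move=> y _ _ [U [Uy [s [Js ->]]]] [V [Vy [t [Jt ->]]]].
exists (open_setI U V), (conj Uy Vy), (res (@oI_l _ U V) s + res (@oI_r _ U V) t).
split; first by apply: idealD; exact: isec_res.
by rewrite rmorphD /= (germ_res _ Uy) (germ_res _ Vy).
Qed.
Next Obligation.
move=> y a _ [V [Vy [t [Jt ->]]]]; have [U [Uy [s ->]]] := stalkP a.
exists (open_setI U V), (conj Uy Vy), (res (@oI_l _ U V) s * res (@oI_r _ U V) t).
split; first by apply: idealM; exact: isec_res.
by rewrite rmorphM /= (germ_res _ Uy) (germ_res _ Vy).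
Qed.

Definition locally_radical : Prop :=
  forall y : Y, radical_ideal (stalk_ideal y).

(* the sheaf associated with U |-> J(U)^n                                    *)
Program Definition ideal_sheaf_pow (n : nat) : ideal_sheaf Y :=
  @IdealSheaf Y
    (fun U => @Ideal (\O_Y U)
       [set s | forall x, U x -> exists V : opens Y, exists h : V `<=` U,
                  V x /\ ideal_pow (J V) n (res h s)] _ _ _) _ _.
Next Obligation.
move=> n U x Ux; exists U, (@subset_refl _ _); split=> //.
by rewrite rmorph0; exact: ideal0.
Qed.
Next Obligation.
move=> n U s t Js Jt x Ux.
have [V [h [Vx Js']]] := Js x Ux; have [W [k [Wx Jt']]] := Jt x Ux.
exists (open_setI V W), (subset_trans (@oI_l _ V W) h); split=> //.
rewrite rmorphD; apply: idealD.
  rewrite -(resE h (@oI_l _ V W)); apply: ideal_pow_morph Js' => r.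
  exact: isec_res.
rewrite (res_irr _ (subset_trans (@oI_r _ V W) k)) -(resE k (@oI_r _ V W)).
by apply: ideal_pow_morph Jt' => r; exact: isec_res.
Qed.
Next Obligation.
move=> n U a s Js x Ux; have [V [h [Vx Js']]] := Js x Ux.
by exists V, h; split=> //; rewrite rmorphM; exact: idealM.
Qed.
Next Obligation.
move=> n U V h s Js x Vx; have [W [k [Wx Js']]] := Js x (h x Vx).
exists (open_setI V W), (@oI_l _ V W); split=> //.
rewrite resE (res_irr _ (subset_trans (@oI_r _ V W) k)) -(resE k (@oI_r _ V W)).
by apply: ideal_pow_morph Js' => r; exact: isec_res.
Qed.
Next Obligation.
move=> n U s Js x Ux; have [V [h [Vx Js']]] := Js x Ux.
have [W [k [Wx Js'']]] := Js' x Vx.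
by exists W, (subset_trans k h); split=> //; rewrite -resE.
Qed.

(* sections whose germs at all y lie in the symbolic power of the stalk J_y  *)
Program Definition ideal_sheaf_sympow (n : nat) : ideal_sheaf Y :=
  @IdealSheaf Y
    (fun U => @Ideal (\O_Y U)
       [set s | forall y (Uy : U y),
                  symbolic_pow (stalk_ideal y) n (germ Uy s)] _ _ _) _ _.
Next Obligation. by move=> n U y Uy; rewrite rmorph0; exact: ideal0. Qed.
Next Obligation.
move=> n U s t Js Jt y Uy; rewrite rmorphD.
by apply: idealD; [exact: Js|exact: Jt].
Qed.
Next Obligation.
by move=> n U a s Js y Uy; rewrite rmorphM; apply: idealM; exact: Js.
Qed.
Next Obligation.
by move=> n U V h s Js y Vy; rewrite (germ_res h (h y Vy)); exact: Js.
Qed.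
Next Obligation.
move=> n U s Js y Uy; have [V [h [Vy Js']]] := Js y Uy.
by have := Js' y Vy; rewrite (germ_res h Uy).
Qed.

(* The closed subscheme defined by J: its space is the support of O_Y / J    *)
(* and its structure sheaf is the restriction of O_Y / J, realized as the    *)
(* sheaf of families of elements of O_{Y,y} / J_y that are locally induced   *)
(* by sections of O_Y.                                                       *)
Definition support : set Y := [set y | proper_ideal (stalk_ideal y)].

Definition support_space : topologicalType := set_type support.

Definition closed_sub_val : support_space -> Y := set_val.

Definition closed_sub_presentable (U : opens support_space)
    (s : forall z, U z -> quot (stalk_ideal (closed_sub_val z))) : Prop :=
  exists (V : opens Y) (t : \O_Y V) (h : U `<=` closed_sub_val @^-1` V),
    forall z (Uz : U z), s z Uz = quot_pi _ (germ (h z Uz) t).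

Program Definition closed_sub_presentation :=
  @Presentation support_space
    (fun z => quot (stalk_ideal (closed_sub_val z)))
    closed_sub_presentable _ _ _ _.
Next Obligation.
move=> U V h s [W [t [k e]]]; exists W, t, (fun z Vz => k z (h z Vz)) => z Vz.
exact: e.
Qed.
Next Obligation.
by move=> U; exists (Opens openT), 1, (fun _ _ => I) => z Uz; rewrite !rmorph1.
Qed.
Next Obligation.
move=> U s t [V [a [h sE]]] [W [b [k tE]]].
exists (open_setI V W), (res (@oI_l _ V W) a - res (@oI_r _ V W) b),
  (fun z Uz => conj (h z Uz) (k z Uz)) => z Uz.
by rewrite !rmorphB /= (germ_res _ (h z Uz)) (germ_res _ (k z Uz)) sE tE.
Qed.
Next Obligation.
move=> U s t [V [a [h sE]]] [W [b [k tE]]].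
exists (open_setI V W), (res (@oI_l _ V W) a * res (@oI_r _ V W) b),
  (fun z Uz => conj (h z Uz) (k z Uz)) => z Uz.
by rewrite !rmorphM /= (germ_res _ (h z Uz)) (germ_res _ (k z Uz)) sE tE.
Qed.

Definition closed_sub : ringed_space :=
  RingedSpace (lp_sheaf closed_sub_presentation).

Section Inclusion.
Variables (V : opens Y) (U : opens support_space).
Hypothesis h : U `<=` closed_sub_val @^-1` V.

Lemma closed_sub_comorP (t : \O_Y V) :
  loc_presentable closed_sub_presentation
    (fun z (Uz : U z) => quot_pi (stalk_ideal (closed_sub_val z))
                           (germ (h Uz) t)).
Proof.
move=> z Uz; exists U, (fun _ Uw => Uw); split=> //.
by exists V, t, h.
Qed.
Definition closed_sub_comor (t : \O_Y V) : rs_sheaf closed_sub U :=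
  exist _ _ (closed_sub_comorP t).
Lemma closed_sub_comor_zmod : {morph closed_sub_comor : s t / s - t}.
Proof.
move=> s t; apply: lpsec_eq => z Uz; rewrite [RHS]lpvalB.
by rewrite /lpval /= !rmorphB.
Qed.
Lemma closed_sub_comor_monoid : monoid_morphism closed_sub_comor.
Proof.
split=> [|s t]; apply: lpsec_eq => z Uz.
  by rewrite [RHS]lpval1 /lpval /= !rmorph1.
by rewrite [RHS]lpvalM /lpval /= !rmorphM.
Qed.
HB.instance Definition _ :=
  GRing.isZmodMorphism.Build (\O_Y V) (rs_sheaf closed_sub U)
    closed_sub_comor closed_sub_comor_zmod.
HB.instance Definition _ :=
  GRing.isMonoidMorphism.Build (\O_Y V) (rs_sheaf closed_sub U)
    closed_sub_comor closed_sub_comor_monoid.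
End Inclusion.

Program Definition closed_sub_incl : rs_mor closed_sub Y :=
  @RsMor closed_sub Y closed_sub_val _ (fun V U h => closed_sub_comor h) _.
Next Obligation. exact: initial_continuous. Qed.
Next Obligation.
move=> V V' U U' hV hU h h' s; apply: lpsec_eq => z Uz.
rewrite /lpval /= /lpval /= (germ_res hV (h z (hU z Uz))).
by congr (quot_pi _ _).
Qed.

End IdealSheaves.

(* f is a closed immersion and J is the kernel of O_Y -> f_* O_X             *)
Definition closed_subscheme_defined_by (X Y : ringed_space) (f : rs_mor X Y)
    (J : ideal_sheaf Y) : Prop :=
  [/\ is_scheme X, closed_immersion f &
      forall (V : opens Y) (s : \O_Y V),
        J V s <-> comor_preim f V s = 0].

Definition power_thickening (Y : ringed_space) (J : ideal_sheaf Y) (n : nat) :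
    ringed_space := closed_sub (ideal_sheaf_pow J n).

Definition symbolic_thickening (Y : ringed_space) (J : ideal_sheaf Y)
    (m : nat) : ringed_space := closed_sub (ideal_sheaf_sympow J m).

(* Main.v *)
(* On each stalk one has to bound the symbolic power J^(m) by J^n, with m       *)
(* uniform. On an affine chart Spec A of Y the ideal J is quasi-coherent, say   *)
(* given by I, and I^n is an intersection of primary ideals Q with radical P.   *)
(* Since Q contains a power of P and some associated prime R of I lies below P, *)
(* it is enough to bound symbolic powers of R by ordinary powers of P after     *)
(* localizing at P. Going up a saturated chain of primes reduces this to a      *)
(* regular local ring (A, m) and a prime p directly below m. There the          *)
(* generators of m form a regular sequence, so p contains a regular sequence y  *)
(* of length d - 1, where d = dim A. For x in m \ p, the quotient of A by (x^k) *)
(* and the p-saturation of (y_1^k, ...) has length at least k^d; an element f   *)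
(* of p^(k) outside m^N bounds this length by a constant times k^(d-1), because *)
(* modulo f the multiples of the leading monomial of f become redundant. Hence  *)
(* p^(k) is contained in m^N for large k.                                       *)
From HB Require Import structures.
From mathcomp Require Import all_boot all_order all_algebra.
From mathcomp Require Import all_classical topology.
From mathcomp Require Import ring.
From mathcomp Require Import zify.
Require Import Defs.
Set Implicit Arguments.
Unset Strict Implicit.
Unset Printing Implicit Defensive.

Import GRing.Theory.
Local Open Scope classical_set_scope.
Local Open Scope ring_scope.

(** * Ideals and saturation *)

(** Over Y, an inclusion of stalks of two ideal sheaves K1 and K2 at every point already yields a
    closed embedding of the subscheme of K2 into that of K1 ([sub_mor], [sub_mor_incl],
    [sub_mor_closed_immersion]). So it is enough to find one m >= 1 such that the m-th symbolic
    power of J_y lies in the n-th power of J_y for all y; this is [symbolic_sub_power_sheaf]. As X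
    is a scheme, J is quasi-coherent: on a Noetherian affine chart all J_y are extensions of one
    ideal I ([stalk_ideal_chart]). Compactness of Y reduces the search for m to one chart, where
    [symbolic_sub_uniform] finds it.

    In the chart ring, I^n has a finite primary decomposition. A component Q with radical P contains
    some P^N, and P contains an associated prime R of I. Symbolic powers of I lie in those of R, so
    it suffices that R^(m) is contained in P^(N) for large m. This comparison, [symbolic_sub_power],
    is made one step of a saturated chain of primes at a time. The single step is
    [symbolic_sub_adjacent]: in a regular local ring with maximal ideal m, for a prime p directly
    below m, every m^N contains some p^(k).

    That step compares growth rates in dimension d + 1. Depth theory ([regular_prime_depth],
    [regular_seq_in]) gives a regular sequence of length d inside p. Take the ideal of its k-th
    powers, saturate at p and add x^k with x in m outside p: the quotient has length at least
    k^(d+1) ([length_ge_adj_exp], [length_ge_parameter]). An f in p^(k) outside m^N has a power,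
    with exponent independent of k, that vanishes there; discarding the multiples of its leading
    monomial bounds the length by a constant times k^d ([length_le_hypersurface]). For large k this
    is absurd. *)

Section IdealBasics.
Variable A : comPzRingType.
Implicit Types (I J K L : ideal A) (x y z : A).

Lemma ideal_ext I J : (forall x, I x <-> J x) -> I = J.
Proof.
case: I => I a b c; case: J => J d e f /= IJ.
have ? : I = J by apply/seteqP; split=> x /IJ.
by subst J; congr Ideal; exact: Prop_irrelevance.
Qed.

Lemma idealMr I x a : I x -> I (x * a).
Proof. by rewrite mulrC; exact: idealM. Qed.

Lemma ideal_eqm I x y : I (x - y) -> I y -> I x.
Proof. by move=> Ixy /(idealD Ixy); rewrite subrK. Qed.

Lemma ideal_sum I (T : Type) (r : seq T) (P : pred T) (F : T -> A) :
  (forall t, P t -> I (F t)) -> I (\sum_(t <- r | P t) F t).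
Proof. by move=> IF; elim/big_ind: _ => //; [exact: ideal0|exact: idealD]. Qed.

Lemma proper1 I : proper_ideal I <-> ~ I 1.
Proof.
split=> [pI I1|nI1 E]; last by apply: nI1; rewrite E.
by apply: pI; apply/seteqP; split=> // x _; rewrite -[x]mulr1; exact: idealM.
Qed.

Lemma gen_mem (S : set A) x : S x -> ideal_gen S x.
Proof. by move=> Sx I; apply. Qed.

Lemma gen_min (S : set A) I : S `<=` I -> ideal_gen S `<=` I.
Proof. by move=> SI x; apply. Qed.

Definition ideal_top : ideal A :=
  @Ideal A setT I (fun _ _ _ _ => I) (fun _ _ _ => I).
Program Definition ideal_bot : ideal A := @Ideal A [set 0] _ _ _.
Next Obligation. by []. Qed.
Next Obligation. by move=> x y -> ->; rewrite addr0. Qed.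
Next Obligation. by move=> a x ->; rewrite mulr0. Qed.

(** The sum I + (y), with the coefficient of y as an explicit witness; [iadjs] iterates it over a
    list of generators. *)
Program Definition iadj I y : ideal A :=
  @Ideal A [set x | exists a, I (x - a * y)] _ _ _.
Next Obligation. by move=> I y; exists 0; rewrite mul0r subr0; exact: ideal0. Qed.
Next Obligation.
move=> I y u v [a Ia] [b Ib]; exists (a + b).
by have := idealD Ia Ib; congr (iset _ _); ring.
Qed.
Next Obligation.
by move=> I y c u [a Ia]; exists (c * a); rewrite -mulrA -mulrBr; exact: idealM.
Qed.

Lemma iadj_sub I y : I `<=` iadj I y.
Proof. by move=> x Ix; exists 0; rewrite mul0r subr0. Qed.
Lemma iadj_mem I y : iadj I y y.
Proof. by exists 1; rewrite mul1r subrr; exact: ideal0. Qed.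
Lemma iadj_memM I y a : iadj I y (a * y).
Proof. by apply: idealM; exact: iadj_mem. Qed.
Lemma iadj_min I J y : I `<=` J -> J y -> iadj I y `<=` J.
Proof.
by move=> IJ Jy x [a /IJ Jx]; apply: ideal_eqm Jx _; exact: idealM.
Qed.
Lemma iadj_mono I J y : I `<=` J -> iadj I y `<=` iadj J y.
Proof.
move=> IJ; apply: iadj_min; last exact: iadj_mem.
exact: subset_trans IJ (@iadj_sub _ _).
Qed.
Lemma iadj_id I y : I y -> iadj I y = I.
Proof.
move=> Iy; apply: ideal_ext => x; split; last exact: iadj_sub.
exact: iadj_min.
Qed.
Lemma iadjC I x y : iadj (iadj I x) y = iadj (iadj I y) x.
Proof.
have H u v : iadj (iadj I u) v `<=` iadj (iadj I v) u.
  apply: iadj_min; last by apply: iadj_sub; exact: iadj_mem.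
  apply: iadj_min; last exact: iadj_mem.
  exact: subset_trans (@iadj_sub _ _) (@iadj_sub _ _).
by apply: ideal_ext => z; split; exact: H.
Qed.

Definition iadjs I (l : seq A) : ideal A := foldl iadj I l.

Lemma iadjs_sub I l : I `<=` iadjs I l.
Proof.
elim: l I => [|y l IH] I //=.
exact: subset_trans (@iadj_sub _ _) (IH _).
Qed.
Lemma iadjs_mem I l y : y \in l -> iadjs I l y.
Proof.
elim: l I => [//|z l IH] I; rewrite inE => /predU1P[->|yl] /=; last exact: IH.
by apply: iadjs_sub; exact: iadj_mem.
Qed.
Lemma iadjs_min I J l : I `<=` J -> (forall y, y \in l -> J y) ->
  iadjs I l `<=` J.
Proof.
elim: l I => [//|y l IH] I IJ lJ /=; apply: IH.
  by apply: iadj_min => //; apply: lJ; rewrite inE eqxx.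
by move=> z zl; apply: lJ; rewrite inE zl orbT.
Qed.

(** The colon ideal (I : S). Its use below is to turn an inclusion of products into an inclusion of
    ideals that can be checked on generators. *)
Program Definition iquo I (S : set A) : ideal A :=
  @Ideal A [set x | forall s, S s -> I (x * s)] _ _ _.
Next Obligation. by move=> I S s _; rewrite mul0r; exact: ideal0. Qed.
Next Obligation.
by move=> I S x y /= Ix Iy s Ss; rewrite mulrDl; apply: idealD; auto.
Qed.
Next Obligation.
by move=> I S a x /= Ix s Ss; rewrite -mulrA; apply: idealM; auto.
Qed.

Lemma pow_prod I n (f : 'I_n -> A) :
  (forall i, I (f i)) -> ideal_pow I n (\prod_i f i).
Proof. by move=> If; apply: gen_mem; exists f. Qed.

Lemma pow0 I x : ideal_pow I 0 x.
Proof.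
rewrite -[x]mulr1; apply: idealM.
have -> : 1 = \prod_(i < 0) (fun=> 0 : A) i by rewrite big_ord0.
by apply: pow_prod => -[].
Qed.

Lemma pow_mono I J n : I `<=` J -> ideal_pow I n `<=` ideal_pow J n.
Proof.
move=> IJ; apply: gen_min => _ [f If <-]; apply: pow_prod => i.
exact: IJ (If i).
Qed.

Lemma powS_min I J n :
  (forall a b, I a -> ideal_pow I n b -> J (a * b)) -> ideal_pow I n.+1 `<=` J.
Proof.
move=> IJ; apply: gen_min => _ [f If <-]; rewrite big_ord_recl.
by apply: IJ (If _) _; apply: pow_prod => i; exact: If.
Qed.

Lemma powD I a b x y : ideal_pow I a x -> ideal_pow I b y ->
  ideal_pow I (a + b) (x * y).
Proof.
move=> Ix; move: y.
suff H : ideal_pow I b `<=` iquo (ideal_pow I (a + b)) (ideal_pow I a).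
  by move=> y /H /(_ x Ix); rewrite mulrC.
apply: gen_min => _ [g Ig <-] u /=; rewrite mulrC.
suff K : ideal_pow I a `<=` iquo (ideal_pow I (a + b)) [set \prod_i g i].
  by move=> /K; exact.
apply: gen_min => _ [f If <-] _ ->.
pose h (i : 'I_(a + b)) := match fintype.split i with inl j => f j | inr j => g j end.
have -> : (\prod_i f i) * (\prod_i g i) = \prod_i h i.
  rewrite big_split_ord /=; congr (_ * _); apply: eq_bigr => i _; rewrite /h.
    by rewrite (unsplitK (inl i)).
  by rewrite (unsplitK (inr i)).
by apply: pow_prod => i; rewrite /h; case: (fintype.split i).
Qed.

Lemma powD_min I J a b :
  (forall x y, ideal_pow I a x -> ideal_pow I b y -> J (x * y)) ->
  ideal_pow I (a + b) `<=` J.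
Proof.
move=> IJ; apply: gen_min => _ [f If <-]; rewrite big_split_ord /=.
by apply: IJ; apply: pow_prod => i; exact: If.
Qed.

Lemma pow1 I x : I x -> ideal_pow I 1 x.
Proof.
move=> Ix; have -> : x = \prod_(i < 1) (fun=> x) i by rewrite big_ord1.
exact: pow_prod.
Qed.

Lemma powS I n x y : I x -> ideal_pow I n y -> ideal_pow I n.+1 (x * y).
Proof. by move=> /pow1 Ix Iy; exact: powD Ix Iy. Qed.

Lemma pow_expr I n x : I x -> ideal_pow I n (x ^+ n).
Proof.
by move=> Ix; elim: n => [|n IH]; [exact: pow0|rewrite exprS; exact: powS].
Qed.

Lemma pow_leq I a b : (a <= b)%N -> ideal_pow I b `<=` ideal_pow I a.
Proof.
elim: b => [|b IH] in a *; first by rewrite leqn0 => /eqP->.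
case: a => [|a] ab; first by move=> x _; exact: pow0.
apply: powS_min => x y Ix Iy; apply: powS => //.
exact: IH Iy.
Qed.

Lemma pow_pow_expr I a n x : ideal_pow I a x -> ideal_pow I (a * n) (x ^+ n).
Proof.
move=> Ix; elim: n => [|n IH]; first by rewrite muln0; exact: pow0.
by rewrite exprS mulnS; exact: powD.
Qed.

Lemma prime_pow I (p : ideal A) n :
  prime_ideal p -> ideal_pow I n `<=` p -> I `<=` p.
Proof.
move=> [/proper1 p1 pM] Ip x Ix; have := Ip _ (pow_expr (n := n) Ix).
elim: n {Ip} => [|n IH]; first by rewrite expr0.
by rewrite exprS => /pM[].
Qed.

Lemma primeX (p : ideal A) n x : prime_ideal p -> p (x ^+ n) -> p x.
Proof.
move=> [/proper1 p1 pM]; elim: n => [|n IH]; first by rewrite expr0.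
by rewrite exprS => /pM[].
Qed.

Lemma primeM (p : ideal A) x y : prime_ideal p -> ~ p x -> ~ p y -> ~ p (x * y).
Proof. by move=> [_ pM] px py /pM[]. Qed.

Lemma prime1 (p : ideal A) : prime_ideal p -> ~ p 1.
Proof. by move=> [/proper1]. Qed.

(* the preimage in A of the extension of I to the localization at p *)
Definition sat_set (p : ideal A) I : set A := [set x | exists2 s, ~ p s & I (s * x)].

Section Saturation.
Variables (p : ideal A) (pP : prime_ideal p).

Program Definition sat I : ideal A := @Ideal A (sat_set p I) _ _ _.
Next Obligation.
by move=> I; exists 1; [exact: prime1|rewrite mulr0; exact: ideal0].
Qed.
Next Obligation.
move=> I x y [s ps Ix] [t pt Iy]; exists (s * t); first exact: primeM.
rewrite mulrDr -mulrA [s * (t * x)]mulrCA -[s * t * y]mulrA.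
by apply: idealD; exact: idealM.
Qed.
Next Obligation.
by move=> I a x [s ps Ix]; exists s => //; rewrite mulrCA; exact: idealM.
Qed.

Lemma sat_sub I : I `<=` sat I.
Proof. by move=> x Ix; exists 1; [exact: prime1|rewrite mul1r]. Qed.
Lemma sat_mono I J : I `<=` J -> sat I `<=` sat J.
Proof. by move=> IJ x [s ps /IJ]; exists s. Qed.
Lemma satK I s x : ~ p s -> sat I (s * x) -> sat I x.
Proof.
by move=> ps [t pt It]; exists (t * s); [exact: primeM|rewrite -mulrA].
Qed.
Lemma sat_min I J : (forall s x, ~ p s -> J (s * x) -> J x) ->
  I `<=` J -> sat I `<=` J.
Proof. by move=> Js IJ x [s ps /IJ]; exact: Js. Qed.
Lemma sat_satl I J : I `<=` sat J -> sat I `<=` sat J.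
Proof. by apply: sat_min => s x; exact: satK. Qed.
Lemma sat_prime (q : ideal A) : prime_ideal q -> q `<=` p -> sat q `<=` q.
Proof.
by move=> [_ qM] qp; apply: sat_min => // s x ps /qM[/qp|].
Qed.
End Saturation.

End IdealBasics.

(** * Noetherian rings *)

HB.instance Definition _ (A : comPzRingType) := gen_eqMixin (ideal A).

(** * Primes avoiding a multiplicative set *)

Section PrimeExistence.
Variable A : comPzRingType.
Implicit Types (I J K L p q : ideal A) (x y z : A).

(** The class of y is a nonzerodivisor on A / I, where A / I = 0 is allowed. *)
Definition nzd I y := forall a, I (y * a) -> I a.

(** Zorn's lemma is applied to the sets X such that I and X together generate an ideal missing S. By
    maximality, adding any z outside q makes the ideal meet S; if x y were in q with x and y
    outside, the two elements of S so obtained would multiply into q. *)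
Lemma prime_disjoint I (S : A -> Prop) : S 1 ->
  (forall x y, S x -> S y -> S (x * y)) -> (forall x, S x -> ~ I x) ->
  exists q, [/\ prime_ideal q, I `<=` q & forall x, S x -> ~ q x].
Proof.
move=> S1 SM SI.
pose P (X : set A) := forall x, S x -> ~ ideal_gen (I `|` X) x.
have [|Q [PQ Qmax]] := @Zorn_bigcup A P.
  move=> F FP Ftot x Sx.
  (* The disjunct [I y] covers the empty chain F. *)
  pose E := [set y | I y \/ exists2 X, F X & ideal_gen (I `|` X) y].
  have E0 : E 0 by left; exact: ideal0.
  have IX X y : I y -> ideal_gen (I `|` X) y by move=> Iy; apply: gen_mem; left.
  have ED y z : E y -> E z -> E (y + z).
    move=> [Iy|[X FX Xy]] [Iz|[Z FZ Zz]].
    - by left; exact: idealD.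
    - by right; exists Z => //; apply: idealD => //; exact: IX.
    - by right; exists X => //; apply: idealD => //; exact: IX.
    - right; have [XZ|ZX] := Ftot _ _ FX FZ.
        exists Z => //; apply: idealD => //; move: y Xy; apply: gen_min => y.
        by move=> [Iy|/XZ Zy]; apply: gen_mem; [left|right].
      exists X => //; apply: idealD => //; move: z Zz; apply: gen_min => z.
      by move=> [Iz|/ZX Xz]; apply: gen_mem; [left|right].
  have EM c y : E y -> E (c * y).
    move=> [Iy|[X FX Xy]]; first by left; exact: idealM.
    by right; exists X => //; exact: idealM.
  suff H : ideal_gen (I `|` \bigcup_(X in F) X) `<=` Ideal E0 ED EM.
    by move=> /H[/(SI _ Sx)//|[X /FP PX]]; exact: PX.
  apply: gen_min => y [Iy|[X FX Xy]]; first by left.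
  by right; exists X => //; apply: gen_mem; right.
pose q := ideal_gen (I `|` Q); exists q.
have Iq : I `<=` q by move=> x Ix; apply: gen_mem; left.
split=> //; split; first by apply/proper1; exact: PQ.
move=> x y qxy; apply: contrapT => /not_orP[qx qy].
have meet z : ~ q z -> exists2 s, S s & iadj q z s.
  move=> qz; apply: contrapT => H; apply: (Qmax (Q `|` [set z])).
    split; first by left.
    by move=> /(_ z (or_intror erefl)) Qz; apply: qz; apply: gen_mem; right.
  move=> s Ss sQ; apply: H; exists s => //; move: s {Ss} sQ; apply: gen_min.
  move=> s [Is|[Qs|->]]; last exact: iadj_mem.
    by apply: iadj_sub; exact: Iq.
  by apply: iadj_sub; apply: gen_mem; right.
have [s Ss [a qa]] := meet x qx; have [t St [b qb]] := meet y qy.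
apply: (PQ _ (SM _ _ Ss St)).
have -> : s * t = t * (s - a * x) + a * x * (t - b * y) + a * b * (x * y) by ring.
by apply: idealD; [apply: idealD|]; exact: idealM.
Qed.

Lemma nilpotent_of_primes I a :
  (forall q, prime_ideal q -> I `<=` q -> q a) -> exists n, I (a ^+ n).
Proof.
move=> H; apply: contrapT => /forallNP Ia.
have [||_ [n ->]|q [qP Iq qa]] := @prime_disjoint I (fun x => exists n, x = a ^+ n).
- by exists 0%N.
- by move=> _ _ [i ->] [j ->]; exists (i + j)%N; rewrite exprD.
- exact: Ia.
by apply: (qa a); [exists 1%N|exact: H].
Qed.

(** The multiplicative set consists of the s * a ^+ n with s outside p: a prime missing it lies
    inside p and omits a. *)
Lemma prime_below p I a : prime_ideal p ->
  (forall s n, ~ p s -> ~ I (s * a ^+ n)) ->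
  exists q, [/\ prime_ideal q, I `<=` q, q `<=` p & ~ q a].
Proof.
move=> pP H.
have [||x [s [n [ps ->]]]|q [qP Iq qS]] := @prime_disjoint I
    (fun x => exists s n, ~ p s /\ x = s * a ^+ n).
- by exists 1, 0%N; rewrite mul1r; split=> //; exact: prime1.
- move=> _ _ [s [m [ps ->]]] [t [n [pt ->]]].
  by exists (s * t), (m + n)%N; rewrite exprD mulrACA; split=> //; exact: primeM.
- exact: H.
exists q; split=> // [x qx|qa].
  by apply: contrapT => px; apply: (qS x) => //; exists x, 0%N; rewrite mulr1.
by apply: (qS a) => //; exists 1, 1%N; rewrite mul1r; split=> //; exact: prime1.
Qed.

(** A nonzerodivisor on A / I lies in no minimal prime over I. *)
Lemma prime_smaller q I y : prime_ideal q -> I `<=` q -> q y -> nzd I y ->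
  exists q', [/\ prime_ideal q', I `<=` q', q' `<=` q & ~ q' y].
Proof.
move=> qP Iq qy Iy; apply: prime_below => // s n qs.
elim: n => [|n IH]; first by rewrite mulr1 => /Iq.
by rewrite exprS mulrCA => /Iy.
Qed.

End PrimeExistence.

Section Noetherian.
Variable A : comPzRingType.
Hypothesis noethA : noetherian_ring A.
Implicit Types (I J K L p q : ideal A) (x y z : A).

Lemma noeth_acc (c : nat -> ideal A) :
  (forall n, c n `<=` c n.+1) -> exists n, c n.+1 `<=` c n.
Proof.
move=> cS; have cle m n : (m <= n)%N -> c m `<=` c n.
  elim: n => [|n IH]; first by rewrite leqn0 => /eqP->.
  rewrite leq_eqVlt => /predU1P[->//|/IH]; move/subset_trans; apply; exact: cS.
have U0 : [set x | exists n, c n x] 0 by exists 0%N; exact: ideal0.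
have UD x y : [set x | exists n, c n x] x -> [set x | exists n, c n x] y ->
    [set x | exists n, c n x] (x + y).
  move=> [m cx] [n cy]; exists (maxn m n); apply: idealD.
    by apply: cle cx; exact: leq_maxl.
  by apply: cle cy; exact: leq_maxr.
have UM a x : [set x | exists n, c n x] x -> [set x | exists n, c n x] (a * x).
  by move=> [n cx]; exists n; exact: idealM.
have [d [g UE]] := noethA (Ideal U0 UD UM).
have gU i : exists n, c n (g i).
  suff : (Ideal U0 UD UM : set A) (g i) by [].
  by rewrite UE; apply: gen_mem; exists i.
pose k i := sval (cid (gU i)); have kP i : c (k i) (g i) := svalP (cid (gU i)).
exists (\max_i k i) => x cx.
have : (Ideal U0 UD UM : set A) x by exists (\max_i k i).+1.
rewrite UE; apply: gen_min => _ [i _ <-].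
by apply: cle (kP i); exact: leq_bigmax.
Qed.

Lemma noeth_max (P : ideal A -> Prop) I : P I ->
  exists2 J, P J & forall K, P K -> J `<=` K -> K = J.
Proof.
move=> PI; apply: contrapT => nmax.
have step (c : {J | P J}) : {d : {J | P J} |
    sval c `<=` sval d /\ ~ (sval d `<=` sval c)}.
  apply: cid; case: c => J PJ /=; apply: contrapT => H; apply: nmax.
  exists J => // K PK JK; apply: ideal_ext => x; split; last exact: JK.
  move: x; apply: contrapT => KJ.
  by apply: H; exists (exist _ K PK).
pose c n := iter n (fun c => sval (step c)) (exist _ I PI).
have [n] := noeth_acc (c := fun n => sval (c n))
  (fun n => proj1 (svalP (step (c n)))).
exact: (proj2 (svalP (step (c n)))).
Qed.

Lemma noeth_ind (P : ideal A -> Prop) :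
  (forall I, (forall J, I `<=` J -> ~ (J `<=` I) -> P J) -> P I) ->
  forall I, P I.
Proof.
move=> Pind I; apply: contrapT => nPI.
have [J nPJ Jmax] := noeth_max (P := fun I => ~ P I) nPI.
apply: nPJ; apply: Pind => K JK KJ; apply: contrapT => nPK.
by apply: KJ; rewrite (Jmax K).
Qed.

Lemma noeth_fg I : exists l : seq A, I = iadjs (ideal_bot A) l.
Proof.
have [d [g Ig]] := noethA I; exists [seq g i | i <- enum 'I_d].
apply: ideal_ext => x; have -> : I x = ideal_gen (range g) x by rewrite -Ig.
split.
  apply: gen_min => _ [i _ <-]; apply: iadjs_mem.
  by apply: map_f; rewrite mem_enum.
apply: iadjs_min => [y ->|y /mapP[i _ ->]]; first exact: ideal0.
by apply: gen_mem; exists i.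
Qed.

(** The annihilator of the class of z in A / I; the associated primes of I are those [ann I z] that
    are prime. *)
Definition ann I z : ideal A := iquo I [set z].

Lemma annE I z x : ann I z x <-> I (x * z).
Proof. by split=> [|H _ ->//]; exact. Qed.

(** A largest annihilator among the nonzero multiples of z is prime: if y r z is not in I, its
    annihilator contains that of r z, hence equals it. *)
Lemma ass_above I z : ~ I z ->
  exists r, ~ I (r * z) /\ prime_ideal (ann I (r * z)).
Proof.
move=> Iz.
have [|_ [r [Irz ->]] qmax] := @noeth_max
    (fun q => exists r, ~ I (r * z) /\ q = ann I (r * z)) (ann I (1 * z)).
  by exists 1; rewrite mul1r.
exists r; split=> //; split; first by apply/proper1; rewrite annE mul1r.
move=> x y /annE Ixy; have [Iy|Iy] := pselect (I (y * (r * z))).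
  by right; apply/annE.
left; rewrite -(qmax (ann I (y * r * z))).
- by apply/annE; rewrite -mulrA mulrA.
- by exists (y * r); rewrite -mulrA.
- by move=> w /annE Iw; apply/annE; rewrite -mulrA mulrCA; exact: idealM.
Qed.

(** The power expands into terms from K^i times a^j with i + j = m + n, so that j >= n or i >= m. *)
Lemma adj_pow_sub K J a m n : ideal_pow K m `<=` J -> J (a ^+ n) ->
  ideal_pow (iadj K a) (m + n) `<=` J.
Proof.
move=> KJ aJ.
pose W n := ideal_gen [set x | exists k i j,
  [/\ ideal_pow K i k, (i + j = n)%N & x = k * a ^+ j]].
have KW k : ideal_pow (iadj K a) k `<=` W k.
  elim: k => [|k IHk].
    move=> x _; rewrite -[x]mulr1; apply: idealM; apply: gen_mem.
    by exists 1, 0%N, 0%N; split; rewrite ?mulr1 //; exact: pow0.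
  apply: powS_min => u v [c Kc] /IHk; rewrite mulrC.
  suff : W k `<=` iquo (W k.+1) [set u] by move=> /[apply]; exact.
  apply: gen_min => _ [w [i [j [Kw ij ->]]]] _ ->.
  have -> : w * a ^+ j * u = (u - c * a) * w * a ^+ j + c * (w * a ^+ j.+1).
    by rewrite exprS; ring.
  apply: idealD; last apply: idealM; apply: gen_mem.
    by exists ((u - c * a) * w), i.+1, j; split=> //; [exact: powS|rewrite addSn ij].
  by exists w, i, j.+1; split=> //; rewrite addnS ij.
move=> x /KW; apply: gen_min => _ [k [i [j [Kk ij ->]]]].
have [nj|nj] := leqP n j.
  by rewrite -(subnK nj) exprD mulrA; exact: idealM.
apply: idealMr; apply: KJ; apply: pow_leq Kk.
by move: ij nj; lia.
Qed.

(** Each generator adds n to the exponent. The extra 1 serves the empty list, since the zeroth power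
    of the zero ideal is the whole ring. *)
Lemma fg_pow_sub (J : ideal A) (l : seq A) n :
  (forall a, a \in l -> J (a ^+ n)) ->
  ideal_pow (iadjs (ideal_bot A) l) (size l * n).+1 `<=` J.
Proof.
elim/last_ind: l => [|l a IH] lJ.
  apply: powS_min => a b -> _; rewrite mul0r; exact: ideal0.
rewrite size_rcons /iadjs foldl_rcons -/(iadjs _ l) mulSnr -addSn.
apply: adj_pow_sub; last by apply: lJ; rewrite mem_rcons inE eqxx.
by apply: IH => b bl; apply: lJ; rewrite mem_rcons inE bl orbT.
Qed.

Lemma radical_pow_sub K J : (forall a, K a -> exists n, J (a ^+ n)) ->
  exists n, ideal_pow K n `<=` J.
Proof.
move=> KJ; have [l Kl] := noeth_fg K.
have [N lN] : exists N, forall a, a \in l -> J (a ^+ N).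
  have : forall a, a \in l -> exists n, J (a ^+ n).
    by move=> a al; apply: KJ; rewrite Kl; exact: iadjs_mem.
  elim: l {Kl} => [|b l IH] lJ; first by exists 0%N.
  have [n nJ] : exists n, J (b ^+ n) by apply: lJ; rewrite inE eqxx.
  have [|N NJ] := IH; first by move=> a al; apply: lJ; rewrite inE al orbT.
  exists (N + n)%N => a; rewrite inE exprD => /predU1P[->|/NJ]; first exact: idealM.
  exact: idealMr.
by exists (size l * N).+1; rewrite Kl; exact: fg_pow_sub.
Qed.

(** If an element a of p had no power in I after localizing at p, [prime_below] would give a prime
    over I, inside p, omitting a. *)
Lemma minimal_prime_pow p (pP : prime_ideal p) I :
  (forall q, prime_ideal q -> I `<=` q -> q `<=` p -> p `<=` q) ->
  exists n, ideal_pow p n `<=` sat pP I.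
Proof.
move=> pmin; apply: radical_pow_sub => a pa; apply: contrapT => H.
have [|q [qP Iq qp]] := @prime_below _ p I a pP.
  by move=> s n ps Isa; apply: H; exists n, s.
by apply; exact: pmin pa.
Qed.

(** * Nakayama's lemma at a prime *)

Section Nakayama.
Variables (p : ideal A) (pP : prime_ideal p).

Let padj_def J g : [set x | exists2 c, p c & J (x - c * g)] 0.
Proof. by exists 0; [exact: ideal0|rewrite mul0r subr0; exact: ideal0]. Qed.

(** The ideal J + p g. It is also used later with another ideal in the place of p. *)
Program Definition padj J g : ideal A :=
  @Ideal A [set x | exists2 c, p c & J (x - c * g)] (padj_def J g) _ _.
Next Obligation.
move=> J g x y [a pa Ja] [b pb Jb]; exists (a + b); first exact: idealD.
by have := idealD Ja Jb; congr (iset _ _); ring.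
Qed.
Next Obligation.
move=> J g a x [c pc Jc]; exists (a * c); first exact: idealM.
by rewrite -mulrA -mulrBr; exact: idealM.
Qed.

Let pspan I l := foldr (fun g J => padj J g) I l.

Let padj_sub J g : J `<=` padj J g.
Proof. by move=> x Jx; exists 0; [exact: ideal0|rewrite mul0r subr0]. Qed.

Let pspan_ann I l s : (forall a, a \in l -> I (s * a)) ->
  forall x, pspan I l x -> I (s * x).
Proof.
elim: l => [|g l IH] /= lI x; first exact: idealM.
move=> [c pc Jx]; have -> : s * x = s * (x - c * g) + c * (s * g) by ring.
apply: idealD; last by apply: idealM; apply: lI; rewrite inE eqxx.
by apply: IH Jx => a al; apply: lI; rewrite inE al orbT.
Qed.

(** Elimination instead of determinants: the relation for g reads t g = 0 modulo the span of the
    other generators, with t outside p; multiplying by t removes g from the remaining relations. *)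
Let nakayama_seq I l : (forall a, a \in l -> sat pP (pspan I l) a) ->
  exists2 s, ~ p s & forall a, a \in l -> I (s * a).
Proof.
elim: l => [_|g l IH H]; first by exists 1; [exact: prime1|].
have [|sg psg [c pc]] := H g; first by rewrite inE eqxx.
rewrite -mulrBl; set t := sg - c => Jtg.
have pt : ~ p t by move=> pt; apply: psg; exact: ideal_eqm pt pc.
have [|s ps sl] := IH.
  move=> a al; have [|sa psa [c' pc' Ja]] := H a; first by rewrite inE al orbT.
  exists (t * sa); first exact: primeM.
  have -> : t * sa * a = t * (sa * a - c' * g) + c' * (t * g) by ring.
  by apply: idealD; exact: idealM.
exists (s * t); first exact: primeM.
move=> a; rewrite inE => /predU1P[->|/sl]; last by rewrite mulrAC; exact: idealMr.
by rewrite -mulrA; exact: pspan_ann Jtg.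
Qed.

(** After localizing at p the hypothesis says that K is contained in I + p K. Finite generation of K
    makes [nakayama_seq] applicable. *)
Lemma nakayama I K :
  K `<=` sat pP (ideal_gen [set x | I x \/ exists a b, [/\ p a, K b & x = a * b]]) ->
  K `<=` sat pP I.
Proof.
move=> KL; have [l Kl] := noeth_fg K.
have LS : ideal_gen [set x | I x \/ exists a b, [/\ p a, K b & x = a * b]]
    `<=` pspan I l.
  apply: gen_min => x [Ix|[a [b [pa Kb ->]]]].
    by move: x Ix; elim: {Kl} l => [|g l IH] //= x /IH; exact: padj_sub.
  suff : K `<=` iquo (pspan I l) p by move=> /(_ b Kb a pa); rewrite mulrC.
  rewrite Kl; apply: iadjs_min => [_ -> c _|g gl c pc].
    by rewrite mul0r; exact: ideal0.
  rewrite mulrC; elim: {Kl} l gl => [//|h l IH]; rewrite inE.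
  move=> /predU1P[->|/IH Sc] /=; last exact: padj_sub.
  by exists c => //; rewrite subrr; exact: ideal0.
have [|s ps sl] := @nakayama_seq I l.
  move=> a al; have [|s ps Ls] := KL a; first by rewrite Kl; exact: iadjs_mem.
  by exists s => //; exact: LS.
move=> x Kx; exists s => //; suff : K `<=` iquo I [set s].
  by move=> /(_ x Kx s erefl); rewrite mulrC.
rewrite Kl; apply: iadjs_min => [_ -> _ ->|a al _ ->].
  by rewrite mul0r; exact: ideal0.
by rewrite mulrC; exact: sl.
Qed.

Lemma nakayama1 I K x : p x ->
  (forall a, K a -> exists s k, [/\ ~ p s, K k & I (s * a - x * k)]) ->
  K `<=` sat pP I.
Proof.
move=> px H; apply: nakayama => a /H[s [k [ps Kk Ik]]]; exists s => //.
apply: (ideal_eqm (y := x * k)); first by apply: gen_mem; left.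
by apply: gen_mem; right; exists x, k.
Qed.

End Nakayama.

(** * Prime avoidance and associated primes *)

Section Avoidance.

Lemma prime_avoidance K (l : seq (ideal A)) :
  (forall q, q \in l -> prime_ideal q /\ ~ (K `<=` q)) ->
  exists2 w, K w & forall q, q \in l -> ~ q w.
Proof.
have [n] := ubnP (size l); elim: n l => // n IH [|q l] sl lK.
  by exists 0; [exact: ideal0|].
have [qP Kq] : prime_ideal q /\ ~ (K `<=` q) by apply: lK; rewrite inE eqxx.
(* Primes inside q may be dropped, as avoiding q avoids them. The others all contain some c outside
   q, so that when w lies in q it can be replaced by w + u c with u in K outside q. *)
pose l' := seq.filter (fun q' : ideal A => ~~ `[< q' `<=` q >]) l.
have [||w Kw wl'] := IH l'.
- by rewrite size_filter; move: sl; rewrite ltnS; apply: leq_ltn_trans; exact: count_size.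
- by move=> q'; rewrite mem_filter => /andP[_ ql]; apply: lK; rewrite inE ql orbT.
have wl u : ~ q u -> (forall q', q' \in l' -> ~ q' u) ->
    forall q', q' \in q :: l -> ~ q' u.
  move=> qu ul' q'; rewrite inE => /predU1P[->//|q'l].
  have [q'q|q'q] := pselect (q' `<=` q); first by move=> /q'q.
  by apply: ul'; rewrite mem_filter q'l andbT; apply/asboolPn.
have [qw|qw] := pselect (q w); last by exists w => //; exact: wl.
have [u Ku qu] : exists2 u, K u & ~ q u.
  by apply: contrapT => H; apply: Kq => x Kx; apply: contrapT => qx; apply: H; exists x.
have [c qc cl'] : exists2 c, ~ q c & forall q', q' \in l' -> q' c.
  have : forall q', q' \in l' -> ~ (q' `<=` q).
    by move=> q'; rewrite mem_filter => /andP[/asboolPn].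
  elim: (l') => [|q' m IHm] ml; first by exists 1; [exact: prime1|].
  have [|c qc cm] := IHm.
    by move=> q'' q''m; apply: ml; rewrite inE q''m orbT.
  have [b q'b qb] : exists2 b, q' b & ~ q b.
    apply: contrapT => H; apply: (ml q'); first by rewrite inE eqxx.
    by move=> x qx; apply: contrapT => nqx; apply: H; exists x.
  exists (c * b); first exact: primeM.
  move=> q''; rewrite inE => /predU1P[->|/cm]; [exact: idealM|exact: idealMr].
exists (w + u * c); first by apply: idealD => //; exact: idealMr.
apply: wl.
  move=> qwc; apply: (primeM qP qu qc).
  by have := idealB qwc qw; rewrite addrC addKr.
move=> q' q'l' q'wc; apply: (wl' q' q'l').
by have := idealB q'wc (idealM u (cl' q' q'l')); rewrite addrK.
Qed.

(** Noetherian induction: with [ann I z] prime, a submodule A w of A / I with prime annihilator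
    either meets A z nontrivially, and then has the same annihilator as z, or embeds in A / (I +
    (z)). *)
Lemma ass_finite I : exists l : seq (ideal A),
  forall z, ~ I z -> prime_ideal (ann I z) -> ann I z \in l.
Proof.
elim/noeth_ind: I => I IH.
have [I1|I1] := pselect (I 1).
  by exists [::] => z Iz; case: Iz; rewrite -[z]mulr1; exact: idealM.
have [r [Ir rP]] := ass_above I1; set z := r * 1 in Ir rP.
have [||l lP] := IH (iadj I z); first exact: iadj_sub.
  by move=> /(_ z (@iadj_mem _ _ _)).
have annM w a : prime_ideal (ann I w) -> ~ I (a * w) -> ann I (a * w) = ann I w.
  move=> [_ wM] Iaw; apply: ideal_ext => x; rewrite !annE mulrCA; split.
    by rewrite mulrCA mulrA => /annE/wM[/annE//|/annE].
  exact: idealM.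
exists (ann I z :: l) => w Iw wP; rewrite inE.
have [[a [Ia Iaw]]|H] := pselect (exists a, iadj I z (a * w) /\ ~ I (a * w)).
  have [b Ib] := Ia; rewrite -(annM w a) //.
  have annE' : ann I (a * w) = ann I (b * z).
    apply: ideal_ext => x; rewrite !annE.
    have e : x * (a * w) = x * (a * w - b * z) + x * (b * z) by ring.
    split=> H; last by rewrite e; apply: idealD => //; exact: idealM.
    by have := idealB H (idealM x Ib); rewrite {1}e addrC addKr.
  rewrite annE' annM ?eqxx // => Ibz; apply: Iaw; exact: ideal_eqm Ib Ibz.
apply/orP; right; have e : ann I w = ann (iadj I z) w.
  apply: ideal_ext => x; rewrite !annE; split; first exact: iadj_sub.
  by move=> Jx; apply: contrapT => Ix; apply: H; exists x.
rewrite e; apply: lP; last by rewrite -e.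
by move=> Jw; apply: H; exists 1; rewrite mul1r.
Qed.

(** The hypotheses say that K lies in no associated prime of I or of J, and zero divisors lie in
    associated primes; prime avoidance treats both finite sets at once. *)
Lemma nzd_avoid I J K : (forall z, K `<=` ann I z -> I z) ->
  (forall z, K `<=` ann J z -> J z) -> exists w, [/\ K w, nzd I w & nzd J w].
Proof.
move=> KI KJ; have [l lI] := ass_finite I; have [m mJ] := ass_finite J.
pose good (q : ideal A) := `[< prime_ideal q /\ ~ (K `<=` q) >].
have [q|w Kw wl] := @prime_avoidance K [seq q <- l ++ m | good q].
  by rewrite mem_filter => /andP[/asboolP].
have wz H : (forall z, K `<=` ann H z -> H z) -> (forall z, ~ H z ->
    prime_ideal (ann H z) -> ann H z \in l ++ m) -> nzd H w.
  move=> KH lH z Hwz; apply: contrapT => Hz.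
  have [r [Hrz rP]] := ass_above Hz; apply: (wl (ann H (r * z))).
    rewrite mem_filter lH // andbT; apply/asboolP; split=> //.
    by move=> /KH.
  by apply/annE; rewrite mulrCA; exact: idealM.
exists w; split=> //; apply: wz => // z zH zP; rewrite mem_cat.
  by rewrite lI.
by rewrite mJ ?orbT.
Qed.

End Avoidance.

(** Each pair holds a primary ideal and its radical. Noetherian induction splits an ideal that is
    not primary into two strictly larger ones. *)
Lemma primary_decomposition I : exists l : seq (ideal A * ideal A),
  (forall c, c \in l -> [/\ prime_ideal c.2, I `<=` c.1, c.1 `<=` c.2,
     exists n, ideal_pow c.2 n `<=` c.1 &
     forall s x, ~ c.2 s -> c.1 (s * x) -> c.1 x]) /\
  forall x, (forall c, c \in l -> c.1 x) -> I x.
Proof.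
elim/noeth_ind: I => I IH.
have [I1|I1] := pselect (I 1).
  by exists [::]; split=> // x _; rewrite -[x]mulr1; exact: idealM.
have R0 : [set x | exists n, I (x ^+ n)] 0.
  by exists 1%N; rewrite expr1; exact: ideal0.
have [prim|] := pselect (forall x y, I (x * y) -> ~ I x -> exists n, I (y ^+ n)).
  have RD x y : [set x | exists n, I (x ^+ n)] x ->
      [set x | exists n, I (x ^+ n)] y -> [set x | exists n, I (x ^+ n)] (x + y).
    move=> [m Ix] [n Iy]; exists (m + n)%N; rewrite exprDn.
    apply: ideal_sum => i _; rewrite -mulr_natl; apply: idealM.
    have [ni|ni] := leqP n i; first by rewrite -(subnK ni) exprD mulrA; exact: idealM.
    apply: idealMr; have mi : (m <= m + n - i)%N by lia.
    by rewrite -(subnK mi) exprD; exact: idealM.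
  have RM a x : [set x | exists n, I (x ^+ n)] x -> [set x | exists n, I (x ^+ n)] (a * x).
    by move=> [n Ix]; exists n; rewrite exprMn; exact: idealM.
  pose R := Ideal R0 RD RM.
  have RP : prime_ideal R.
    split; first by apply/proper1 => -[n]; rewrite expr1n.
    move=> x y [n]; rewrite exprMn => Ixy.
    have [Ixn|Ixn] := pselect (I (x ^+ n)); first by left; exists n.
    by right; have [k] := prim _ _ Ixy Ixn; rewrite -exprM; exists (n * k)%N.
  exists [:: (I, R)]; split=> [c|x /(_ (I, R))].
    rewrite inE => /eqP -> /=; split=> // [x Ix||s x Rs Isx].
    - by exists 1%N; rewrite expr1.
    - by apply: (@radical_pow_sub R I) => a [n Ia]; exists n.
    - apply: contrapT => Ix; apply: Rs.
      by apply: (prim x); rewrite // mulrC.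
  by apply; rewrite inE.
move=> /existsNP[x /existsNP[y /not_implyP[Ixy /not_implyP[Ix /forallNP Iy]]]].
(* Once (I : y^n) is stationary, I is the intersection of (I : y^n) and I + (y^n); the first
   contains x and the second y^n, so both are strictly larger than I. *)
have [|n nP] := noeth_acc (c := fun n => ann I (y ^+ n)).
  by move=> n z /annE Iz; apply/annE; rewrite exprSr mulrA; exact: idealMr.
have nS k : ann I (y ^+ (n + k)) `<=` ann I (y ^+ n).
  elim: k => [|k IHk]; first by rewrite addn0.
  move=> z /annE; rewrite addnS exprSr mulrA => Iz.
  apply: nP; apply/annE; rewrite exprS mulrA; apply/annE.
  by apply: IHk; apply/annE; rewrite mulrAC.
have [||l1 [l1P l1I]] := IH (ann I (y ^+ n)).
- by move=> z Iz; apply/annE; exact: idealMr.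
- move=> /(_ x) H; apply: Ix; apply: H.
  apply: nP; apply/annE; rewrite exprS mulrA; exact: idealMr.
have [||l2 [l2P l2I]] := IH (iadj I (y ^+ n)).
- exact: iadj_sub.
- by move=> /(_ _ (@iadj_mem _ _ _)); exact: Iy.
exists (l1 ++ l2); split=> [c|z zl].
  rewrite mem_cat => /orP[/l1P[a b d e f]|/l2P[a b d e f]]; split=> //.
    by move=> z Iz; apply: b; apply/annE; exact: idealMr.
  by move=> z Iz; apply: b; exact: iadj_sub.
have Iz1 : I (z * y ^+ n).
  by apply/annE; apply: l1I => c cl; apply: zl; rewrite mem_cat cl.
have [b Ib] : iadj I (y ^+ n) z.
  by apply: l2I => c cl; apply: zl; rewrite mem_cat cl orbT.
apply: (ideal_eqm Ib); apply/annE; apply: (nS n); apply/annE.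
have -> : b * y ^+ (n + n) = z * y ^+ n - (z - b * y ^+ n) * y ^+ n.
  by rewrite exprD; ring.
exact: idealB Iz1 (idealMr _ Ib).
Qed.

End Noetherian.

(** * Lengths and monomials *)

Section ChainLength.
Variables (A : comPzRingType) (p : ideal A) (pP : prime_ideal p).
Implicit Types (I J K L : ideal A).

(* when L is saturated, this says that (A / L)_p has length at least s *)
Fixpoint length_ge (s : nat) L : Prop :=
  if s is s'.+1 then
    exists L', [/\ sat pP L' `<=` L', L `<=` L', ~ (L' `<=` L) & length_ge s' L']
  else True.

Lemma length_ge_mono s L K : L `<=` K -> length_ge s K -> length_ge s L.
Proof.
case: s => // s LK [K' [K's KK' K'K Ks]]; exists K'; split=> //.
  exact: subset_trans KK'.
by move=> /subset_trans/(_ LK).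
Qed.

Lemma length_ge_top s L : L 1 -> length_ge s L -> s = 0%N.
Proof.
case: s => // s L1 [L' [_ _ L'L _]]; case: L'L => x _.
by rewrite -[x]mulr1; exact: idealM.
Qed.

(** Localized at p, (L + (g)) / L is a quotient of the residue field, so adding g costs at most one
    unit of length. A chain whose first term omits g stays strict after adding g. *)
Lemma length_ge_adj s L g : sat pP L `<=` L -> (forall a, p a -> L (a * g)) ->
  length_ge s.+1 L -> length_ge s (sat pP (iadj L g)).
Proof.
elim: s L => // s IH L Ls pgL [L' [L's LL' L'L L'ge]].
have [L'g|L'g] := pselect (L' g).
  apply: (length_ge_mono (s := s.+1) _ L'ge).
  apply: subset_trans L's; apply: sat_mono; exact: iadj_min.
exists (sat pP (iadj L' g)); split.
- by apply: sat_satl.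
- by apply: sat_mono; exact: iadj_mono.
- move=> H; apply: L'L => j L'j.
  have [s' ps' [c Lc]] : sat pP (iadj L g) j.
    by apply: H; apply: sat_sub; exact: iadj_sub.
  have [pc|pc] := pselect (p c).
    by apply: Ls; exists s' => //; apply: ideal_eqm Lc _; exact: pgL.
  case: L'g; apply: L's; exists c => //.
  by have := idealB (idealM s' L'j) (LL' _ Lc); rewrite opprB addrC subrK.
by apply: IH => // a /pgL /LL'.
Qed.

(** Only the bad elements cost length; the good ones already belong to the saturation. *)
Lemma length_ge_seq (T : eqType) (l : seq T) (e : T -> A) (bad : pred T) s K :
  (forall t a, t \in l -> p a -> sat pP K (a * e t)) ->
  (forall t, t \in l -> ~~ bad t -> sat pP K (e t)) ->
  length_ge s (sat pP K) ->
  length_ge (s - count bad l) (sat pP (iadjs K [seq e t | t <- l])).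
Proof.
elim: l s K => [|t l IH] s K lp lb Ks /=; first by rewrite subn0.
rewrite subnDA; apply: IH.
- move=> t' a t'l pa; have := lp t' a; rewrite inE t'l orbT => /(_ isT pa).
  by apply: sat_mono; exact: iadj_sub.
- move=> t' t'l nb; have := lb t'; rewrite inE t'l orbT => /(_ isT nb).
  by apply: sat_mono; exact: iadj_sub.
have tl : t \in t :: l by rewrite inE eqxx.
have [bt|bt] := boolP (bad t).
  case: s Ks => [//|s Ks]; rewrite subn1 /=.
  apply: (length_ge_mono (K := sat pP (iadj (sat pP K) (e t)))).
    by apply: sat_mono; apply: iadj_mono; exact: sat_sub.
  apply: length_ge_adj Ks; first exact: sat_satl.
  by move=> a pa; exact: lp.
rewrite subn0; apply: length_ge_mono Ks; apply: sat_satl.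
by apply: iadj_min; [exact: sat_sub|exact: lb].
Qed.

End ChainLength.

Lemma base_digits_inj (B d : nat) (a b : nat -> nat) :
  (forall i, (i < d)%N -> (a i < B)%N) -> (forall i, (i < d)%N -> (b i < B)%N) ->
  (\sum_(i < d) a i * B ^ i = \sum_(i < d) b i * B ^ i)%N ->
  forall i, (i < d)%N -> a i = b i.
Proof.
elim: d a b => // d IH a b aB bB; rewrite !big_ord_recl !expn0 !muln1.
have shift (c : nat -> nat) : (\sum_(i < d) c (lift ord0 i) * B ^ (lift ord0 i) =
    B * \sum_(i < d) c i.+1 * B ^ i)%N.
  by rewrite big_distrr /=; apply: eq_bigr => i _; rewrite expnS mulnCA.
rewrite !shift => E.
have B0 : (0 < B)%N by exact: leq_ltn_trans (aB 0%N isT).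
have e0 : a 0%N = b 0%N.
  have := congr1 (modn^~ B) E; rewrite ![(_ + B * _)%N]addnC ![(B * _)%N]mulnC.
  by rewrite !modnMDl !modn_small ?aB ?bB.
have := E; rewrite -[nat_of_ord ord0]/0%N e0 => /addnI/eqP.
rewrite eqn_pmul2l // => /eqP E' [|i] // id.
by apply: (IH (fun i => a i.+1) (fun i => b i.+1)) => // j jd; [exact: aB|exact: bB].
Qed.

Lemma base_digits_lt (B d : nat) (a : nat -> nat) :
  (forall i, (i < d)%N -> (a i < B)%N) ->
  (\sum_(i < d) a i * B ^ i < B ^ d)%N.
Proof.
elim: d a => [|d IH] a aB; first by rewrite big_ord0.
rewrite big_ord_recr /= expnS.
have := IH a (fun i id => aB i (ltnW id)); have := aB d (leqnn _).
set S := (\sum_(i < d) _)%N; set P := (B ^ d)%N => aB' SP.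
have : (a d * P + P <= B * P)%N by rewrite -mulSnr leq_mul2r aB' orbT.
lia.
Qed.

(** * The weight filtration by monomials *)

Section MonomialFiltration.
Variables (A : comPzRingType) (p : ideal A) (pP : prime_ideal p).
Variables (d : nat) (g : 'I_d -> A).
Hypothesis pg : (p : set A) = ideal_gen (range g).
Variable B : nat.
Hypothesis B_gt0 : (0 < B)%N.
Implicit Types (b c : 'I_d -> nat) (x y : A).

Definition monom b : A := \prod_i g i ^+ b i.
Definition mdeg b : nat := (\sum_i b i)%N.
(* With all exponents below B, this weight orders the monomials by degree    *)
(* first and then lexicographically.                                         *)
Definition mweight b : nat := (\sum_i b i * (B ^ d + B ^ i))%N.

(** A multiplicative filtration finer than the powers of p: for the exponents of interest each
    graded piece is spanned by one monomial, so that leading monomials make sense. *)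
Definition mfilt (w : nat) : ideal A :=
  ideal_gen [set monom b | b in [set b | (w <= mweight b)%N]].

Let gp i : p (g i).
Proof. by rewrite pg; apply: gen_mem; exists i. Qed.

Lemma monomD b c : monom (fun i => b i + c i)%N = monom b * monom c.
Proof. by rewrite -big_split; apply: eq_bigr => i _; rewrite exprD. Qed.

Lemma monomX b n : monom (fun i => n * b i)%N = monom b ^+ n.
Proof. by rewrite /monom -prodrXl; apply: eq_bigr => i _; rewrite mulnC exprM. Qed.

Lemma mweightD b c : mweight (fun i => b i + c i)%N = (mweight b + mweight c)%N.
Proof. by rewrite -big_split; apply: eq_bigr => i _; rewrite mulnDl. Qed.

Lemma mweightX b n : mweight (fun i => n * b i)%N = (n * mweight b)%N.
Proof. by rewrite /mweight big_distrr; apply: eq_bigr => i _; rewrite /= mulnA. Qed.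

Lemma mweightE b : mweight b = (mdeg b * B ^ d + \sum_i b i * B ^ i)%N.
Proof.
by rewrite /mdeg big_distrl -big_split; apply: eq_bigr => i _; rewrite mulnDr.
Qed.

Lemma mweight_le b : (mweight b <= mdeg b * (2 * B ^ d))%N.
Proof.
rewrite /mdeg big_distrl; apply: leq_sum => i _; rewrite /= leq_mul2l.
by rewrite mul2n -addnn leq_add2l leq_pexp2l ?orbT // ltnW.
Qed.

Lemma monom_pow b n : (n <= mdeg b)%N -> ideal_pow p n (monom b).
Proof.
move=> nb; apply: (pow_leq nb); rewrite /mdeg /monom.
elim/big_rec2: _ => [|i x n' _ IH]; first exact: pow0.
by apply: powD => //; exact: pow_expr.
Qed.

Lemma mfilt_mem b w : (w <= mweight b)%N -> mfilt w (monom b).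
Proof. by move=> wb; apply: gen_mem; exists b. Qed.

Lemma mfilt_min w (I : ideal A) :
  (forall b, (w <= mweight b)%N -> I (monom b)) -> mfilt w `<=` I.
Proof. by move=> wI; apply: gen_min => _ [b wb <-]; exact: wI. Qed.

Lemma mfilt_leq v w : (v <= w)%N -> mfilt w `<=` mfilt v.
Proof.
move=> vw; apply: mfilt_min => b wb; apply: mfilt_mem.
exact: leq_trans vw wb.
Qed.

Lemma mfilt0 x : mfilt 0 x.
Proof.
rewrite -[x]mulr1; apply: idealM.
have -> : 1 = monom (fun=> 0)%N by rewrite /monom big1.
exact: mfilt_mem.
Qed.

Lemma mfiltM v w x y : mfilt v x -> mfilt w y -> mfilt (v + w) (x * y).
Proof.
move=> Fx; move: y.
suff H : mfilt w `<=` iquo (mfilt (v + w)) (mfilt v).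
  by move=> y /H/(_ x Fx); rewrite mulrC.
apply: mfilt_min => b wb {Fx}x; rewrite mulrC; move: x.
suff H : mfilt v `<=` iquo (mfilt (v + w)) [set monom b].
  by move=> x /H; exact.
apply: mfilt_min => c vc _ ->; rewrite -monomD; apply: mfilt_mem.
by rewrite mweightD; exact: leq_add.
Qed.

Lemma mfiltMp w a x : p a -> mfilt w x -> mfilt w.+1 (a * x).
Proof.
rewrite -add1n => pa; apply: mfiltM; move: a pa; rewrite pg.
apply: gen_min => _ [i _ <-].
have -> : g i = monom (fun j => (j == i) : nat)%N.
  rewrite /monom (bigD1 i) //= eqxx expr1 big1 ?mulr1 // => j /negPf->.
  by rewrite expr0.
apply: mfilt_mem; rewrite /mweight (bigD1 i) //= eqxx mul1n.
by rewrite -addnA; apply: leq_trans (leq_addr _ _); rewrite expn_gt0 B_gt0.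
Qed.

Lemma mfilt_sub_pow N : mfilt (N * (2 * B ^ d)) `<=` ideal_pow p N.
Proof.
apply: mfilt_min => b wb; apply: monom_pow.
have /= := leq_trans wb (mweight_le b).
by rewrite leq_pmul2r // muln_gt0 expn_gt0 B_gt0.
Qed.

(** Take the last filtration step v that contains f at p. Its coefficient c lies outside p, since
    otherwise f would be in step v + 1. *)
Lemma leading_monomial N f : (2 * N <= B)%N -> ~ sat pP (ideal_pow p N) f ->
  exists b (c s : A), [/\ (mdeg b < 2 * N)%N, ~ p c, ~ p s &
                   mfilt (mweight b).+1 (s * f - c * monom b)].
Proof.
move=> NB fN.
have [v [vN Fv Fv1]] : exists v, [/\ (v < N * (2 * B ^ d))%N,
    sat pP (mfilt v) f & ~ sat pP (mfilt v.+1) f].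
  have : ~ sat pP (mfilt (N * (2 * B ^ d))) f.
    by move=> H; apply: fN; move: f H; apply: sat_mono; exact: mfilt_sub_pow.
  elim: (N * _)%N => [|n IH] Fn; first by case: Fn; apply: sat_sub; exact: mfilt0.
  have [Fn'|/IH[v [vn ? ?]]] := pselect (sat pP (mfilt n) f).
    by exists n; split.
  by exists v; split=> //; exact: ltnW.
(* A weight below N * (2 * B ^ d) forces degree below 2 N <= B, so all exponents are base B digits
   and the weight determines the monomial. *)
have small b : mweight b = v -> (mdeg b < 2 * N)%N.
  move=> bv; have : (mdeg b * B ^ d < 2 * N * B ^ d)%N.
    rewrite [(2 * N)%N]mulnC -mulnA; apply: leq_ltn_trans vN.
    by rewrite -bv mweightE leq_addr.
  by rewrite ltn_pmul2r // expn_gt0 B_gt0.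
have digit b i : mweight b = v -> (b i < B)%N.
  move=> /small bN; apply: leq_trans NB; apply: leq_ltn_trans bN.
  by rewrite /mdeg (bigD1 i) //= leq_addr.
pose ext b (j : nat) := if insub j is Some i then b i else 0%N.
have extE b (i : 'I_d) : ext b i = b i by rewrite /ext valK.
have low b : mweight b = v -> (\sum_i b i * B ^ i < B ^ d)%N.
  move=> bv; rewrite (eq_bigr (fun i : 'I_d => ext b i * B ^ i)%N) => [|i _].
    apply: base_digits_lt => j jd.
    by rewrite (extE b (Ordinal jd)); exact: digit.
  by rewrite extE.
have uniq b b' : mweight b = v -> mweight b' = v -> monom b = monom b'.
  move=> bv b'v; have := congr1 (modn^~ (B ^ d)%N) (etrans bv (esym b'v)).
  rewrite !mweightE !modnMDl !modn_small ?low // => E.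
  apply: eq_bigr => i _; rewrite -(extE b i) -(extE b' i).
  rewrite (@base_digits_inj B d (ext b) (ext b')) //.
  - by move=> j jd; rewrite (extE b (Ordinal jd)); exact: digit.
  - by move=> j jd; rewrite (extE b' (Ordinal jd)); exact: digit.
  - rewrite (eq_bigr (fun i : 'I_d => b i * B ^ i)%N) => [|i' _]; last by rewrite extE.
    by rewrite E; apply: eq_bigr => i' _; rewrite extE.
have [s ps Fs] := Fv.
have [b bv] : exists b, mweight b = v.
  apply: contrapT => H; apply: Fv1; exists s => //; move: Fs.
  apply: mfilt_min => b vb; apply: mfilt_mem.
  rewrite ltn_neqAle vb andbT; apply/negP => /eqP bv.
  by apply: H; exists b.
have [c Fc] : iadj (mfilt v.+1) (monom b) (s * f).
  move: (s * f) Fs; apply: mfilt_min => b' vb'.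
  have [bv'|bv'] := eqVneq (mweight b') v.
    by rewrite (uniq b' b) //; exact: iadj_mem.
  by apply: iadj_sub; apply: mfilt_mem; rewrite ltn_neqAle vb' andbT eq_sym.
exists b, c, s; split=> //; [exact: small| |by rewrite bv].
move=> pc; apply: Fv1; exists s => //; apply: ideal_eqm Fc _.
by apply: mfiltMp => //; apply: mfilt_mem; rewrite bv.
Qed.

Section Box.
Variables (M : nat) (I : ideal A).
Hypothesis IM : forall i, I (g i ^+ M).
Variable bad : pred {ffun 'I_d -> 'I_M}.

Definition box_exp (b : {ffun 'I_d -> 'I_M}) (i : 'I_d) : nat := b i.

Let G w : ideal A := ideal_gen [set x | I x \/ mfilt w x].

Hypothesis good : forall b : {ffun 'I_d -> 'I_M}, ~~ bad b ->
  sat pP (ideal_gen [set x | I x \/ mfilt (mweight (box_exp b)).+1 x])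
    (monom (box_exp b)).

Let G_I w : I `<=` G w.
Proof. by move=> x Ix; apply: gen_mem; left. Qed.
Let G_F w : mfilt w `<=` G w.
Proof. by move=> x Fx; apply: gen_mem; right. Qed.

Let outside b w : (forall c : {ffun 'I_d -> 'I_M}, mweight (box_exp c) = w -> ~ monom b = monom (box_exp c)) ->
  mweight b = w -> I (monom b).
Proof.
move=> H bw; have [i Mi] : exists i, (M <= b i)%N.
  apply: contrapT => /forallNP bM.
  have bM' i : (b i < M)%N by rewrite ltnNge; apply/negP.
  apply: (H [ffun i => Ordinal (bM' i)]).
    by rewrite -bw; apply: eq_bigr => i _; rewrite /box_exp ffunE.
  by apply: eq_bigr => i _; rewrite /box_exp ffunE.
rewrite /monom (bigD1 i) //= -(subnK Mi) exprD -mulrA mulrCA.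
by apply: idealMr; exact: IM.
Qed.

(** Monomials outside the box lie in I, so [G w] equals I above all box weights and is the whole
    ring at w = 0. Descending from weight w + 1 to w adds the box monomials of weight w, and only
    the bad ones cost length. *)
Lemma length_le_box s : length_ge pP s (sat pP I) -> (s <= #|bad|)%N.
Proof.
move=> Is.
pose W := (\max_(b : {ffun 'I_d -> 'I_M}) mweight (box_exp b)).+1.
pose above w := #|[pred b : {ffun 'I_d -> 'I_M} | bad b && (w <= mweight (box_exp b))%N]|.
have main k : (k <= W)%N ->
    length_ge pP (s - above (W - k))%N (sat pP (G (W - k)%N)).
  elim: k => [_|k IH kW].
    rewrite subn0 (_ : above W = 0%N); last first.
      apply/eqP/pred0P => b /=; apply/negbTE; rewrite negb_and -ltnNge ltnS.
      by rewrite leq_bigmax orbT.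
    rewrite subn0; apply: length_ge_mono Is; apply: sat_mono.
    apply: gen_min => x [//|]; move: x; apply: mfilt_min => b Wb.
    apply: (outside _ erefl) => c cb _; move: Wb; rewrite -cb ltnNge => /negP; apply.
    by rewrite leq_bigmax.
  have {IH} := IH (ltnW kW); set w := (W - k.+1)%N.
  rewrite (_ : (W - k)%N = w.+1); last by rewrite /w; lia.
  move=> IH; pose l := [seq b : {ffun 'I_d -> 'I_M} <- enum {ffun 'I_d -> 'I_M} | mweight (box_exp b) == w].
  have -> : (s - above w = s - above w.+1 - count bad l)%N.
    rewrite -subnDA; congr (_ - _)%N; rewrite addnC /above count_filter.
    rewrite -(cardID [pred b | mweight (box_exp b) == w]); congr (_ + _)%N.
      rewrite -size_filter cardE /enum_mem -filter_predI; congr size.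
      apply: eq_filter => b; rewrite !inE andbT.
      by case: (bad b); rewrite ?andbF //=; case: eqP => [->|]; rewrite ?leqnn ?andbF.
    apply: eq_card => b; rewrite !inE.
    by case: (bad b); rewrite ?andbF //= ltn_neqAle eq_sym.
  apply: (length_ge_mono (K := sat pP (iadjs (G w.+1) [seq monom (box_exp b) | b : {ffun 'I_d -> 'I_M} <- l]))).
    apply: sat_mono; apply: gen_min => x [Ix|].
      by apply: iadjs_sub; exact: G_I.
    move: x; apply: mfilt_min => b wb.
    have [bw|bw] := eqVneq (mweight b) w; last first.
      apply: iadjs_sub; apply: G_F; apply: mfilt_mem.
      by rewrite ltn_neqAle wb andbT eq_sym.
    have [[c [cw ->]]|H] := pselect (exists c : {ffun 'I_d -> 'I_M},
        mweight (box_exp c) = w /\ monom b = monom (box_exp c)).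
      apply: iadjs_mem; apply/mapP; exists c => //.
      by rewrite mem_filter cw eqxx mem_enum.
    apply: iadjs_sub; apply: G_I; apply: outside bw => c cw E.
    by apply: H; exists c.
  apply: length_ge_seq IH => b.
    move=> a; rewrite mem_filter => /andP[/eqP bw _] pa; apply: sat_sub; apply: G_F.
    by apply: mfiltMp => //; apply: mfilt_mem; rewrite bw.
  by rewrite mem_filter => /andP[/eqP bw _] /good; rewrite bw.
have {main} := main W (leqnn _); rewrite subnn => /length_ge_top.
have -> : above 0%N = #|bad| by apply: eq_card => b; rewrite !inE andbT.
move=> H; rewrite -subn_eq0 H //; apply: sat_sub; apply: G_F; exact: mfilt0.
Qed.

End Box.

(** A vector that is not above t has b i < t i for some i, and each i accounts for at most t i * M ^
    d.-1 vectors. *)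
Lemma card_box_lt M (t : 'I_d -> nat) :
  (#|[pred b : {ffun 'I_d -> 'I_M} | ~~ [forall i, t i <= b i]]|
     <= (\sum_i t i) * M ^ d.-1)%N.
Proof.
pose F i := [pred b : {ffun 'I_d -> 'I_M} | (b i < t i)%N].
apply: (@leq_trans (\sum_i #|F i|)%N).
  rewrite -sum1_card.
  under [X in (_ <= X)%N]eq_bigr do rewrite -sum1_card big_mkcond /=.
  rewrite exchange_big /= big_mkcond; apply: leq_sum => b _; rewrite inE.
  case: forallPn => [[i]|//]; rewrite -ltnNge => bt.
  by rewrite (bigD1 i) //= inE bt.
rewrite big_distrl /=; apply: leq_sum => i _.
pose H (j : 'I_d) := [pred k : 'I_M | (j == i) ==> (k < t i)%N].
have -> : #|F i| = #|family H|.
  apply: eq_card => b; rewrite !inE; apply/idP/forallP => [bt j|/(_ i)].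
    by rewrite inE; apply/implyP => /eqP->.
  by rewrite inE eqxx.
rewrite card_family /= foldrE big_map big_enum /= (bigD1 i) //=.
have -> : (\prod_(j < d | j != i) #|H j| = M ^ d.-1)%N.
  rewrite (eq_bigr (fun=> M)) => [|j /negPf ji].
    by rewrite prod_nat_const cardC1 card_ord.
  by rewrite -[RHS]card_ord; apply: eq_card => k; rewrite !inE ji.
rewrite leq_mul2r; apply/orP; right.
have [Mt|tM] := leqP M (t i).
  by apply: leq_trans Mt; rewrite -[X in (_ <= X)%N]card_ord; exact: max_card.
have -> : #|H i| = (\sum_(k < M | (k < t i)%N) 1)%N.
  by rewrite -sum1_card; apply: eq_bigl => k; rewrite !inE eqxx.
by rewrite -(big_ord_widen _ (fun=> 1%N) (ltnW tM)) sum1_card card_ord.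
Qed.

End MonomialFiltration.

Section LengthBounds.
Variables (A : comPzRingType) (p : ideal A) (pP : prime_ideal p).
Variables (d : nat) (g : 'I_d -> A).
Hypothesis pg : (p : set A) = ideal_gen (range g).

(** All box monomials are counted as bad, and base 1 suffices because no leading monomial is
    taken. *)
Lemma length_le_finite M (I : ideal A) s : (forall i, I (g i ^+ M)) ->
  length_ge pP s (sat pP I) -> (s <= M ^ d)%N.
Proof.
move=> IM /(length_le_box pg (ltn0Sn 0) IM (bad := predT)) H.
apply: leq_trans (H _) _ => //.
by apply: leq_trans (max_card _) _; rewrite card_ffun !card_ord.
Qed.

(** The leading monomial of f^a is the a-th power of that of f. As f^a is in I, every multiple of
    this monomial is, at p, congruent modulo I to terms of higher weight; the bad exponents are
    those not above a * b. *)
Lemma length_le_hypersurface M N a f (I : ideal A) s : (forall i, I (g i ^+ M)) ->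
  I (f ^+ a) -> ~ sat pP (ideal_pow p N) f ->
  length_ge pP s (sat pP I) -> (s <= a * (2 * N) * M ^ d.-1)%N.
Proof.
move=> IM If fN; pose B := (2 * N).+1; have B0 : (0 < B)%N by [].
have [b [c [t [bN pc pt Fb]]]] := leading_monomial pg B0 (leqnSn _) fN.
set v := mweight B b in Fb.
have Fvf : mfilt g B v (t * f).
  apply: ideal_eqm (mfilt_leq (leqnSn v) Fb) _.
  by apply: idealM; exact: mfilt_mem.
have Fpow n : mfilt g B (n * v).+1 ((t * f) ^+ n - (c * monom g b) ^+ n).
  elim: n => [|n IH]; first by rewrite !expr0 subrr; exact: ideal0.
  have -> : (t * f) ^+ n.+1 - (c * monom g b) ^+ n.+1 =
      (t * f) * ((t * f) ^+ n - (c * monom g b) ^+ n) +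
      (t * f - c * monom g b) * (c * monom g b) ^+ n by rewrite !exprS; ring.
  rewrite mulSn; apply: idealD; first by rewrite -addnS; exact: mfiltM.
  rewrite -addSn; apply: mfiltM => //; rewrite exprMn; apply: idealM.
  by rewrite -monomX; apply: mfilt_mem; rewrite mweightX.
move=> /(length_le_box pg B0 IM
  (bad := [pred k : {ffun 'I_d -> 'I_M} | ~~ [forall i, a * b i <= k i]%N])) H.
apply: leq_trans (H _) _ => [k|].
  rewrite negbK => /forallP ak; exists (c ^+ a); first by move=> /(primeX pP).
  set J := ideal_gen _.
  pose r (i : 'I_d) := (k i - a * b i)%N.
  have kE : monom g (box_exp k) = monom g r * monom g b ^+ a.
    by rewrite -monomX -monomD; apply: eq_bigr => i _; rewrite subnK.
  have wE : mweight B (box_exp k) = (mweight B r + a * v)%N.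
    by rewrite -mweightX -mweightD; apply: eq_bigr => i _; rewrite subnK.
  have -> : c ^+ a * monom g (box_exp k) = monom g r * (t ^+ a * f ^+ a) -
      monom g r * ((t * f) ^+ a - (c * monom g b) ^+ a).
    by rewrite kE !exprMn; ring.
  apply: idealB.
    by apply: gen_mem; left; apply: idealM; exact: idealM.
  by apply: gen_mem; right; rewrite wE -addnS; apply: mfiltM => //; exact: mfilt_mem.
apply: leq_trans (card_box_lt M (fun i => a * b i)%N) _.
rewrite -big_distrr /= leq_mul2r leq_mul2l; apply/orP; right; apply/orP; right.
exact: ltnW.
Qed.

End LengthBounds.

(** * Dimension, depth and regular local rings *)

Section PrimeChains.
Variable A : comPzRingType.
Hypothesis noethA : noetherian_ring A.
Implicit Types (I J K L p q : ideal A) (x y z : A).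

Fixpoint chain_above (k : nat) q : Prop :=
  if k is k'.+1 then
    exists q', [/\ prime_ideal q', q `<=` q', ~ (q' `<=` q) & chain_above k' q']
  else True.

Definition dim_lt (k : nat) I : Prop :=
  forall q, prime_ideal q -> I `<=` q -> ~ chain_above k q.

Lemma chain_above_mono k q q' : q `<=` q' -> chain_above k q' -> chain_above k q.
Proof.
case: k => // k qq' [r [rP q'r rq' rk]]; exists r; split=> //.
  exact: subset_trans q'r.
by move=> /subset_trans/(_ qq').
Qed.

Lemma chain_above_leq j k q : (j <= k)%N -> chain_above k q -> chain_above j q.
Proof.
elim: k j q => [|k IH] [|j] q //= jk [r [rP qr rq rk]].
by exists r; split=> //; exact: IH rk.
Qed.

(* Krull's principal ideal theorem, stated for the ring localized at q2 and *)
(* divided by q0: there q1 is a nonzero prime strictly below the maximal    *)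
(* ideal, so the latter is not minimal over z.                              *)
Lemma principal_ideal_theorem q0 q1 q2 z :
  prime_ideal q0 -> prime_ideal q1 -> prime_ideal q2 ->
  q0 `<=` q1 -> ~ (q1 `<=` q0) -> q1 `<=` q2 -> ~ (q2 `<=` q1) -> q2 z ->
  exists q', [/\ prime_ideal q', q0 `<=` q', q' z, q' `<=` q2 & ~ (q2 `<=` q')].
Proof.
move=> P0 P1 P2 q01 q10 q12 q21 q2z; apply: contrapT => H.
have min q' : prime_ideal q' -> iadj q0 z `<=` q' -> q' `<=` q2 -> q2 `<=` q'.
  move=> q'P q0q' q'q2; apply: contrapT => nq; apply: H; exists q'; split=> //.
    exact: subset_trans (@iadj_sub _ _ _) q0q'.
  by apply: q0q'; exact: iadj_mem.
have q1z : ~ q1 z by move=> q1z; apply: H; exists q1.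
have [C q2C] := minimal_prime_pow noethA P2 min.
(* [T n] is the n-th symbolic power of q1 modulo q0. The quotient by q0 + (z) has length at most C^d
   at q2, so its ideals [J n], the images of the [T n], cannot decrease strictly forever. *)
pose S n := ideal_gen [set x | q0 x \/ ideal_pow q1 n x].
have S0 n : q0 `<=` S n by move=> x q0x; apply: gen_mem; left.
have SS n : S n.+1 `<=` S n.
  apply: gen_min => x [/S0//|q1x]; apply: gen_mem; right.
  exact: pow_leq (leqnSn n) _ q1x.
pose T n := sat P1 (S n); pose J n := sat P2 (iadj (T n) z).
have TS n : T n.+1 `<=` T n by apply: sat_mono; exact: SS.
have JS n : J n.+1 `<=` J n by apply: sat_mono; apply: iadj_mono; exact: TS.
have [n JnS] : exists n, J n `<=` J n.+1.
  apply: contrapT => /forallNP nJ.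
  have Jlen n : length_ge P2 n (J n).
    elim: n => // n IH; exists (J n); split=> //.
    by apply: sat_satl.
  have [d [g q2E]] := noethA q2.
  have := @length_le_finite _ _ P2 d g q2E C (J (C ^ d).+1) (C ^ d).+1.
  rewrite ltnn => K; have : false; last by [].
  apply: K => [i|].
    apply: (subset_trans q2C); last first.
      by apply: pow_expr; rewrite q2E; apply: gen_mem; exists i.
    apply: sat_mono; apply: iadj_mono.
    exact: subset_trans (@S0 _) (@sat_sub _ _ _ _).
  by apply: length_ge_mono (Jlen _); apply: sat_satl.
(* An element of [T n] is locally c z plus an element of [T n.+1]; since z is outside q1, c is again
   in [T n], and Nakayama at q2 removes the term c z. *)
have TnS : T n `<=` T n.+1.
  suff /subset_trans : T n `<=` sat P2 (T n.+1).
    apply; apply: sat_min => // s x q2s; apply: satK => /q12.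
    exact: q2s.
  apply: (nakayama1 noethA _ q2z) => a Ta.
  have [s q2s [c Tc]] : J n.+1 a.
    by apply: JnS; apply: sat_sub; exact: iadj_sub.
  exists s, c; split=> //; last by rewrite [z * c]mulrC.
  apply: (satK (s := z)) => //; rewrite mulrC.
  by have := idealB (idealM s Ta) (TS _ _ Tc); rewrite opprB addrC subrK.
(* At q1 the previous step reads: q1^n is contained in q0 + q1^(n+1). Nakayama at q1 puts q1^n in
   q0, against q1 being strictly larger. *)
have q1n : ideal_pow q1 n `<=` sat P1 q0.
  apply: nakayama => //; apply: subset_trans (sat_mono (I := S n.+1) _).
    by move=> x q1x; apply: TnS; apply: sat_sub; apply: gen_mem; right.
  apply: gen_min => x [q0x|]; first by apply: gen_mem; left.
  move: x; apply: powS_min => a b q1a q1b; apply: gen_mem; right.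
  by exists a, b.
apply: q10; apply: (prime_pow (n := n) P0); apply: (subset_trans q1n).
exact: sat_prime.
Qed.

End PrimeChains.

(** * Depth and lengths over a Noetherian local ring *)

Section LocalRing.
Variable A : comPzRingType.
Hypothesis noethA : noetherian_ring A.
Variables (m : ideal A) (mP : prime_ideal m).
Hypothesis munit : forall x, ~ m x -> is_unit x.
Implicit Types (I J K L p q : ideal A) (x y z : A).

Lemma local_prime_sub q : prime_ideal q -> q `<=` m.
Proof.
move=> /prime1 q1 x qx; apply: contrapT => /munit[y xy].
by apply: q1; rewrite -xy; exact: idealMr.
Qed.

Lemma local_cancel I s x : ~ m s -> I (s * x) -> I x.
Proof.
move=> /munit[y sy] Isx.
by rewrite -[x]mul1r -sy mulrAC mulrC; exact: idealM.
Qed.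

Lemma local_sat I : sat mP I = I.
Proof.
apply: ideal_ext => x; split; last exact: sat_sub.
by move=> [s ms]; exact: local_cancel.
Qed.

Lemma local_nakayama1 I K x : m x ->
  (forall a, K a -> exists2 k, K k & I (a - x * k)) -> K `<=` I.
Proof.
move=> mx H; rewrite -(local_sat I); apply: (nakayama1 noethA mP mx).
move=> a /H[k Kk Ik]; exists 1, k; rewrite mul1r; split=> //.
exact: prime1.
Qed.

(** If the first prime of the chain omits z, induction puts z in the next one, and the principal
    ideal theorem replaces the first by a prime containing z. *)
Lemma chain_through k q z : prime_ideal q -> m z -> chain_above k.+1 q ->
  exists q', [/\ prime_ideal q', q `<=` q', q' z & chain_above k q'].
Proof.
move=> qP mz; elim: k q qP => [|k IH] q0 P0.
  by move=> _; exists m; split=> //; exact: local_prime_sub.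
move=> [q1 [P1 q01 q10 ch1]]; have [q1z|q1z] := pselect (q1 z).
  by exists q1.
have [q2 [P2 q12 q2z ch2]] := IH _ P1 ch1.
have [|q' [P' q0' q'z q'2 q2']] :=
  principal_ideal_theorem noethA P0 P1 P2 q01 q10 q12 _ q2z.
  by move=> /(_ z q2z).
by exists q'; split=> //; exists q2.
Qed.

(** Krull's height theorem: by [chain_through], each generator absorbs one step of a chain. *)
Lemma dim_lt_generated I (l : seq A) : m = iadjs I l -> dim_lt (size l).+1 I.
Proof.
elim: l I => [|z l IH] I /= mE q qP Iq.
  move=> [q' [q'P _ q'q _]]; apply: q'q.
  by apply: subset_trans (local_prime_sub q'P) _; rewrite mE.
have mz : m z by rewrite mE; apply: iadjs_sub; exact: iadj_mem.
move=> /(chain_through qP mz)[q' [q'P qq' q'z]]; apply: IH mE _ q'P _.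
by apply: iadj_min => //; exact: subset_trans qq'.
Qed.

(** Existence of a regular sequence of length k in m on A / I. *)
Fixpoint depth_ge (k : nat) I : Prop :=
  if k is k'.+1 then exists y, [/\ m y, nzd I y & depth_ge k' (iadj I y)]
  else True.

(** A regular local ring is a domain whose minimal generators of m form a regular sequence. By
    induction I + (z) and q0 + (z) are prime, and they agree for dimension reasons; since z is
    outside q0, this gives q0 = I + z q0, whence q0 = I by Nakayama. *)
Lemma regular_prime_depth I (l : seq A) q : m = iadjs I l ->
  prime_ideal q -> I `<=` q -> chain_above (size l) q ->
  prime_ideal I /\ depth_ge (size l) I.
Proof.
elim: l I q => [|z l IH] I q0 /= mE P0 Iq0; first by rewrite -mE.
have mz : m z by rewrite mE; apply: iadjs_sub; exact: iadj_mem.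
move=> ch0; have [q1 [P1 q01 q1z ch1]] := chain_through P0 mz ch0.
have Iz1 : iadj I z `<=` q1 by apply: iadj_min => //; exact: subset_trans q01.
have [IzP Izd] := IH _ q1 mE P1 Iz1 ch1.
have Izq : iadj I z `<=` iadj q0 z by exact: iadj_mono.
have q0z1 : iadj q0 z `<=` q1 by exact: iadj_min.
have mE' : m = iadjs (iadj q0 z) l.
  apply: ideal_ext => x; split.
    rewrite mE; apply: iadjs_min => [|y yl]; last exact: iadjs_mem.
    exact: subset_trans Izq (@iadjs_sub _ _ _).
  move: x; apply: iadjs_min => [|y yl]; first exact: subset_trans (local_prime_sub P1).
  by rewrite mE; exact: iadjs_mem.
have [QzP _] := IH _ q1 mE' P1 q0z1 ch1.
have Qz : iadj q0 z `<=` iadj I z.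
  apply: contrapT => nQ; apply: (dim_lt_generated mE IzP) => //.
  by exists (iadj q0 z); split=> //; exact: chain_above_mono ch1.
have q0z : ~ q0 z.
  move=> q0z; have := dim_lt_generated mE'; rewrite iadj_id // => /(_ _ P0).
  exact.
have q0I : q0 `<=` I.
  apply: (local_nakayama1 mz) => a q0a.
  have [c Ic] : iadj I z a by apply: Qz; exact: iadj_sub.
  exists c; last by rewrite mulrC.
  have q0cz : q0 (c * z).
    by have := idealB q0a (Iq0 _ Ic); rewrite opprB addrC subrK.
  by case: P0 => _ /(_ _ _ q0cz)[].
have IE : I = q0 by apply: ideal_ext => x; split; [exact: Iq0|exact: q0I].
split; first by rewrite IE.
exists z; split=> // a; rewrite IE => q0za.
by case: P0 => _ /(_ _ _ q0za)[].
Qed.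

(** Regular sequences in a Noetherian local ring may be permuted: (I : w) is contained in I + x (I :
    w), so Nakayama applies. *)
Lemma exchange I x w : m x -> m w -> nzd I x -> nzd (iadj I x) w ->
  nzd I w /\ nzd (iadj I w) x.
Proof.
move=> mx mw Ix Ixw.
have Iw : nzd I w.
  suff H : ann I w `<=` I by move=> a Iwa; apply: H; apply/annE; rewrite mulrC.
  apply: (local_nakayama1 mx) => a /annE Iaw.
  have [b Ib] : iadj I x a by apply: Ixw; apply: iadj_sub; rewrite mulrC.
  exists b; last by rewrite mulrC.
  apply/annE; apply: Ix.
  have -> : x * (b * w) = a * w - w * (a - b * x) by ring.
  by apply: idealB => //; exact: idealM.
split=> // a [b Ib].
have [c Ic] : iadj I x b.
  apply: Ixw; exists a; have := idealN Ib; rewrite opprB.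
  by congr (iset _ _); ring.
exists c; apply: Ix.
have -> : x * (a - c * w) = (x * a - b * w) + w * (b - c * x) by ring.
by apply: idealD => //; exact: idealM.
Qed.

(** The socles of A / (I + (x)) and A / (I + (y)) are both copies of Ext^1(k, A / I), k being the
    residue field. The correspondence sends z to the w with y z = w x modulo I. *)
Lemma socle_exchange I x y z : m x -> m y -> nzd I x -> nzd I y ->
  ~ iadj I x z -> m `<=` ann (iadj I x) z ->
  exists2 w, ~ iadj I y w & m `<=` ann (iadj I y) w.
Proof.
move=> mx my Ix Iy nz mz.
have [w Iw] : iadj I x (y * z) by apply/annE; exact: mz.
exists w.
  move=> [v Iv]; apply: nz; exists v; apply: Iy.
  have -> : y * (z - v * x) = (y * z - w * x) + x * (w - v * y) by ring.
  by apply: idealD => //; exact: idealM.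
move=> a ma; apply/annE; have [b Ib] : iadj I x (a * z) by apply/annE; exact: mz.
exists b; apply: Ix.
have -> : x * (a * w - b * y) = y * (a * z - b * x) - a * (y * z - w * x) by ring.
by apply: idealB; exact: idealM.
Qed.

(** The depth left after dividing by a nonzerodivisor does not depend on its choice. Vanishing
    socles provide a w regular modulo both I + (x) and I + (y), and induction passes from x to y
    through w. *)
Lemma depth_adj k I y : m y -> nzd I y -> depth_ge k.+1 I -> depth_ge k (iadj I y).
Proof.
elim: k I y => // k IH I y my Iy [x [mx Ix [x' [mx' Ixx' dx']]]].
have soc z : m `<=` ann (iadj I x) z -> iadj I x z.
  by move=> /(_ _ mx')/annE/Ixx'.
have socy z : m `<=` ann (iadj I y) z -> iadj I y z.
  move=> mz; apply: contrapT => nz.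
  by have [w nw /soc] := socle_exchange my mx Iy Ix nz mz.
have [w [mw Ixw Iyw]] := nzd_avoid noethA soc socy.
have [Iw Iwx] := exchange mx mw Ix Ixw.
have [_ Iwy] := exchange my mw Iy Iyw.
have dxw : depth_ge k (iadj (iadj I x) w) by apply: IH => //; exists x'.
have dwy : depth_ge k (iadj (iadj I w) y).
  by apply: IH => //; exists x; rewrite iadjC.
by exists w; rewrite iadjC.
Qed.

(** The depth is at most dim A / q for each associated prime q. By Nakayama (I : q) is not contained
    in I + (x), so some associated prime of I + (x) contains both q and x; it is strictly larger
    than q. *)
Lemma ass_chain k I z : ~ I z -> prime_ideal (ann I z) -> depth_ge k I ->
  chain_above k (ann I z).
Proof.
elim: k I z => // k IH I z Iz zP [x [mx Ix dx]].
pose q := ann I z; pose U := iquo I q.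
have [u Uu xu] : exists2 u, U u & ~ iadj I x u.
  apply: contrapT => H; apply: Iz.
  suff : U `<=` I by apply=> s /annE; rewrite mulrC.
  apply: (local_nakayama1 mx) => a Ua.
  have [b Ib] : iadj I x a by apply: contrapT => na; apply: H; exists a.
  exists b; last by rewrite mulrC.
  move=> s qs; apply: Ix.
  have -> : x * (b * s) = a * s - s * (a - b * x) by ring.
  by apply: idealB; [exact: Ua|exact: idealM].
have [r [nru ruP]] := ass_above noethA xu.
have qx : ~ q x by move=> /annE/Ix.
exists (ann (iadj I x) (r * u)); split=> //.
- move=> s qs; apply/annE; rewrite mulrCA; apply: idealM; apply: iadj_sub.
  by rewrite mulrC; exact: Uu.
- move=> /(_ x) H; apply: qx; apply: H; apply/annE; rewrite mulrC.
  exact: iadj_memM.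
- exact: IH.
Qed.

Lemma dim_lt_adj k I y : m y -> nzd I y -> dim_lt k.+1 I -> dim_lt k (iadj I y).
Proof.
move=> my Iy Idim q qP Iyq ch.
have Iq := subset_trans (@iadj_sub _ I y) Iyq.
have [|q' [q'P Iq' q'q q'y]] := prime_smaller qP Iq _ Iy.
  by apply: Iyq; exact: iadj_mem.
apply: (Idim q') => //; exists q; split=> // /(_ y) H; apply: q'y; apply: H.
by apply: Iyq; exact: iadj_mem.
Qed.

Fixpoint regular_seq I (l : seq A) : Prop :=
  if l is y :: l' then nzd I y /\ regular_seq (iadj I y) l' else True.

(** While the depth is at least 2, each associated prime has a chain of two primes above it and so
    cannot contain p; p therefore contains a nonzerodivisor. *)
Lemma regular_seq_in p k I : prime_ideal p -> ~ chain_above 2 p ->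
  I `<=` p -> depth_ge k.+1 I -> dim_lt k.+2 I ->
  exists l, [/\ size l = k, forall y, y \in l -> p y, regular_seq I l &
                dim_lt 2 (iadjs I l)].
Proof.
move=> pP p2; elim: k I => [|k IH] I Ip Id Idim; first by exists [::].
have Iavoid z : p `<=` ann I z -> I z.
  move=> pz; apply: contrapT => Iz; have [r [Irz rP]] := ass_above noethA Iz.
  have ch := ass_chain Irz rP Id; apply: p2.
  apply: (chain_above_mono (q' := ann I (r * z))).
    by move=> s /pz/annE Isz; apply/annE; rewrite mulrCA; exact: idealM.
  by apply: chain_above_leq ch.
have [y [py Iy _]] := nzd_avoid noethA Iavoid Iavoid.
have my := local_prime_sub pP py.
have [|||l [lk lp lI ldim]] := IH (iadj I y).
- exact: iadj_min.
- exact: depth_adj.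
- exact: dim_lt_adj.
exists (y :: l); split=> //=; first by rewrite lk.
by move=> x; rewrite inE => /predU1P[->|/lp].
Qed.

Lemma nzd_exp I y n : nzd I y -> nzd I (y ^+ n).
Proof.
move=> Iy; elim: n => [|n IH] a; first by rewrite mul1r.
by rewrite exprS -mulrA => /Iy/IH.
Qed.

Lemma nzd_adj_exp I y z n : nzd I y -> nzd (iadj I y) z ->
  nzd (iadj I (y ^+ n)) z.
Proof.
move=> Iy Iyz; elim: n => [|n IH] a.
  by move=> _; rewrite -[a]mulr1; exact: iadj_memM.
move=> [c Ic]; have [b Ib] : iadj I y a.
  by apply: Iyz; exists (c * y ^+ n); rewrite -mulrA -exprSr.
have [e Ie] : iadj I (y ^+ n) b.
  apply: IH; exists c; apply: Iy.
  have -> : y * (z * b - c * y ^+ n) =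
      (z * a - c * y ^+ n.+1) - z * (a - b * y) by rewrite exprS; ring.
  by apply: idealB => //; exact: idealM.
exists e; have -> : a - e * y ^+ n.+1 = (a - b * y) + y * (b - e * y ^+ n).
  by rewrite exprS; ring.
by apply: idealD => //; exact: idealM.
Qed.

Lemma regular_seq_exp I y l n : m y -> (forall z, z \in l -> m z) ->
  nzd I y -> regular_seq (iadj I y) l -> regular_seq (iadj I (y ^+ n)) l.
Proof.
move=> my; elim: l I => //= z l IH I lm Iy [Iyz Iyzl].
split; first exact: nzd_adj_exp.
have [|Iz Izy] := exchange my _ Iy Iyz; first by apply: lm; rewrite inE eqxx.
rewrite iadjC; apply: IH => //; last by rewrite iadjC.
by move=> w wl; apply: lm; rewrite inE wl orbT.
Qed.

Lemma nzd_adjs_exp I y l n : m y -> (forall z, z \in l -> m z) ->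
  nzd I y -> regular_seq (iadj I y) l -> nzd (iadjs I [seq z ^+ n | z <- l]) y.
Proof.
move=> my; elim: l I => //= z l IH I lm Iy [Iyz Iyzl].
have mz : m z by apply: lm; rewrite inE eqxx.
have lm' w : w \in l -> m w by move=> wl; apply: lm; rewrite inE wl orbT.
have [Iz Izy] := exchange my mz Iy Iyz.
apply: IH => //; first exact: nzd_adj_exp.
by rewrite iadjC; exact: regular_seq_exp.
Qed.

Lemma iadjs_adj I y l : iadjs (iadj I y) l = iadj (iadjs I l) y.
Proof. by elim: l I => //= z l IH I; rewrite iadjC IH. Qed.

(** The powers of y filter A / (I + (y^n)) with n successive quotients isomorphic to A / (I +
    (y)). *)
Lemma length_ge_adj_exp p (pP : prime_ideal p) I y n s : nzd I y ->
  length_ge pP s (sat pP (iadj I y)) ->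
  length_ge pP (n * s) (sat pP (iadj I (y ^+ n))).
Proof.
move=> Iy len; elim: n => // n IH; rewrite mulSn.
move: (n * s)%N IH => t IH.
pose u := y ^+ n; have Iu : nzd I u by exact: nzd_exp.
(* multiplication by u embeds A / L into A / (I + u L) *)
have step L : I `<=` L -> sat pP L `<=` L -> length_ge pP s L ->
    length_ge pP (s + t) (sat pP (padj L I u)).
  have sub L' : sat pP (padj L' I u) `<=` sat pP (iadj I u).
    by apply: sat_mono => x [c _]; exists c.
  elim: (s) L => [|s' IHs] L IL Ls; first by move=> _; exact: length_ge_mono (sub L) IH.
  move=> [L' [L's LL' L'L L'len]]; exists (sat pP (padj L' I u)); split.
  - by apply: sat_satl.
  - by apply: sat_mono => x [c Lc Ic]; exists c => //; exact: LL'.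
  - move=> H; apply: L'L => l L'l.
    have [v pv [c Lc Ic]] : sat pP (padj L I u) (l * u).
      apply: H; apply: sat_sub; exists l => //.
      by rewrite subrr; exact: ideal0.
    apply: Ls; exists v => //; apply: ideal_eqm Lc; apply: IL; apply: Iu.
    by move: Ic; congr (iset _ _); ring.
  - by apply: IHs => //; exact: subset_trans LL'.
apply: length_ge_mono (step _ _ _ len).
- apply: sat_mono => x [a Ia]; exists (a * y); last by rewrite -mulrA -exprS.
  by apply: sat_sub; exact: iadj_memM.
- exact: subset_trans (@iadj_sub _ _ _) (@sat_sub _ _ _ _).
- exact: sat_satl.
Qed.

Lemma length_ge_regular_seq p (pP : prime_ideal p) I l n :
  I `<=` p -> (forall y, y \in l -> p y) -> regular_seq I l ->
  length_ge pP (n ^ size l) (sat pP (iadjs I [seq y ^+ n | y <- l])).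
Proof.
elim: l I => [|y l IH] I Ip lp /=.
  exists (ideal_top A); split=> [x _|x _||] //.
  by move=> /(_ 1 Logic.I)[s ps]; rewrite mulr1 => /Ip.
move=> [Iy Iyl]; rewrite expnS iadjs_adj.
have py : p y by apply: lp; rewrite inE eqxx.
have lp' z : z \in l -> p z by move=> zl; apply: lp; rewrite inE zl orbT.
apply: length_ge_adj_exp.
  apply: nzd_adjs_exp => //; first exact: local_prime_sub py.
  by move=> z /lp'; exact: local_prime_sub.
by rewrite -iadjs_adj; apply: IH => //; exact: iadj_min.
Qed.

(** Since x is a nonzerodivisor modulo each p-saturated L', an equality L' + (x) = L + (x) would
    give L' = L + x L', and Nakayama would collapse the step. *)
Lemma length_ge_parameter p (pP : prime_ideal p) L x s : m x -> ~ p x ->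
  length_ge pP s L -> length_ge mP s (iadj L x).
Proof.
move=> mx px; elim: s L => // s IH L [L' [L's LL' L'L len]].
exists (iadj L' x); split; [by rewrite local_sat|exact: iadj_mono| |exact: IH].
move=> H; apply: L'L; apply: (local_nakayama1 mx) => a L'a.
have [c Lc] : iadj L x a by apply: H; exact: iadj_sub.
exists c; last by rewrite mulrC.
apply: L's; exists x => //.
by have := idealB L'a (LL' _ Lc); rewrite opprB addrC subrK mulrC.
Qed.

Lemma pow_sat_pow p (pP : prime_ideal p) K n e :
  ideal_pow p n `<=` sat pP K -> ideal_pow p (n * e) `<=` sat pP (ideal_pow K e).
Proof.
move=> pK; elim: e => [|e IH]; first by move=> x _; apply: sat_sub; exact: pow0.
rewrite mulnS; apply: powD_min => x y /pK[s ps Kx] /IH[t pt Ky].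
by exists (s * t); [exact: primeM|rewrite mulrACA; exact: powS].
Qed.

Lemma symbolic_sub_adjacent d (g : 'I_d -> A) p (pP : prime_ideal p) :
  (m : set A) = ideal_gen (range g) ->
  depth_ge d (ideal_bot A) -> dim_lt d.+1 (ideal_bot A) ->
  ~ (m `<=` p) -> ~ chain_above 2 p ->
  forall N, exists k, sat pP (ideal_pow p k) `<=` ideal_pow m N.
Proof.
move=> mE dep dim mp p2 N.
have pm := local_prime_sub pP.
have bot0 I : ideal_bot A `<=` I by move=> _ ->; exact: ideal0.
have pch : chain_above 1 p by exists m.
(* Dimension 0 is excluded by p lying strictly below m; from here the dimension is d + 1. *)
case: d g mE dep dim => [g _ _ /(_ p pP (bot0 p))//|d g mE dep dim].
have [l [ld lp lreg ldim]] := regular_seq_in pP p2 (bot0 p) dep dim.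
set K := iadjs _ l in ldim.
(* With a sequence l of length d in p and x in m \ p, and K' the saturation *)
(* at p of the ideal of k-th powers of l, compare two bounds for the length *)
(* of A / J with J = K' + (x^k). It is at least k * k^d. If f were not in    *)
(* m^N, then, as J contains f^(C(d+1)) and the M-th powers of generators   *)
(* of m with M proportional to k, it would be at most a constant times k^d. *)
have [C pC] : exists C, ideal_pow p C `<=` sat pP K.
  apply: (minimal_prime_pow noethA) => q qP Kq qp; apply: contrapT => pq.
  by apply: (ldim q qP Kq); exists p.
have [x mx px] : exists2 x, m x & ~ p x.
  by apply: contrapT => H; apply: mp => x mx; apply: contrapT => px; apply: H; exists x.
(* No prime other than m contains p and x. *)
have [c mc] : exists c, ideal_pow m c `<=` iadj p x.
  apply: (radical_pow_sub noethA) => a ma; apply: contrapT => H.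
  have [|q [qP Iq qm qa]] := @prime_below _ m (iadj p x) a mP.
    by move=> s n ms /(local_cancel ms) Ia; apply: H; exists n.
  apply: p2; exists q; split=> //.
  - exact: subset_trans (@iadj_sub _ _ _) Iq.
  - by move=> /(_ x) qpx; apply: px; apply: qpx; apply: Iq; exact: iadj_mem.
  - by exists m; split=> // /(_ a ma).
(* The factor of k^d in [length_le_hypersurface] for the exponents a = C (d + 1) and M = c (C (d +
   1) + 1) k found below. *)
pose bound := (C * d.+1 * (2 * N) * (c * (C * d.+1 + 1)) ^ d)%N.
pose k := bound.+1; exists k => f pf; apply: contrapT => fN.
pose K' := sat pP (iadjs (ideal_bot A) [seq y ^+ k | y <- l]).
(* K^(d k + 1) lies in the ideal of k-th powers of l, and C (d k + 1) <= C (d + 1) k since k >=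
   1. *)
have pK' : ideal_pow p (C * d.+1 * k) `<=` K'.
  have Cle : (C * (size l * k).+1 <= C * d.+1 * k)%N.
    rewrite ld -mulnA leq_mul2l; apply/orP; right.
    by rewrite mulSn -addn1 addnC leq_add2r.
  move=> z /(pow_leq Cle)/(pow_sat_pow pC); apply: sat_mono.
  by apply: fg_pow_sub => a al; apply: iadjs_mem; exact: map_f.
have K'nzd y : ~ p y -> nzd K' y by move=> py a; exact: satK.
pose J := iadj K' (x ^+ k).
have Jlen : length_ge mP (k * k ^ d) J.
  rewrite -(local_sat J); apply: length_ge_adj_exp; first exact: K'nzd.
  rewrite local_sat; apply: (length_ge_parameter (pP := pP)) => //.
  by rewrite -ld; exact: length_ge_regular_seq.
have Jf : J (f ^+ (C * d.+1)).
  apply: iadj_sub; have [s ps pk] := pf.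
  apply: (satK (s := s ^+ (C * d.+1))); first by move=> /(primeX pP).
  by rewrite -exprMn; apply: pK'; rewrite [(_ * k)%N]mulnC; exact: pow_pow_expr.
have Jg i : J (g i ^+ (c * (C * d.+1 + 1) * k)).
  rewrite -mulnA exprM mulnDl mul1n.
  apply: (adj_pow_sub (K := p) (a := x)) (pow_expr _).
  - exact: subset_trans pK' (@iadj_sub _ _ _).
  - exact: iadj_mem.
  - by apply: mc; apply: pow_expr; rewrite mE; apply: gen_mem; exists i.
have fN' : ~ sat mP (ideal_pow m N) f by rewrite local_sat.
have := length_le_hypersurface mE Jg Jf fN' (s := k * k ^ d).
rewrite local_sat => /(_ Jlen) /=; rewrite expnMn mulnA.
by rewrite leq_pmul2r ?expn_gt0 // ltnn.
Qed.

End LocalRing.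

(** * Localization *)

Section FinitelyManyDenominators.
Variables (A : comPzRingType) (p : ideal A) (pP : prime_ideal p).

Lemma noeth_sat_denominator (K I : ideal A) : noetherian_ring A ->
  K `<=` sat pP I -> exists2 s, ~ p s & forall x, K x -> I (s * x).
Proof.
move=> noethA; have [l ->] := noeth_fg noethA K => lI.
have {lI} : forall x, x \in l -> sat pP I x by move=> x /iadjs_mem/lI.
elim/last_ind: l => [_|l a IH lI].
  by exists 1; [exact: prime1|move=> _ ->; rewrite mulr0; exact: ideal0].
have [|s ps sl] := IH.
  by move=> x xl; apply: lI; rewrite mem_rcons inE xl orbT.
have [|t pt ta] := lI a; first by rewrite mem_rcons inE eqxx.
exists (s * t); first exact: primeM.
rewrite /iadjs foldl_rcons -/(iadjs _ l) => x [c /sl lx].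
have -> : s * t * x = t * (s * (x - c * a)) + s * c * (t * a) by ring.
by apply: idealD; exact: idealM.
Qed.

End FinitelyManyDenominators.

(** The localization at p up to isomorphism, so that the stalks of Y serve directly as localizations
    of a chart ring. *)
Definition is_localization (A B : comPzRingType) (phi : {rmorphism A -> B})
    (p : ideal A) : Prop :=
  [/\ forall s, ~ p s -> is_unit (phi s),
      forall b, exists a s, ~ p s /\ b * phi s = phi a &
      forall a, phi a = 0 -> exists2 s, ~ p s & s * a = 0].

Lemma unit_cancel (B : comPzRingType) (I : ideal B) x u :
  is_unit u -> I (x * u) -> I x.
Proof.
by move=> [v uv] Ixu; rewrite -[x]mulr1 -uv mulrA; exact: idealMr.
Qed.

Section IdealExtension.
Variables (A B : comPzRingType) (phi : {rmorphism A -> B}).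
Implicit Types (I q r : ideal A) (Q : ideal B) (b : B).

Definition iext I : ideal B := ideal_gen [set phi a | a in I].

Lemma iext_mem I a : I a -> iext I (phi a).
Proof. by move=> Ia; apply: gen_mem; exists a. Qed.

Lemma iext_mono I q : I `<=` q -> iext I `<=` iext q.
Proof. by move=> Iq; apply: gen_min => _ [a Ia <-]; apply: iext_mem; exact: Iq. Qed.

Lemma iext_preim Q : iext (ideal_preim phi Q) `<=` Q.
Proof. by apply: gen_min => _ [a Qa <-]. Qed.

Variables (p : ideal A) (pP : prime_ideal p).
Hypothesis phiL : is_localization phi p.

Lemma iextP I b :
  iext I b <-> exists a s, [/\ I a, ~ p s & b * phi s = phi a].
Proof.
split; last first.
  move=> [a [s [Ia ps bs]]]; apply: (@unit_cancel _ _ _ (phi s)).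
    by case: phiL => H _ _; exact: H.
  by rewrite bs; exact: iext_mem.
pose E := [set b | exists a s, [/\ I a, ~ p s & b * phi s = phi a]].
have E0 : E 0.
  exists 0, 1; rewrite rmorph0 mul0r.
  by split=> //; [exact: ideal0|exact: prime1].
have ED x y : E x -> E y -> E (x + y).
  move=> [a [s [Ia ps xs]]] [c [t [Ic pt yt]]].
  exists (t * a + s * c), (s * t); split.
  - by apply: idealD; exact: idealM.
  - exact: primeM.
  - by rewrite rmorphD !rmorphM -xs -yt; ring.
have EM c x : E x -> E (c * x).
  move=> [a [s [Ia ps xs]]]; case: phiL => _ /(_ c)[e [t [pt ct]]] _.
  exists (e * a), (t * s); split; [exact: idealM|exact: primeM|].
  by rewrite !rmorphM -xs -ct; ring.
suff : iext I `<=` Ideal E0 ED EM by exact.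
apply: gen_min => _ [a Ia <-]; exists a, 1.
by rewrite rmorph1 mulr1; split=> //; exact: prime1.
Qed.

Lemma phi_eq a c : phi a = phi c -> exists2 s, ~ p s & s * a = s * c.
Proof.
move=> ac; case: phiL => _ _ /(_ (a - c))[|s ps].
  by rewrite rmorphB ac subrr.
by rewrite mulrBr => /subr0_eq; exists s.
Qed.

Lemma iext_phi I a : iext I (phi a) <-> sat pP I a.
Proof.
rewrite iextP; split=> [[c [s [Ic ps]]]|[s ps Isa]].
  rewrite -rmorphM => /phi_eq[t pt e]; exists (t * s); first exact: primeM.
  by rewrite -mulrA [s * a]mulrC e; exact: idealM.
by exists (s * a), s; split=> //; rewrite rmorphM mulrC.
Qed.

Lemma iext_preimE Q : iext (ideal_preim phi Q) = Q.
Proof.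
apply: ideal_ext => b; split; first exact: iext_preim.
move=> Qb; apply/iextP; case: phiL => _ /(_ b)[a [s [ps bs]]] _.
by exists a, s; split=> //=; rewrite -bs; exact: idealMr.
Qed.

Lemma iext_sub_sat I q : iext I `<=` iext q -> I `<=` sat pP q.
Proof. by move=> H a Ia; apply/iext_phi; apply: H; exact: iext_mem. Qed.

Lemma iext_sub_prime r q : prime_ideal q -> q `<=` p ->
  iext r `<=` iext q -> r `<=` q.
Proof.
by move=> qP qp /iext_sub_sat/subset_trans; apply; exact: sat_prime.
Qed.

Lemma iext_prime q : prime_ideal q -> q `<=` p -> prime_ideal (iext q).
Proof.
move=> qP qp; split.
  apply/proper1; rewrite -(rmorph1 phi) => /iext_phi/(sat_prime (pP := pP) qP qp).
  exact: prime1.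
have [punit pfrac _] := phiL.
move=> x y qxy; have [a [s [ps xs]]] := pfrac x; have [c [t [pt yt]]] := pfrac y.
have : iext q (phi (a * c)).
  have -> : phi (a * c) = phi s * phi t * (x * y) by rewrite rmorphM -xs -yt; ring.
  exact: idealM.
move=> /iext_phi/(sat_prime (pP := pP) qP qp); case: qP => _ /[apply]-[qa|qc]; [left|right].
  by apply: (unit_cancel (punit s ps)); rewrite xs; exact: iext_mem.
by apply: (unit_cancel (punit t pt)); rewrite yt; exact: iext_mem.
Qed.

Lemma preim_prime Q : prime_ideal Q ->
  prime_ideal (ideal_preim phi Q) /\ ideal_preim phi Q `<=` p.
Proof.
move=> [/proper1 Q1 QM]; split.
  by split; [apply/proper1; rewrite /= rmorph1|move=> x y; rewrite /= rmorphM; exact: QM].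
move=> a /= Qa; apply: contrapT => pa; case: phiL => /(_ a pa)[v av] _ _.
by apply: Q1; rewrite -av; exact: idealMr.
Qed.

Lemma iext_pow I n : ideal_pow (iext I) n `<=` iext (ideal_pow I n).
Proof.
elim: n => [b _|n IH].
  by rewrite -[b]mulr1 -(rmorph1 phi); apply: idealM; apply: iext_mem; exact: pow0.
apply: powS_min => x y /iextP[a [s [Ia ps xs]]] /IH/iextP[c [t [Ic pt yt]]].
apply/iextP; exists (a * c), (s * t); split; [exact: powS|exact: primeM|].
by rewrite !rmorphM -xs -yt; ring.
Qed.

Lemma iext_nonunit b : ~ iext p b -> is_unit b.
Proof.
case: phiL => punit /(_ b)[a [s [ps bs]]] _ pb.
have pa : ~ p a by move=> pa; apply: pb; apply/iextP; exists a, s.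
have [v av] := punit a pa; exists (phi s * v).
by rewrite mulrA bs.
Qed.

Lemma iext_maximal Q : maximal_ideal Q -> (Q : set B) = iext p.
Proof.
move=> [/proper1 Q1 Qmax]; rewrite -(Qmax (iext p)) //.
  move=> b Qb; apply: contrapT => /iext_nonunit[v bv]; apply: Q1.
  by rewrite -bv; exact: idealMr.
by have [] := iext_prime pP (@subset_refl _ p).
Qed.

End IdealExtension.

(** * Symbolic powers in a Noetherian ring with regular localizations *)

Section RegularRing.
Variable A : comPzRingType.
Hypothesis noethA : noetherian_ring A.
Implicit Types (I p q r : ideal A).

Fixpoint chain_between (k : nat) p q : Prop :=
  if k is k'.+1 then
    exists r, [/\ prime_ideal r, p `<=` r, ~ (r `<=` p), r `<=` q &
                  chain_between k' r q]
  else True.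

Lemma chain_between_rcons k p q r : prime_ideal r -> q `<=` r -> ~ (r `<=` q) ->
  p `<=` q -> chain_between k p q -> chain_between k.+1 p r.
Proof.
move=> rP qr rq; elim: k p => [|k IH] p pq.
  move=> _; exists r; split=> //; first exact: subset_trans qr.
  by move=> /subset_trans/(_ pq).
move=> [s [sP ps sp sq ch]]; exists s; split=> //; last exact: IH.
exact: subset_trans qr.
Qed.

Section AtPrime.
Variables (q : ideal A) (qP : prime_ideal q).
Variables (B : comPzRingType) (phi : {rmorphism A -> B}).
Hypothesis phiL : is_localization phi q.
Hypothesis regB : regular_local_ring B.

Let m : ideal B := iext phi q.
Let mP : prime_ideal m := iext_prime qP phiL qP (@subset_refl _ q).
Let munit x : ~ m x -> is_unit x := iext_nonunit qP phiL (b := x).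

(** A chain of d + 1 primes together with d generators of the maximal ideal is what
    [regular_prime_depth] needs. *)
Lemma regular_at : exists d (g : 'I_d -> B),
  [/\ (m : set B) = ideal_gen (range g), depth_ge m d (ideal_bot B) &
      dim_lt d.+1 (ideal_bot B)].
Proof.
have [noethB _ [d [g [[[c [cP cS]] _] gmax]]]] := regB.
exists d, g; have mE : (m : set B) = ideal_gen (range g).
  by rewrite (iext_maximal qP phiL gmax).
pose l := [seq g i | i <- enum 'I_d].
have ml : m = iadjs (ideal_bot B) l.
  apply: ideal_ext => x; have -> : m x = ideal_gen (range g) x by rewrite -mE.
  split.
    by apply: gen_min => _ [i _ <-]; apply: iadjs_mem; apply: map_f; rewrite mem_enum.
  apply: iadjs_min => [_ ->|_ /mapP[i _ ->]]; first exact: ideal0.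
  by apply: gen_mem; exists i.
have ld : size l = d by rewrite size_map size_enum_ord.
have ch j k : (j + k = d)%N -> chain_above k (c j).
  elim: k j => // k IH j jk; exists (c j.+1).
  have [jd cj] : (j.+1 <= d)%N /\ (c j `<` c j.+1).
    by split; [|apply: cS]; lia.
  have [? ?] := cj; split=> //; first exact: cP.
  by apply: IH; lia.
split=> //; last by rewrite -ld; exact: (dim_lt_generated noethB mP munit ml).
have [_] := regular_prime_depth noethB mP munit ml (cP 0%N (leq0n d))
  (I := ideal_bot B) (fun x x0 => eq_ind_r _ (ideal0 _) x0)
  (eq_ind_r (fun k => chain_above k _) (ch 0%N d erefl) ld).
by rewrite ld.
Qed.

Lemma regular_chain_bound : exists d, forall p, prime_ideal p -> p `<=` q ->
  ~ chain_between d p q.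
Proof.
have [d [g [_ _ dim]]] := regular_at; exists d.+1 => p pP pq ch.
have ext k r : prime_ideal r -> r `<=` q -> chain_between k r q ->
    chain_above k (iext phi r).
  elim: k r => // k IH r rP rq [s [sP rs sr sq chs]]; exists (iext phi s).
  split; [exact: (iext_prime qP phiL sP sq)|exact: iext_mono| |exact: IH].
  by move=> /(iext_sub_prime qP phiL rP rq).
apply: (dim _ (iext_prime qP phiL pP pq)) (ext _ _ pP pq ch).
by move=> _ ->; exact: ideal0.
Qed.

Lemma symbolic_sub_power_adjacent p (pP : prime_ideal p) : p `<=` q ->
  ~ (q `<=` p) ->
  (forall r, prime_ideal r -> p `<=` r -> r `<=` q -> ~ (q `<=` r) -> r `<=` p) ->
  forall N, exists k, sat pP (ideal_pow p k) `<=` sat qP (ideal_pow q N).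
Proof.
move=> pq qp adj N; have [d [g [mE dep dim]]] := regular_at.
have PP := iext_prime qP phiL pP pq.
have mp : ~ (m `<=` iext phi p) by move=> /(iext_sub_prime qP phiL pP pq).
(* The middle prime of such a chain would contract to a prime strictly between p and q. *)
have ch2 : ~ chain_above 2 (iext phi p).
  move=> [Q1 [Q1P pQ1 Q1p [Q2 [Q2P Q12 Q21 _]]]].
  have [rP rq] := preim_prime phiL Q1P; have rE := iext_preimE qP phiL Q1.
  apply: Q1p; rewrite -rE; apply: iext_mono; apply: adj => //.
    by move=> a pa; apply: pQ1; exact: iext_mem.
  move=> qr; apply: Q21; rewrite -rE.
  apply: subset_trans (iext_mono qr).
  exact: (local_prime_sub munit Q2P).
have [noethB _ _] := regB.
have [k kN] := symbolic_sub_adjacent noethB mP munit PP mE dep dim mp ch2 N.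
exists k => x [s ps sx]; apply/(iext_phi qP phiL); apply: (iext_pow qP phiL).
apply: kN; exists (phi s).
  by move=> /(iext_phi qP phiL)/(sat_prime (pP := qP) pP pq).
rewrite -rmorphM; apply: ideal_pow_morph sx; exact: iext_mem.
Qed.

End AtPrime.

Hypothesis regA : forall q, prime_ideal q ->
  exists (B : comPzRingType) (phi : {rmorphism A -> B}),
    is_localization phi q /\ regular_local_ring B.

(** Chains from p to q have bounded length because A_q has finite dimension. Induction on that bound
    inserts a prime r maximal among those strictly below q, and treats the step from r to q by the
    adjacent case. *)
Lemma symbolic_sub_power p q (pP : prime_ideal p) (qP : prime_ideal q) :
  p `<=` q -> forall N, exists k, sat pP (ideal_pow p k) `<=` sat qP (ideal_pow q N).
Proof.
have [D Dpq] : exists D, forall r, prime_ideal r -> r `<=` q -> ~ chain_between D r q.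
  by have [B [phi [phiL regB]]] := regA qP; exact: regular_chain_bound phiL regB.
move=> pq; have {Dpq} := Dpq p pP pq.
elim: D p q pP qP pq => [|D IH] p q pP qP pq ch N; first by case: ch.
have [qp|qp] := pselect (q `<=` p).
  have pE : p = q by apply: ideal_ext => x; split; [exact: pq|exact: qp].
  by subst q; exists N => x [s ps sx]; exists s.
have [|r [rP pr rq qr] rmax] := @noeth_max _ noethA
    (fun r => [/\ prime_ideal r, p `<=` r, r `<=` q & ~ (q `<=` r)]) p.
  by split.
have [B [phi [phiL regB]]] := regA qP.
have [|k1 k1N] := symbolic_sub_power_adjacent qP phiL regB rP rq qr _ N.
  move=> s sP rs sq qs; rewrite (rmax s) //; split=> //; exact: subset_trans rs.
have [|k kk1] := IH p r pP rP pr _ k1.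
  by move=> /(chain_between_rcons qP rq qr pr).
by exists k; exact: subset_trans k1N.
Qed.

(** An associated prime of the saturation of I at p becomes one of I after multiplying z by a common
    denominator. *)
Lemma ass_below I p : prime_ideal p -> I `<=` p ->
  exists z, [/\ ~ I z, prime_ideal (ann I z) & ann I z `<=` p].
Proof.
move=> pP Ip; have I1 : ~ sat pP I 1.
  by move=> [s ps]; rewrite mulr1 => /Ip.
have [r [Ir rP]] := ass_above noethA I1; set z := r * 1 in Ir rP.
have [s ps sz] : exists2 s, ~ p s & forall x, ideal_gen
    [set y * z | y in ann (sat pP I) z] x -> I (s * x).
  apply: (noeth_sat_denominator (pP := pP)) => //.
  by apply: gen_min => _ [y /annE yz <-].
have annI : ann I (s * z) = ann (sat pP I) z.
  apply: ideal_ext => y; rewrite !annE mulrCA; split=> [Isyz|yz].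
    by exists s.
  by apply: sz; apply: gen_mem; exists y => //; apply/annE.
exists (s * z); rewrite annI; split=> //.
  by move=> Isz; apply: Ir; exists s.
by move=> y /annE yz; apply: contrapT => py; apply: Ir; exact: satK yz.
Qed.

Lemma symbolic_sub_uniform I n : exists m, forall q, prime_ideal q ->
  forall (B : comPzRingType) (phi : {rmorphism A -> B}), is_localization phi q ->
  symbolic_pow (iext phi I) m.+1 `<=` ideal_pow (iext phi I) n.
Proof.
have [l [lP lI]] := primary_decomposition noethA (ideal_pow I n).
(* For a component c = (Q, P) of I^n: the m-th symbolic power of some associated prime of I below P
   lies in Q. Larger m remain good, so finitely many components share one m. *)
pose good m (c : ideal A * ideal A) := exists z (zP : prime_ideal (ann I z)),
  [/\ ~ I z, ann I z `<=` c.2 & sat zP (ideal_pow (ann I z) m) `<=` c.1].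
have [m mgood] : exists m, forall c, c \in l -> good m c.
  have : forall c, c \in l -> exists m, good m c.
    move=> c /lP[c2P Ic c12 [N cN] csat].
    have Ic2 : I `<=` c.2 by apply: (prime_pow (n := n) c2P); exact: subset_trans c12.
    have [z [Iz zP zc]] := ass_below c2P Ic2.
    have [k kN] := symbolic_sub_power zP c2P zc N; exists k, z, zP; split=> //.
    apply: (subset_trans kN); apply: sat_min => //.
  elim: (l) => [|c l' IH] lgood; first by exists 0%N.
  have [m1 m1g] : exists m, good m c by apply: lgood; rewrite inE eqxx.
  have [|m2 m2g] := IH; first by move=> c' cl; apply: lgood; rewrite inE cl orbT.
  have mono j k c' : (j <= k)%N -> good j c' -> good k c'.
    move=> jk [z [zP [Iz zc zs]]]; exists z, zP; split=> //.
    by apply: subset_trans zs; apply: sat_mono; exact: pow_leq.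
  exists (m1 + m2)%N => c'; rewrite inE => /predU1P[->|/m2g m2c].
    by apply: mono m1g; exact: leq_addr.
  by apply: mono m2c; exact: leq_addl.
exists m => q qP B phi phiL b bsym.
have [punit pfrac _] := phiL; have [x [t [qt bt]]] := pfrac b.
apply: (unit_cancel (punit t qt)); rewrite bt.
suff [s qs sx] : sat qP (ideal_pow I n) x.
  apply: (unit_cancel (punit s qs)); rewrite mulrC -rmorphM.
  by apply: ideal_pow_morph sx; exact: iext_mem.
have {bsym} xsym : symbolic_pow (iext phi I) m.+1 (phi x).
  by rewrite -bt; exact: idealMr.
have [s qs sx] : exists2 s, ~ q s & forall c, c \in l -> c.1 (s * x).
  have : forall c, c \in l -> exists2 s, ~ q s & c.1 (s * x).
    move=> c cl; have [c2P Ic c12 [N cN] csat] := lP c cl.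
    have [z [zP [Iz zc zs]]] := mgood c cl.
    (* A component whose radical is not inside q becomes the unit ideal after localizing at q. *)
    have [c2q|c2q] := pselect (c.2 `<=` q); last first.
      have [a ca qa] : exists2 a, c.2 a & ~ q a.
        apply: contrapT => H; apply: c2q => a ca.
        by apply: contrapT => qa; apply: H; exists a.
      exists (a ^+ N); first by move=> /(primeX qP).
      by apply: idealMr; apply: cN; exact: pow_expr.
    exists 1; first exact: prime1.
    rewrite mul1r; apply: zs.
    have zq := subset_trans zc c2q.
    have RP := iext_prime qP phiL zP zq.
    have Iproper : proper_ideal (iext phi I).
      apply/proper1; rewrite -(rmorph1 phi) => /(iext_phi qP phiL)[s qs].
      rewrite mulr1 => Is; apply: qs; apply: zq; apply/annE; exact: idealMr.
    (* Associated primes of I inside q extend to associated primes of the localized ideal, so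
       membership in its symbolic power can be tested there. *)
    have ass : assoc_prime (iext phi I) (SpecPoint RP).
      exists (quot_pi (iext phi I) (phi z)); apply/seteqP.
      have qE (r : B) : quot_pi (iext phi I) r * quot_pi (iext phi I) (phi z) = 0 <->
          iext phi I (r * phi z).
        rewrite -rmorphM -(rmorph0 (quot_pi (iext phi I))); split.
          by move/(@qclP (quot_pre (iext phi I))) => /=; rewrite subr0.
        by move=> H; apply/(@qclP (quot_pre (iext phi I))); rewrite /= subr0.
      split=> r.
        move=> /(iextP qP phiL)[a [s [az qs rs]]]; apply/qE.
        apply: (unit_cancel (punit s qs)); rewrite mulrAC rs -rmorphM.
        by apply: iext_mem; apply/annE.
      move=> /qE rz; have [a [s [qs rs]]] := pfrac r.
      have : iext phi I (phi (a * z)).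
        rewrite rmorphM -rs mulrAC mulrC; exact: idealM.
      move=> /(iext_phi qP phiL)[u qu uaz]; apply/(iextP qP phiL).
      exists a, s; split=> //.
      have : ann I z (u * a) by apply/annE; rewrite -mulrA.
      by case: (zP) => _ /[apply]-[/zq|].
    have /ker_quot_locP[S zS Sx] := xsym Iproper _ ass.
    have RS : ~ iext phi (ann I z) S := zS.
    have [s' [u [qu Su]]] := pfrac S.
    have : iext phi (ideal_pow I m.+1) (phi (s' * x)).
      apply: (iext_pow qP phiL); rewrite rmorphM -Su mulrAC mulrC; exact: idealM.
    move=> /(iext_phi qP phiL)[v qv vsx]; exists (v * s').
      apply: primeM => //; first by move=> /zq.
      by move=> s'z; apply: RS; apply/(iextP qP phiL); exists s', u.
    rewrite -mulrA; apply: (pow_leq (leqnSn m)); move: vsx; apply: pow_mono.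
    by move=> a Ia; apply/annE; exact: idealMr.
  elim: (l) => [|c l' IH] H; first by exists 1; [exact: prime1|].
  have [|s qs sl] := IH; first by move=> c' cl; apply: H; rewrite inE cl orbT.
  have [|t' qt' tc] := H c; first by rewrite inE eqxx.
  exists (s * t'); first exact: primeM.
  move=> c'; rewrite inE => /predU1P[->|/sl].
    by rewrite -mulrA; exact: idealM.
  by rewrite mulrAC; exact: idealMr.
by exists s => //; exact: lI.
Qed.

End RegularRing.

(** * Affine charts *)

Lemma loc_fracP (A : comPzRingType) (S : mulset A) a s (Ss : S s) b t (St : S t) :
  loc_frac a Ss = loc_frac b St <-> exists2 u, S u & u * (a * t) = u * (b * s).
Proof. exact: (@qclP (loc_pre S)). Qed.

Section SpecSections.
Variable A : comPzRingType.

Definition spec_all : opens (Spec A) := Opens openT.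

Lemma basic_open_subproof (h : A) : open [set p : Spec A | ~ (p : spec A) h].
Proof.
suff : zariski_open [set p : spec A | ~ p h] by [].
exists [set h]; apply/seteqP; split=> p /=.
  by move=> ph /(_ h erefl).
by move=> H ph; apply: H => _ ->.
Qed.

Definition basic_open (h : A) : opens (Spec A) := Opens (basic_open_subproof h).

Lemma basic_open_nbhs (V : opens (Spec A)) (p : spec A) : V p ->
  exists2 h, ~ p h & basic_open h `<=` V.
Proof.
have [E VE] : zariski_open (V : set (spec A)) by exact: (oset_open V).
have VP (q : spec A) : V q = ~ zariski_closed E q := congr1 (fun S => S q) VE.
rewrite VP => pE; apply: contrapT => H; apply: pE => h Eh.
apply: contrapT => ph; apply: H; exists h => // q qh.
by rewrite VP => /(_ h Eh).
Qed.

Lemma frac_sec_subproof (V : opens (Spec A)) (a g : A)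
    (Vg : forall p : spec A, V p -> prime_compl p g) :
  loc_presentable (spec_presentation A)
    (fun (p : Spec A) (Vp : V p) => loc_frac a (Vg p Vp)).
Proof.
move=> p Vp; exists V, (fun _ Vq => Vq); split=> //.
by exists a, g => q Vq; exists (Vg q Vq).
Qed.

Definition frac_sec V a g Vg : rs_sheaf (Spec A) V :=
  exist _ _ (@frac_sec_subproof V a g Vg).

End SpecSections.

(** * Sections and germs on an affine chart *)

Section Chart.
Variables (Y : ringed_space) (A : comPzRingType) (f : rs_mor (Spec A) Y).
Hypothesis fI : open_immersion f.
Implicit Types (V : opens (Spec A)) (U W : opens Y) (p : spec A).

Let f_open V : open (f @` V).
Proof. by case: fI. Qed.

Definition chart_image V : opens Y := Opens (f_open V).

Lemma chart_image_sub V : V `<=` f @^-1` chart_image V.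
Proof. by move=> p Vp; exists p. Qed.

Lemma chart_image_min V U : V `<=` f @^-1` U -> chart_image V `<=` U.
Proof. by move=> VU _ [p /VU Up <-]. Qed.

(** The value in A_p of a section of Y; on a chart these values determine the section. *)
Definition ev W (t : \O_Y W) p (Wp : W (f p)) : loc_at p :=
  lpval (comor_preim f W t) Wp.

Lemma ev_comor W V (h : V `<=` f @^-1` W) (t : \O_Y W) p (Vp : V p) :
  lpval (comor f h t) Vp = ev t (h p Vp).
Proof.
have := @comor_res _ _ f W W (open_preim f W) V (@subset_refl _ _) h
  (@subset_refl _ _) h t.
by rewrite res_id => <-.
Qed.

Lemma ev_irr W (t : \O_Y W) p (Wp Wp' : W (f p)) : ev t Wp = ev t Wp'.
Proof. by rewrite (Prop_irrelevance Wp Wp'). Qed.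

Lemma ev_res W W' (k : W' `<=` W) (t : \O_Y W) p (Wp : W' (f p)) :
  ev (res k t) Wp = ev t (k _ Wp).
Proof.
pose h : open_preim f W' `<=` f @^-1` W := fun q => k (f q).
have := @comor_res _ _ f W W' (open_preim f W) (open_preim f W') k h
  (@subset_refl _ _) (@subset_refl _ _) t.
by rewrite /ev => <-.
Qed.

Lemma evB W (s t : \O_Y W) p (Wp : W (f p)) : ev (s - t) Wp = ev s Wp - ev t Wp.
Proof. by rewrite /ev rmorphB [LHS]lpvalB. Qed.
Lemma evM W (s t : \O_Y W) p (Wp : W (f p)) : ev (s * t) Wp = ev s Wp * ev t Wp.
Proof. by rewrite /ev rmorphM. Qed.
Lemma ev1 W p (Wp : W (f p)) : ev (1 : \O_Y W) Wp = 1.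
Proof. by rewrite /ev rmorph1. Qed.
Lemma ev0 W p (Wp : W (f p)) : ev (0 : \O_Y W) Wp = 0.
Proof. by rewrite -(subrr 1) evB subrr. Qed.
Lemma evX W (t : \O_Y W) n p (Wp : W (f p)) : ev (t ^+ n) Wp = ev t Wp ^+ n.
Proof. by elim: n => [|n IH]; rewrite ?ev1 // !exprS evM IH. Qed.

Lemma chart_sec_ext V (s t : \O_Y (chart_image V)) :
  (forall p (Vp : V p), ev s (chart_image_sub Vp) = ev t (chart_image_sub Vp)) ->
  s = t.
Proof.
case: fI => _ _ /(_ (chart_image V) V (@chart_image_sub V) erefl) fbij st.
by apply: (bij_inj fbij); apply: lpsec_eq => p Vp; rewrite !ev_comor.
Qed.

Lemma chart_sec_exists V (u : rs_sheaf (Spec A) V) :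
  exists t : \O_Y (chart_image V),
    forall p (Vp : V p) Wp, ev t (p := p) Wp = lpval u Vp.
Proof.
case: fI => _ _ /(_ (chart_image V) V (@chart_image_sub V) erefl)[g _ gK].
exists (g u) => p Vp Wp; rewrite (ev_irr _ Wp (chart_image_sub Vp)) -ev_comor.
by rewrite gK.
Qed.

Lemma germ_ev U U' (s : \O_Y U) (t : \O_Y U') V p (Vp : V p)
    (VU : V `<=` f @^-1` U) (VU' : V `<=` f @^-1` U') (Up : U (f p)) (Up' : U' (f p)) :
  (forall q (Vq : V q), ev s (VU q Vq) = ev t (VU' q Vq)) ->
  germ Up s = germ Up' t.
Proof.
move=> st; apply/germP.
exists (chart_image V), (chart_image_min VU), (chart_image_min VU').
split; first by exists p.
apply: chart_sec_ext => q Vq; rewrite !ev_res.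
by rewrite (ev_irr _ _ (VU q Vq)) (ev_irr _ _ (VU' q Vq)) st.
Qed.

Lemma ev_germ U U' (s : \O_Y U) (t : \O_Y U') p (Up : U (f p)) (Up' : U' (f p)) :
  germ Up s = germ Up' t -> ev s Up = ev t Up'.
Proof.
move=> /germP[W [h [k [Wp e]]]].
by rewrite (ev_irr _ Up (h _ Wp)) (ev_irr _ Up' (k _ Wp)) -!ev_res e.
Qed.

Lemma ev_local U (s : \O_Y U) p : U (f p) -> exists h a g,
  [/\ ~ p h, basic_open h `<=` f @^-1` U & forall q (Uq : U (f q)), ~ q h ->
     exists gq : prime_compl q g, ev s Uq = loc_frac a gq].
Proof.
move=> Up; have [V [VU [Vp [a [g ag]]]]] := svalP (comor_preim f U s) p Up.
have [h ph hV] := basic_open_nbhs Vp.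
exists h, a, g; split=> // [q /hV/VU//|q Uq /hV Vq].
have [gq e] := ag q Vq; exists gq; rewrite -e /ev /lpval.
by congr (sval _ _ _).
Qed.

Definition chart_top : opens Y := chart_image (spec_all A).

Lemma chart_top_mem p : chart_top (f p).
Proof. by exists p. Qed.

Lemma chart_sec_subproof a : exists t : \O_Y chart_top,
  forall p Wp, ev t (p := p) Wp = loc_pi (prime_compl p) a.
Proof.
have [t tE] := chart_sec_exists
  (frac_sec (V := spec_all A) a (fun p _ => mset1 (prime_compl p))).
by exists t => p Wp; rewrite (tE p Logic.I).
Qed.

Definition chart_sec a : \O_Y chart_top := sval (cid (chart_sec_subproof a)).

Lemma ev_chart_sec a p Wp : ev (chart_sec a) (p := p) Wp = loc_pi (prime_compl p) a.
Proof. exact: (svalP (cid (chart_sec_subproof a))). Qed.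

Lemma chart_sec_zmod : {morph chart_sec : a b / a - b}.
Proof.
move=> a b; apply: chart_sec_ext => p Vp; rewrite evB !ev_chart_sec /loc_pi.
rewrite loc_fracB; apply/loc_fracP; exists 1; first exact: mset1.
by ring.
Qed.

Lemma chart_sec_monoid : monoid_morphism chart_sec.
Proof.
split=> [|a b]; apply: chart_sec_ext => p Vp.
  by rewrite ev_chart_sec ev1.
rewrite evM !ev_chart_sec /loc_pi loc_fracM; apply/loc_fracP.
by exists 1; [exact: mset1|ring].
Qed.

HB.instance Definition _ :=
  GRing.isZmodMorphism.Build A (\O_Y chart_top) chart_sec chart_sec_zmod.
HB.instance Definition _ :=
  GRing.isMonoidMorphism.Build A (\O_Y chart_top) chart_sec chart_sec_monoid.

Definition chart_germ p : {rmorphism A -> stalk (f p : Y)} :=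
  @germ Y (f p) chart_top (chart_top_mem p) \o chart_sec.

Lemma germ_unit_ev U (s : \O_Y U) p (Up : U (f p)) h b c :
  basic_open h `<=` f @^-1` U -> ~ p h -> ~ p b ->
  (forall q (Uq : U (f q)), ~ q h ->
     exists cq : prime_compl q c, ev s Uq = loc_frac b cq) ->
  is_unit (germ Up s).
Proof.
move=> hU ph pb sE.
have hb : basic_open (h * b) `<=` basic_open h `&` basic_open b.
  by move=> q qhb; split=> qx; apply: qhb; [exact: idealMr|exact: idealM].
have phb : ~ p (h * b) by apply: specM.
pose V := basic_open (h * b).
have Vb q : V q -> prime_compl q b by move=> /hb[].
have [t tE] := chart_sec_exists (frac_sec (V := V) c Vb).
exists (germ (chart_image_sub (phb : V p)) t).
pose W := open_setI U (chart_image V).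
have VW : V `<=` f @^-1` W by move=> q Vq; split; [apply: hU; case: (hb q Vq)|exists q].
have Wp : W (f p) by exact: VW.
rewrite -(germ_res (@oI_l _ U (chart_image V)) Up Wp).
rewrite -(germ_res (@oI_r _ U (chart_image V)) (chart_image_sub (phb : V p)) Wp).
rewrite -rmorphM -(rmorph1 (germ Wp)) /=.
apply: (germ_ev (V := V) (VU := VW) (VU' := VW) phb) => q Vq.
rewrite evM !ev_res ev1 (tE q Vq).
have [qh qb] := hb q Vq; have [cq ->] := sE q (oI_l (VW q Vq)) qh.
rewrite [lpval _ _]/(loc_frac c (Vb q Vq)) loc_fracM -loc_frac1.
by apply/loc_fracP; exists 1; [exact: mset1|ring].
Qed.

Lemma germ_frac U (s : \O_Y U) p (Up : U (f p)) h a g :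
  ~ p h -> basic_open h `<=` f @^-1` U ->
  (forall q (Uq : U (f q)), ~ q h ->
     exists gq : prime_compl q g, ev s Uq = loc_frac a gq) ->
  germ Up s * chart_germ p g = chart_germ p a.
Proof.
move=> ph hU sE; pose W := open_setI U chart_top.
have VW : basic_open h `<=` f @^-1` W.
  by move=> q qh; split; [exact: hU|exact: chart_top_mem].
have Wp : W (f p) by exact: VW.
rewrite /chart_germ /= -(germ_res (@oI_l _ U chart_top) Up Wp).
rewrite -(germ_res (@oI_r _ U chart_top) _ Wp) -rmorphM /=.
apply: (germ_ev (V := basic_open h) (VU := VW) (VU' := fun q _ => chart_top_mem q) ph).
move=> q qh; rewrite evM !ev_res !ev_chart_sec.
have [gq ->] := sE q (oI_l (VW q qh)) qh.
rewrite /loc_pi loc_fracM; apply/loc_fracP.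
by exists 1; [exact: mset1|ring].
Qed.

Lemma chart_localization p : is_localization (chart_germ p) p.
Proof.
split=> [s ps|b|a].
- apply: (@germ_unit_ev chart_top _ p (chart_top_mem p) 1 s 1) => //.
  + by move=> q _; exact: chart_top_mem.
  + exact: spec1.
  + by move=> q Uq _; exists (mset1 _); exact: ev_chart_sec.
- have [U [Up [s ->]]] := stalkP b.
  have [h [a [g [ph hU sE]]]] := ev_local s Up.
  have [pg _] := sE p Up ph; exists a, g; split; first exact: pg.
  exact: germ_frac ph hU sE.
- rewrite -(rmorph0 (germ (chart_top_mem p))) => /ev_germ.
  rewrite ev_chart_sec ev0 => /loc_fracP[u pu]; rewrite !mulr1 mulr0.
  by exists u.
Qed.

Lemma unit_chart_sec y (Uy : chart_top y) h :
  is_unit (germ Uy (chart_sec h)) -> chart_image (basic_open h) y.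
Proof.
have [p _ e] := Uy; move: Uy; rewrite -e => Uy [v hv]; exists p => //= ph.
have pP := specP p; have pL := chart_localization p.
apply: (prime1 (iext_prime pP pL pP (@subset_refl _ p))).
rewrite -hv; apply: idealMr; rewrite (Prop_irrelevance Uy (chart_top_mem p)).
exact: (iext_mem (phi := chart_germ p) ph).
Qed.

End Chart.

(** Quasi-compactness of Spec A for covers by basic open sets, from a maximal ideal among those
    spanned by finitely many elements of S. *)
Lemma noeth_cover (A : comPzRingType) (S : set A) : noetherian_ring A ->
  (forall q : ideal A, prime_ideal q -> exists2 e, S e & ~ q e) ->
  exists2 l : seq A, forall e, e \in l -> S e &
    forall q : ideal A, prime_ideal q -> exists2 e, e \in l & ~ q e.
Proof.
move=> noethA SP.
have [|_ [l [lS ->]] lmax] := @noeth_max _ noethA (fun K => exists l : seq A,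
    (forall e, e \in l -> S e) /\ K = iadjs (ideal_bot A) l) (ideal_bot A).
  by exists [::].
exists l => // q qP; have [e Se qe] := SP q qP.
apply: contrapT => H; apply: qe.
have lq : iadjs (ideal_bot A) l `<=` q.
  apply: iadjs_min => [_ ->|x xl]; first exact: ideal0.
  by apply: contrapT => qx; apply: H; exists x.
apply: lq; rewrite -(lmax (iadjs (ideal_bot A) (rcons l e))).
- by apply: iadjs_mem; rewrite mem_rcons inE eqxx.
- exists (rcons l e); split=> // x; rewrite mem_rcons inE => /predU1P[->//|].
  exact: lS.
- by rewrite /iadjs foldl_rcons; exact: iadj_sub.
Qed.

(** On an affine neighbourhood write s = a / g and t = b / c over the basic open set of h. Each
    prime containing the annihilator of a contains h b, since elsewhere t is a unit and s vanishes;
    so a power of h b kills a. *)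
Lemma local_annihilation (X : ringed_space) (W : opens X) (s t : \O_X W) x :
  is_scheme X -> W x ->
  (forall x' (Wx' : W x'), is_unit (germ Wx' t) -> germ Wx' s = 0) ->
  exists n (W' : opens X) (h : W' `<=` W), W' x /\ res h (t ^+ n * s) = 0.
Proof.
move=> [_ Xs] + H; have [B [k [kI [r _ <-]]]] := Xs x => Wr.
have [h1 [a [g [rh1 h1W sE]]]] := ev_local s Wr.
have [h2 [b [c [rh2 h2W tE]]]] := ev_local t Wr.
pose h := h1 * h2; have rh : ~ (r : spec B) h by exact: specM.
have hh q : basic_open h q -> basic_open h1 q /\ basic_open h2 q.
  by move=> qh; split=> qx; apply: qh; [exact: idealMr|exact: idealM].
have [n nE] : exists n, ann (ideal_bot B) a ((h * b) ^+ n).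
  apply: nilpotent_of_primes => q qP qann; apply: contrapT => qhb.
  pose Q := SpecPoint qP.
  have Qh : basic_open h Q by move=> qh; apply: qhb; exact: idealMr.
  have [Qh1 Qh2] := hh _ Qh; have WQ : W (k Q) := h1W _ Qh1.
  have tu : is_unit (germ WQ t).
    by apply: (germ_unit_ev kI _ h2W Qh2 _ tE) => qb; apply: qhb; exact: idealM.
  have := H _ WQ tu; rewrite -(rmorph0 (germ WQ)) => /ev_germ.
  have [gQ ->] := sE Q WQ Qh1; rewrite ev0 => /loc_fracP[u Qu].
  rewrite mulr1 mul0r mulr0 => ua; apply: Qu; apply: qann.
  by apply/annE.
have hW : basic_open h `<=` k @^-1` W by move=> q /hh[/h1W].
exists n, (chart_image kI (basic_open h)), (chart_image_min hW).
split; first by exists r.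
apply: chart_sec_ext => q qh; rewrite ev_res ev0 (ev_irr _ _ (hW q qh)) evM evX.
have [qh1 qh2] := hh q qh.
have [gq ->] := sE q (hW q qh) qh1; have [cq ->] := tE q (hW q qh) qh2.
have cqn : prime_compl q (c ^+ n).
  by move=> /(primeX (specP q)); exact: cq.
have -> : loc_frac b cq ^+ n = loc_frac (b ^+ n) cqn.
  elim: (n) cqn => [|j IH] cqj.
    by apply/loc_fracP; exists 1; [exact: mset1|rewrite !expr0].
  have cqj' : prime_compl q (c ^+ j) by move=> /(primeX (specP q)); exact: cq.
  rewrite exprS (IH cqj') loc_fracM; apply/loc_fracP.
  by exists 1; [exact: mset1|rewrite !exprS; ring].
rewrite loc_fracM; apply/loc_fracP; exists (h ^+ n).
  by move=> /(primeX (specP q)); exact: qh.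
have e : (h * b) ^+ n * a = 0 by exact: (annE _ _ _).1 nE.
have -> : h ^+ n * (b ^+ n * a * 1) = (h * b) ^+ n * a by rewrite mulr1 mulrA -exprMn.
by rewrite e mul0r mulr0.
Qed.

Section ClosedSubscheme.
Variables (X Y : ringed_space) (i : rs_mor X Y) (J : ideal_sheaf Y).
Hypothesis iJ : closed_subscheme_defined_by i J.
Variables (A : comPzRingType) (f : rs_mor (Spec A) Y).
Hypothesis noethA : noetherian_ring A.
Hypothesis fI : open_immersion f.
Implicit Types (U V W : opens Y) (p : spec A).

Lemma ideal_sheaf_comor V W (h : V `<=` W) (s : \O_Y W)
    (k : open_preim i V `<=` open_preim i W) :
  J V (res h s) <-> res k (comor_preim i W s) = 0.
Proof.
have [_ _ ->] := iJ.
by rewrite (comor_res h k (@subset_refl _ _) (@subset_refl _ _)).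
Qed.

Let chart_sub h : chart_image fI (basic_open h) `<=` chart_top fI.
Proof. by apply: chart_image_min => p _; exact: chart_top_mem. Qed.

(* the quasi-coherence of J on an affine chart *)
Lemma ideal_sheaf_power_kill (a h : A) :
  J (chart_image fI (basic_open h)) (res (@chart_sub h) (chart_sec fI a)) ->
  exists n, J (chart_top fI) (chart_sec fI (h ^+ n * a)).
Proof.
have [Xs [iloc [_ iclosed] itop _] _] := iJ => Ja.
(* The e for which the claim holds on the basic open set of e. At a point of X such an e comes from
   [local_annihilation] on X; off X it comes from a neighbourhood whose preimage in X is empty. *)
pose S e := exists n, J (chart_image fI (basic_open e))
  (res (@chart_sub e) (chart_sec fI (h ^+ n * a))).
have preim_sub V W : V `<=` W -> open_preim i V `<=` open_preim i W.
  by move=> VW x; exact: VW.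
pose W := open_preim i (chart_top fI).
pose s := comor_preim i (chart_top fI) (chart_sec fI a).
pose t := comor_preim i (chart_top fI) (chart_sec fI h).
have st x (Wx : W x) : is_unit (germ Wx t) -> germ Wx s = 0.
  move=> /iloc/unit_chart_sec hx.
  have Wx' : open_preim i (chart_image fI (basic_open h)) x by exact: hx.
  have k := preim_sub _ _ (@chart_sub h).
  rewrite -(germ_res k Wx Wx') ((ideal_sheaf_comor _ _ k).1 Ja).
  exact: rmorph0.
have [|l lS lcov] := @noeth_cover A S noethA.
  move=> q qP; pose p := SpecPoint qP.
  have [[x xp]|nx] := pselect (exists x, i x = f p).
    have Wx : W x by rewrite /W /= xp; exact: chart_top_mem.
    have [n [W' [hW [W'x tn]]]] := local_annihilation Xs Wx st.
    have [V VE] := itop W'.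
    have Vp : open_preim f V p.
      by rewrite /= -xp; have := congr1 (fun S => S x) VE; rewrite /= => <-.
    have [e pe eV] := basic_open_nbhs Vp; exists e => //; exists n.
    have k := preim_sub _ _ (@chart_sub e).
    apply/(ideal_sheaf_comor _ _ k).
    have kW : open_preim i (chart_image fI (basic_open e)) `<=` W'.
      rewrite VE; apply: preim_sub; exact: chart_image_min eV.
    rewrite (res_irr _ (subset_trans kW hW)) -resE.
    have -> : comor_preim i (chart_top fI) (chart_sec fI (h ^+ n * a)) = t ^+ n * s.
      by rewrite rmorphM /= rmorphM /= rmorphXn /= rmorphXn.
    by rewrite tn rmorph0.
  have Vo : open (~` range i) by exact: closed_openC.
  have Vp : open_preim f (Opens Vo) p by move=> [x _ xp]; apply: nx; exists x.
  have [e pe eV] := basic_open_nbhs Vp; exists e => //; exists 0%N.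
  have k := preim_sub _ _ (@chart_sub e).
  apply/(ideal_sheaf_comor _ _ k); apply: sheaf_sep => x [q' q'e q'x].
  by case: (eV q' q'e); exists x.
have [N NS] : exists N, forall e, e \in l -> J (chart_image fI (basic_open e))
    (res (@chart_sub e) (chart_sec fI (h ^+ N * a))).
  elim: (l) lS => [|e l' IH] lS; first by exists 0%N.
  have [|N NS] := IH; first by move=> e' e'l; apply: lS; rewrite inE e'l orbT.
  have [|n nS] := lS e; first by rewrite inE eqxx.
  exists (N + n)%N => e'; rewrite inE exprD => /predU1P[->|/NS NSe].
    by rewrite -mulrA rmorphM /= rmorphM /=; exact: idealM.
  by rewrite [h ^+ N * _]mulrC -mulrA rmorphM /= rmorphM /=; exact: idealM.
exists N; apply: isec_loc => y [p _ <-]; have [e el pe] := lcov p (specP p).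
exists (chart_image fI (basic_open e)), (@chart_sub e); split; last exact: NS.
by exists p.
Qed.

Definition chart_ideal : ideal A := ideal_preim (chart_sec fI) (J (chart_top fI)).

(** A germ in J is locally a / g on the basic open set of h. Then a is in J there, so h^n a is in J
    on the whole chart, and h^n g is invertible at p. *)
Lemma stalk_ideal_chart p :
  stalk_ideal J (f p : Y) = iext (chart_germ fI p) chart_ideal.
Proof.
have pP := specP p; have pL := chart_localization fI p.
apply: ideal_ext => b; split; last first.
  move: b; apply: gen_min => _ [a Ja <-].
  by exists (chart_top fI), (chart_top_mem fI p), (chart_sec fI a).
move=> [U [Up [s [Js ->]]]]; have [h [a [g [ph hU sE]]]] := ev_local s Up.
have [n Jn] : exists n, chart_ideal (h ^+ n * a).
  apply: ideal_sheaf_power_kill.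
  have -> : res (@chart_sub h) (chart_sec fI a) =
      res (@chart_sub h) (chart_sec fI g) * res (chart_image_min hU) s.
    apply: chart_sec_ext => q qh; rewrite evM !ev_res !ev_chart_sec.
    have [gq ->] := sE q (chart_image_min hU (chart_image_sub fI qh)) qh.
    rewrite /loc_pi loc_fracM; apply/loc_fracP.
    by exists 1; [exact: mset1|ring].
  by apply: idealM; exact: isec_res.
have [pg _] := sE p Up ph.
apply/(iextP pP pL); exists (h ^+ n * a), (h ^+ n * g); split=> //.
  by apply: primeM => // /(primeX pP).
by rewrite !rmorphM mulrCA (germ_frac fI Up ph hU sE).
Qed.

End ClosedSubscheme.

(** * Inclusions of closed subschemes *)

Section QuotientMap.
Variables (R : comPzRingType) (I I' : ideal R).
Hypothesis II' : I `<=` I'.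

Definition quot_map (c : quot I) : quot I' := quot_pi I' (qrep c).

Lemma quot_piP (J : ideal R) x y : quot_pi J x = quot_pi J y <-> J (x - y).
Proof. exact: (@qclP (quot_pre J)). Qed.

Lemma quot_pi_qrep (J : ideal R) (c : quot J) : quot_pi J (qrep c) = c.
Proof. exact: qrepK. Qed.

Lemma quot_map_pi x : quot_map (quot_pi I x) = quot_pi I' x.
Proof. by apply/quot_piP; apply: II'; exact: (@qclK (quot_pre I)). Qed.

Lemma quot_map_zmod : {morph quot_map : x y / x - y}.
Proof.
move=> x y; rewrite -(quot_pi_qrep x) -(quot_pi_qrep y) -rmorphB.
by rewrite !quot_map_pi rmorphB.
Qed.

Lemma quot_map_monoid : monoid_morphism quot_map.
Proof.
split=> [|x y]; first by rewrite -(rmorph1 (quot_pi I)) quot_map_pi rmorph1.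
rewrite -(quot_pi_qrep x) -(quot_pi_qrep y) -rmorphM.
by rewrite !quot_map_pi rmorphM.
Qed.

End QuotientMap.

(** The unique maximal ideal contains I, and would contain x as well if x were not a unit; then it
    would contain 1. *)
Lemma local_unit_mod (R : comPzRingType) (I : ideal R) x c : noetherian_ring R ->
  local_ring R -> proper_ideal I -> I (x * c - 1) -> is_unit x.
Proof.
move=> noethR [M Mmax Muniq] Ip Ixc; apply: contrapT => xu.
have inM K : proper_ideal K -> K `<=` M.
  move=> Kp; have [|L [Lp KL] Lmax] := noeth_max noethR
    (P := fun L => proper_ideal L /\ K `<=` L) (I := K); first by split.
  suff LM : maximal_ideal L by rewrite -(Muniq L LM).
  split=> // L' LL' L'p; rewrite (Lmax L') //; split=> //.
  exact: subset_trans LL'.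
have Mx : M x.
  apply: (inM (iadj (ideal_bot R) x)); last exact: iadj_mem.
  apply/proper1 => -[a]; rewrite /= => /subr0_eq xa; apply: xu; exists a.
  by rewrite mulrC.
case: Mmax => /proper1 + _; apply.
have -> : 1 = x * c - (x * c - 1) by ring.
by apply: idealB; [exact: idealMr|exact: inM Ixc].
Qed.

Section ClosedSubschemeInclusion.
Variables (Y : ringed_space) (K1 K2 : ideal_sheaf Y).
Hypothesis K12 : forall y, stalk_ideal K1 y `<=` stalk_ideal K2 y.
Let X1 := closed_sub K1.
Let X2 := closed_sub K2.

Lemma support_sub : support K2 `<=` support K1.
Proof.
by move=> y /proper1 y2; apply/proper1 => y1; apply: y2; exact: K12.
Qed.

Definition sub_pt (z : X2) : X1 := SigSub (mem_set (support_sub (set_valP z))).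

Lemma sub_pt_continuous : continuous sub_pt.
Proof. by apply/continuousP => _ [W Wo <-]; exists W. Qed.

Section Comorphism.
Variables (V : opens X1) (U : opens X2).
Hypothesis h : U `<=` sub_pt @^-1` V.

Lemma sub_comor_subproof (s : \O_X1 V) :
  loc_presentable (closed_sub_presentation K2)
    (fun z (Uz : U z) =>
       quot_map (stalk_ideal K2 (closed_sub_val z)) (lpval s (h Uz))).
Proof.
move=> z Uz; have [V' [k [V'z [W [t [kW sE]]]]]] := svalP s _ (h Uz).
have o : open (U `&` sub_pt @^-1` V').
  apply: openI; first exact: oset_open.
  by move/continuousP: sub_pt_continuous; apply; exact: oset_open.
exists (Opens o), (fun w => @proj1 _ _); split=> //.
exists W, t, (fun w Uw => kW _ (proj2 Uw)) => w Uw.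
rewrite -(quot_map_pi (@K12 (closed_sub_val w))) -(sE _ (proj2 Uw)).
by congr quot_map; rewrite /lpval; congr (sval _ _ _).
Qed.

Definition sub_comor (s : \O_X1 V) : \O_X2 U := exist _ _ (sub_comor_subproof s).

Lemma sub_comor_zmod : {morph sub_comor : s t / s - t}.
Proof.
move=> s t; apply: lpsec_eq => z Uz; rewrite [RHS]lpvalB.
rewrite -[LHS]/(quot_map (stalk_ideal K2 (closed_sub_val z)) (lpval (s - t) (h Uz))).
by rewrite lpvalB (quot_map_zmod (@K12 (closed_sub_val z))).
Qed.

Lemma sub_comor_monoid : monoid_morphism sub_comor.
Proof.
have H (z : X2) := quot_map_monoid (@K12 (closed_sub_val z)).
split=> [|s t]; apply: lpsec_eq => z Uz; first exact: (H z).1.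
exact: (H z).2.
Qed.

HB.instance Definition _ :=
  GRing.isZmodMorphism.Build (\O_X1 V) (\O_X2 U) sub_comor sub_comor_zmod.
HB.instance Definition _ :=
  GRing.isMonoidMorphism.Build (\O_X1 V) (\O_X2 U) sub_comor sub_comor_monoid.

End Comorphism.

Lemma sub_comor_res (V V' : opens X1) (U U' : opens X2)
    (hV : V' `<=` V) (hU : U' `<=` U)
    (h : U `<=` sub_pt @^-1` V) (h' : U' `<=` sub_pt @^-1` V') (s : \O_X1 V) :
  res hU (sub_comor h s) = sub_comor h' (res hV s).
Proof.
apply: lpsec_eq => z Uz; rewrite /lpval /= /lpval /=; congr quot_map.
by congr (sval _ _ _).
Qed.

Definition sub_mor : rs_mor X2 X1 :=
  @RsMor X2 X1 sub_pt sub_pt_continuous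
    (fun V U h => GRing.RMorphism.clone _ _ (sub_comor h) _) sub_comor_res.

Lemma sub_mor_incl : rs_mor_eq (rs_comp (closed_sub_incl K1) sub_mor) (closed_sub_incl K2).
Proof.
split=> // V U hf hg s; apply: lpsec_eq => z Uz; rewrite /lpval /= /lpval /=.
rewrite (quot_map_pi (@K12 (closed_sub_val z))); congr (quot_pi _ (germ _ _)).
exact: Prop_irrelevance.
Qed.

(** If 1 lies in the stalk at y, it is already a section of K on a neighbourhood of y. *)
Lemma support_closed (K : ideal_sheaf Y) : closed (support K).
Proof.
rewrite -[support K]setCK; apply: open_closedC; rewrite openE => y /= yK.
have [U [Uy [s [Ks s1]]]] : stalk_ideal K y 1.
  by apply: contrapT => H; apply: yK; apply/proper1.
have [W [k [k' [Wy e]]]] : exists W : opens Y, exists h : W `<=` U,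
    exists k : W `<=` U, W y /\ res h 1 = res k s.
  by apply/(germP Uy Uy); rewrite rmorph1.
apply: (filterS (P := W)); last by apply: open_nbhs_nbhs; split=> //; exact: oset_open.
move=> y' Wy' /proper1; apply; exists W, Wy', (res k' s); split.
  exact: isec_res.
by rewrite -e !rmorph1.
Qed.

Lemma sub_pt_range (w : X1) : range sub_pt w <-> support K2 (closed_sub_val w).
Proof.
split=> [[z _ <-]|w2]; first exact: (set_valP z).
by exists (SigSub (mem_set w2)) => //; apply: val_inj.
Qed.

Lemma sub_pt_range_closed : closed (range sub_pt).
Proof.
have -> : range sub_pt = @closed_sub_val Y K1 @^-1` support K2.
  by apply/seteqP; split=> w /sub_pt_range.
apply: closed_comp; last exact: support_closed.
by move=> w _; exact: initial_continuous.
Qed.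

Lemma sub_pt_open (U : opens X2) :
  exists V : opens X1, (U : set X2) = sub_pt @^-1` V.
Proof.
have [W Wo WU] := oset_open U.
have Vo : open (@closed_sub_val Y K1 @^-1` W) by exists W.
by exists (Opens Vo); rewrite -WU.
Qed.

(** Off the closed image the preimage of a small neighbourhood is empty and 0 is a lift; on the
    image s is locally induced by a section of O_Y, which also induces a section on X1. *)
Lemma sub_mor_surjective (V : opens X1) (s : \O_X2 (open_preim sub_mor V)) (w : X1) :
  V w -> exists (W : opens X1) (h : W `<=` V) (t : \O_X1 W)
    (k : open_preim sub_mor W `<=` open_preim sub_mor V),
    W w /\ comor_preim sub_mor W t = res k s.
Proof.
move=> Vw; have [[z _ zw]|nw] := pselect (range sub_pt w); last first.
  have o : open (V `&` ~` range sub_pt).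
    by apply: openI; [exact: oset_open|apply: closed_openC; exact: sub_pt_range_closed].
  pose k : open_preim sub_mor (Opens o) `<=` open_preim sub_mor V :=
    fun z Wz => proj1 Wz.
  exists (Opens o), (fun x => @proj1 _ _), 0, k; split=> //.
  by apply: lpsec_eq => z Wz; case: (proj2 Wz); exists z.
have Vz : open_preim sub_mor V z by rewrite /= zw.
have [U [kU [Uz [W0 [t0 [hU sE]]]]]] := svalP s z Vz.
have [V1 V1E] := sub_pt_open U.
have W1o : open (@closed_sub_val Y K1 @^-1` W0).
  by exists W0 => //; exact: oset_open.
pose W := open_setI V (open_setI V1 (Opens W1o)).
have WV : W `<=` V by exact: oI_l.
have WW0 : W `<=` @closed_sub_val Y K1 @^-1` W0 by move=> x [_ []].
pose k : open_preim sub_mor W `<=` open_preim sub_mor V := fun z Wz => WV _ Wz.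
exists W, WV, (closed_sub_comor WW0 t0), k; split.
  rewrite -zw; split=> //; split; last exact: (hU z Uz).
  by have := Uz; rewrite V1E.
apply: lpsec_eq => x Wx.
have Ux : U x by rewrite V1E; exact: (proj1 (proj2 Wx)).
rewrite /lpval /= /lpval /= (quot_map_pi (@K12 (closed_sub_val x))).
transitivity (sval s x (kU x Ux)); last by congr (sval _ _ _); exact: Prop_irrelevance.
rewrite sE; congr (quot_pi _ (germ _ _)); exact: Prop_irrelevance.
Qed.

Hypothesis Y_local : locally_ringed Y.
Hypothesis Y_noeth : forall y : Y, noetherian_ring (stalk y).

(** Locally s is induced by a section t of O_Y. If its pullback is a unit, t is a unit modulo the
    stalk of K2, hence a unit in the local ring of Y, and its inverse induces one of s. *)
Lemma sub_mor_local : local_mor sub_mor.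
Proof.
move=> z V U h Uz s [v sv].
have [U' [U'z [r rE]]] := stalkP v.
have [V' [k [V'z [W [t [kW sE]]]]]] := svalP s _ (h z Uz).
pose y := closed_sub_val z; have Wy : W y := kW _ V'z.
have [c tc] : is_unit (germ Wy t).
  move: sv; rewrite rE -(rmorph1 (germ Uz)).
  have Wz : open_setI U U' z by split.
  rewrite -(germ_res (@oI_l _ U U') Uz Wz) -(germ_res (@oI_r _ U U') U'z Wz).
  rewrite -rmorphM => /germP[N [a [b [Nz e]]]].
  have {e} := congr1 (fun x => lpval x Nz) e.
  rewrite rmorphM rmorph1 lpvalM lpval1.
  set c := (X in X * _ = _); set d := (X in _ * X = _).
  have -> : c = quot_pi (stalk_ideal K2 y) (germ Wy t).
    rewrite /c /lpval /= /lpval /= -(quot_map_pi (@K12 y)); congr quot_map.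
    rewrite (Prop_irrelevance Wy (kW _ V'z)); apply: etrans (sE _ V'z).
    congr (sval _ _ _); exact: Prop_irrelevance.
  rewrite -(quot_pi_qrep d) -rmorphM.
  rewrite -(rmorph1 (quot_pi (stalk_ideal K2 y))) => /quot_piP.
  apply: local_unit_mod => //.
  exact: (set_valP z).
have [W' [W'y [t' cE]]] := stalkP c.
have [N [n [n' [Ny e]]]] : exists N : opens Y, exists n : N `<=` W,
    exists n' : N `<=` W', N y /\ res n t * res n' t' = 1.
  have Wy' : open_setI W W' y by split.
  move: tc; rewrite cE -(rmorph1 (germ Wy')).
  rewrite -(germ_res (@oI_l _ W W') Wy Wy') -(germ_res (@oI_r _ W W') W'y Wy').
  rewrite -rmorphM => /germP[N [a [b [Ny e]]]].
  exists N, (subset_trans a (@oI_l _ W W')), (subset_trans a (@oI_r _ W W')).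
  by split=> //; rewrite -!resE -rmorphM e rmorph1.
have Ho : open (V' `&` @closed_sub_val Y K1 @^-1` N).
  apply: openI; first exact: oset_open.
  by exists N => //; exact: oset_open.
pose H : opens X1 := Opens Ho.
have HV : H `<=` V by move=> w [/k].
have HW' : H `<=` @closed_sub_val Y K1 @^-1` W' by move=> w [_ /n'].
have Hz : H (sub_pt z) by split.
exists (@germ X1 (sub_pt z) H Hz (closed_sub_comor HW' t')).
rewrite -(germ_res HV (h z Uz) Hz) -rmorphM -(rmorph1 (germ Hz)).
congr germ; apply: lpsec_eq => w Hw; rewrite lpvalM lpval1.
have -> : lpval (res HV s) Hw = quot_pi _ (germ (kW w (proj1 Hw)) t).
  rewrite -sE; rewrite /lpval /= /lpval /=; congr (sval _ _ _).
  exact: Prop_irrelevance.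
rewrite [lpval (closed_sub_comor _ _) _]/(quot_pi _ (germ (HW' w Hw) t')).
rewrite -rmorphM -(rmorph1 (quot_pi _)); congr (quot_pi _ _).
have Nw : N (closed_sub_val w) by exact: (proj2 Hw).
rewrite -(germ_res n _ Nw) -(germ_res n' (HW' w Hw) Nw) -rmorphM e.
exact: rmorph1.
Qed.

Lemma sub_mor_closed_immersion : closed_immersion sub_mor.
Proof.
split; [exact: sub_mor_local|split| |exact: sub_mor_surjective].
- by move=> z z' /(congr1 (@closed_sub_val Y K1)) zz'; apply: val_inj.
- exact: sub_pt_range_closed.
- exact: sub_pt_open.
Qed.

End ClosedSubschemeInclusion.

(** * Comparison of the thickenings *)

Lemma symbolic_pow_leq (A : comPzRingType) (I : ideal A) (m n : nat) :
  (m <= n)%N -> symbolic_pow I n `<=` symbolic_pow I m.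
Proof.
move=> mn x xn Ip p pI; have /ker_quot_locP[s ps Is] := xn Ip p pI.
by apply/ker_quot_locP; exists s => //; exact: pow_leq Is.
Qed.

Section StalkPowers.
Variables (Y : ringed_space) (J : ideal_sheaf Y) (y : Y).

Lemma stalk_ideal_sympow m :
  stalk_ideal (ideal_sheaf_sympow J m) y `<=` symbolic_pow (stalk_ideal J y) m.
Proof. by move=> _ [U [Uy [s [Js ->]]]]; exact: Js. Qed.

Lemma stalk_ideal_pow n :
  ideal_pow (stalk_ideal J y) n `<=` stalk_ideal (ideal_sheaf_pow J n) y.
Proof.
elim: n => [|n IH].
  move=> b _; have [U [Uy [s ->]]] := stalkP b; exists U, Uy, s; split=> //.
  move=> x Ux; exists U, (@subset_refl _ _); split=> //; exact: pow0.
apply: powS_min => _ b [U [Uy [s [Js ->]]]] /IH[V [Vy [t [Jt ->]]]].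
have [W [k [Wy Jt']]] := Jt y Vy.
pose UW := open_setI U W; have UWy : UW y by [].
exists UW, UWy, (res (@oI_l _ U W) s * res (@oI_r _ U W) (res k t)); split.
  move=> x UWx; exists UW, (@subset_refl _ _); split=> //.
  rewrite rmorphM; apply: powS; first by apply: isec_res; exact: isec_res.
  rewrite res_id; apply: ideal_pow_morph Jt' => r; exact: isec_res.
by rewrite rmorphM /= (germ_res _ Uy) (germ_res _ Wy) (germ_res k Vy).
Qed.

End StalkPowers.

(** Otherwise the complements generate a proper filter, and a cluster point of it would lie in no U
    n. *)
Lemma compact_increasing_cover (T : topologicalType) (U : nat -> set T) :
  compact [set: T] -> (forall n, open (U n)) ->
  (forall m n, (m <= n)%N -> U m `<=` U n) ->
  (forall x, exists n, U n x) -> exists n, forall x, U n x.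
Proof.
move=> Tc Uo Umono Ucov; apply: contrapT => /forallNP H.
pose F := filter_from [set: nat] (fun n => ~` U n).
have FF : ProperFilter F.
  apply: filter_from_proper; last first.
    by move=> n _; have /existsNP[x Ux] := H n; exists x.
  apply: filter_from_filter; first by exists 0%N.
  move=> m n _ _; exists (maxn m n) => // x Ux.
  by split=> Ux'; apply: Ux; apply: Umono Ux'; rewrite ?leq_maxl ?leq_maxr.
have [x [_ xF]] := Tc F FF (ex_intro2 _ _ 0%N Logic.I (fun _ _ => Logic.I)).
have [n Un] := Ucov x.
have [z []] := xF (~` U n) (U n) (ex_intro2 _ _ n Logic.I (@subset_refl _ _))
  (open_nbhs_nbhs (conj (Uo n) Un)).
by [].
Qed.

Lemma symbolic_sub_power_sheaf (X Y : ringed_space) (i : rs_mor X Y)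
    (J : ideal_sheaf Y) (n : nat) :
  noetherian_scheme Y -> regular_scheme Y -> closed_subscheme_defined_by i J ->
  exists m, forall y : Y,
    symbolic_pow (stalk_ideal J y) m.+1 `<=` ideal_pow (stalk_ideal J y) n.
Proof.
move=> [_ Yc Ych] [_ Yreg] iJ.
pose good m (y : Y) := symbolic_pow (stalk_ideal J y) m.+1 `<=`
  ideal_pow (stalk_ideal J y) n.
(* The sets [good m] grow with m, and each point lies in the interior of one of them because a
   single m works on a whole chart. *)
have [|k m|y|m mP] := @compact_increasing_cover Y (fun m => interior (good m)) Yc.
- by move=> m; exact: open_interior.
- move=> km; apply: interiorS => y ygood.
  by apply: subset_trans ygood; exact: symbolic_pow_leq.
- have [A [f [noethA fI [p _ <-]]]] := Ych y.
  have regA q : prime_ideal q -> exists (B : comPzRingType)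
      (phi : {rmorphism A -> B}), is_localization phi q /\ regular_local_ring B.
    move=> qP; exists (stalk (f (SpecPoint qP) : Y)), (chart_germ fI (SpecPoint qP)).
    by split; [exact: (chart_localization fI (SpecPoint qP))|exact: Yreg].
  have [m mI] := symbolic_sub_uniform noethA regA (chart_ideal J fI) n.
  exists m; apply: (filterS (P := chart_top fI)).
    move=> _ [q _ <-]; rewrite /good (stalk_ideal_chart iJ noethA fI).
    exact: mI (specP q) _ _ (chart_localization fI q).
  apply: open_nbhs_nbhs; split; first exact: oset_open.
  exact: chart_top_mem.
by exists m => y; exact: interior_subset (mP y).
Qed.

Unset Implicit Arguments.

Theorem proposition1p3p6 (Y X : ringed_space) (i : rs_mor X Y)
    (J : ideal_sheaf Y)
    (Y_noetherian : noetherian_scheme Y)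
    (Y_regular : regular_scheme Y)
    (X_closed : closed_subscheme_defined_by i J)
    (J_radical : locally_radical J) :
  forall n : nat, (1 <= n)%N ->
  exists m : nat, (1 <= m)%N /\
    exists k : rs_mor (power_thickening J n) (symbolic_thickening J m),
      closed_immersion k /\
      rs_mor_eq (rs_comp (closed_sub_incl (ideal_sheaf_sympow J m)) k)
                (closed_sub_incl (ideal_sheaf_pow J n)).
Proof.
move=> n _.
have [m mP] := symbolic_sub_power_sheaf n Y_noetherian Y_regular X_closed.
exists m.+1; split=> //.
have sub y : stalk_ideal (ideal_sheaf_sympow J m.+1) y `<=`
    stalk_ideal (ideal_sheaf_pow J n) y.
  apply: (subset_trans (@stalk_ideal_sympow _ _ _ _)).
  exact: subset_trans (mP y) (@stalk_ideal_pow _ _ _ _).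
have [[Y_local _] _ _] := Y_noetherian.
exists (sub_mor sub); split; last exact: sub_mor_incl.
apply: sub_mor_closed_immersion => // y.
by have [_ /(_ y)[]] := Y_regular.
Qed.
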